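(* There is a compact Ahlfors regular (in particular doubling) metric measure space satisfying a Poincaré inequality which admits a bilipschitz embedding in $L_1$, but which does not admit a bilipschitz embedding in any Banach space with the Radon–Nikodym property (such as $\ell_1$).
   Context: ''Bilipschitz embeds in $L_1$'' means admits a bilipschitz embedding into $L_1(Z,\mu)$ for some measure space $(Z,\mu)$. A map $f:X\to Y$ is a bilipschitz embedding if there is $L\ge1$ with $L^{-1}d(x,x')\le d(f(x),f(x'))\le L\,d(x,x')$ for all $x,x'$. A metric measure space $(X,d,\nu)$ ($\nu$ a Borel measure) is Ahlfors regular if for some $Q>0$ and $c\ge 1$, $c^{-1}r^Q\le\nu(B(x,r))\le c\,r^Q$ for all $x\in X$ and $0<r\le\operatorname{diam}(X)$. It satisfies a Poincaré inequality if for some $p\in[1,\infty)$ and constants $\tau,\lambda\ge1$, for every ball $B=B(x,r)$, every Lipschitz function $h:X\to\mathbb{R}$ and every upper gradient $g$ of $h$, $\frac{1}{\nu(B)}\int_B|h-h_B|\,d\nu\le\tau r\left(\frac{1}{\nu(\lambda B)}\int_{\lambda B}g^p\,d\nu\right)^{1/p}$, where $h_B$ is the $\nu$-average of $h$ over $B$ and $\lambda B=B(x,\lambda r)$. A Banach space $V$ has the Radon–Nikodym property if every Lipschitz map $\mathbb{R}\to V$ is differentiable almost everywhere. $\ell_1$ is the space of summable sequences. *)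

(* Defs.v *)
From HB Require Import structures.
From mathcomp Require Import all_boot all_order all_algebra.
From mathcomp Require Import all_classical all_reals all_analysis.
From mathcomp Require Import measurable_realfun.

Set Implicit Arguments.
Unset Strict Implicit.
Unset Printing Implicit Defensive.

Import Order.TTheory GRing.Theory Num.Theory.
Import numFieldNormedType.Exports.

Local Open Scope classical_set_scope.
Local Open Scope ring_scope.

(* Measurable types are pointed in MathComp-Analysis, so the Borel
   sigma-algebra is only available on pointed (i.e., nonempty) spaces. *)
#[short(type="pmetricType")]
HB.structure Definition PointedMetric (K : numDomainType) :=
  {X of Metric K X & Pointed X}.

Notation borel X := (g_sigma_algebraType (@open X)).

Definition norm_dist {R : numDomainType} {V : normedModType R} (u v : V) : R :=
  `|u - v|.

Definition lipschitz_dist {R : numDomainType} {X Y : Type}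
    (dX : X -> X -> R) (dY : Y -> Y -> R) (f : X -> Y) :=
  exists L : R, forall x x', dY (f x) (f x') <= L * dX x x'.

Definition bilipschitz_dist {R : numFieldType} {X Y : Type}
    (dX : X -> X -> R) (dY : Y -> Y -> R) (f : X -> Y) :=
  exists2 L : R, 1 <= L &
    forall x x', L^-1 * dX x x' <= dY (f x) (f x') <= L * dX x x'.

Section embeddings.
Context {R : realType}.

Definition L1_dist {d} {Z : measurableType d} (mu : {measure set Z -> \bar R})
    (f g : LspaceType1 mu) : R :=
  fine 'N[mu]_1[EFin \o ((f : Z -> R) \- (g : Z -> R))%R]%E.

Definition bilipschitz_embeds_in_L1 (X : metricType R) :=
  exists (d : measure_display) (Z : measurableType d)
         (mu : {measure set Z -> \bar R}) (f : X -> LspaceType1 mu),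
    bilipschitz_dist (@mdist R X) (@L1_dist d Z mu) f.

Definition bilipschitz_embeds_in_Banach
    (X : metricType R) (V : completeNormedModType R) :=
  exists f : X -> V, bilipschitz_dist (@mdist R X) norm_dist f.

Definition radon_nikodym_property (V : completeNormedModType R) :=
  forall f : R -> V, lipschitz_dist norm_dist norm_dist f ->
    {ae lebesgue_measure, forall t : R, differentiable f t}.

End embeddings.

Section curves.
Context {R : realType} {X : metricType R}.
Implicit Types (a b : R) (gam : R -> X).

Definition curve_variation a b gam (s : seq R) : R :=
  let F := gam \o nth b (a :: s) in
  \sum_(0 <= n < size s) mdist (F n) (F n.+1).

Definition curve_length a b gam : \bar R :=
  ereal_sup [set (curve_variation a b gam s)%:E | s in itv_partition a b].

Definition rectifiable_curve a b gam :=
  [/\ a <= b, {within `[a, b], continuous gam} &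
      (curve_length a b gam < +oo)%E].

(* For a rectifiable curve, any u in [a, b] such that gam restricted to [a, u]
   has length t gives the same point gam u. *)
Definition arclength_param a b gam (t : R) : X :=
  gam (xget a [set u | u \in `[a, b] /\ curve_length a u gam = t%:E]).

Definition line_integral a b gam (g : X -> \bar R) : \bar R :=
  (\int[lebesgue_measure]_(t in `[0%R, fine (curve_length a b gam)])
     g (arclength_param a b gam t))%E.

End curves.

Section metric_measure_spaces.
Context {R : realType}.

Definition upper_gradient {X : pmetricType R} (h : X -> R) (g : X -> \bar R) :=
  [/\ measurable_fun [set: borel X] (g : borel X -> \bar R),
      (forall x, 0 <= g x)%E &
      forall a b gam, rectifiable_curve a b gam ->
        (`|h (gam a) - h (gam b)|%:E <= line_integral a b gam g)%E].

Definition diam (X : metricType R) : \bar R :=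
  ereal_sup [set (mdist x.1 x.2)%:E | x in [set: X * X]].

Context {X : pmetricType R} (nu : {measure set (borel X) -> \bar R}).

Definition Ahlfors_regular :=
  exists Q c : R, [/\ 0 < Q, 1 <= c &
    forall (x : X) (r : R), 0 < r -> (r%:E <= diam X)%E ->
      ((c^-1 * r `^ Q)%:E <= nu (ball x r) <= (c * r `^ Q)%:E)%E].

Definition doubling :=
  exists2 C : R, 1 <= C &
    forall (x : X) (r : R), 0 < r ->
      (0 < nu (ball x r) < +oo)%E /\
      (nu (ball x (2 * r)) <= C%:E * nu (ball x r))%E.

Definition average (B : set X) (h : X -> R) : R :=
  (fine (nu B))^-1 * \int[nu]_(y in B) h y.

Definition Poincare_inequality :=
  exists p tau lam : R, [/\ 1 <= p, 1 <= tau, 1 <= lam &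
    forall (x : X) (r : R), 0 < r ->
    forall (h : X -> R) (g : X -> \bar R),
      lipschitz_dist (@mdist R X) norm_dist h -> upper_gradient h g ->
      let B := ball x r in let lamB := ball x (lam * r) in
      ((nu B)^-1 * \int[nu]_(y in B) `|h y - average B h|%:E <=
       (tau * r)%:E *
         ((nu lamB)^-1 * \int[nu]_(y in lamB) (g y `^ p)) `^ p^-1)%E].

End metric_measure_spaces.

Section l1.
Context (R : realType).

Definition summable_seq : {pred nat -> R} :=
  [pred x : nat -> R | `[< cvgn [normed series x] >]].

Record l1 := L1seq { l1val :> nat -> R ; l1valP : l1val \in summable_seq }.

HB.instance Definition _ := [isSub for l1val].

HB.instance Definition _ := [Choice of l1 by <:].

Lemma summable_seq_bounded (x : nat -> R) (M : R) :
  (forall n, \sum_(0 <= i < n) `|x i| <= M) ->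
  x \in summable_seq /\ limn [normed series x] <= M.
Proof.
move=> xM; have cx : cvgn [normed series x].
  apply: nondecreasing_is_cvgn.
    by apply: nondecreasing_series => i _ _; exact: normr_ge0.
  by exists M => _ [n _ <-]; exact: xM.
split; first exact/asboolP.
by apply: limr_le => //; near=> n; exact: xM.
Unshelve. all: by end_near. Qed.

Lemma summable_seq_le (x : nat -> R) n : x \in summable_seq ->
  \sum_(0 <= i < n) `|x i| <= limn [normed series x].
Proof.
move=> /asboolP cx; apply: (nondecreasing_cvgn_le _ cx).
by apply: nondecreasing_series => i _ _; exact: normr_ge0.
Qed.

Lemma summable_seq_submod_closed : submod_closed summable_seq.
Proof.
split.
  have [] // := @summable_seq_bounded 0 0 => n.
  by rewrite big1// => i _; rewrite normr0.
move=> k x y sx sy.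
have [] // := @summable_seq_bounded (k *: x + y)
  (`|k| * limn [normed series x] + limn [normed series y]) => n.
rewrite (le_trans _ (lerD (ler_wpM2l (normr_ge0 k) (summable_seq_le n sx))
  (summable_seq_le n sy)))// mulr_sumr -big_split/= ler_sum// => i _.
by rewrite (le_trans (ler_normD _ _))// normrM.
Qed.

HB.instance Definition _ :=
  GRing.isSubmodClosed.Build R (nat -> R) summable_seq
    summable_seq_submod_closed.

HB.instance Definition _ := [SubChoice_isSubLmodule of l1 by <:].

Definition l1norm (x : l1) : R := limn [normed series x].

Lemma l1norm_ge (x : l1) n : \sum_(0 <= i < n) `|x i| <= l1norm x.
Proof. exact/summable_seq_le/valP. Qed.

Lemma l1norm_le (x : l1) M :
  (forall n, \sum_(0 <= i < n) `|x i| <= M) -> l1norm x <= M.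
Proof. by move=> /summable_seq_bounded[]. Qed.

Lemma l1norm_coord (x : l1) n : `|x n| <= l1norm x.
Proof.
apply: le_trans (l1norm_ge x n.+1).
by rewrite big_nat_recr//= lerDr sumr_ge0.
Qed.

Lemma l1normD (x y : l1) : l1norm (x + y) <= l1norm x + l1norm y.
Proof.
apply: l1norm_le => n.
rewrite (le_trans _ (lerD (l1norm_ge x n) (l1norm_ge y n)))//.
by rewrite -big_split/= ler_sum// => i _; exact: ler_normD.
Qed.

Lemma l1normZ_le (k : R) (x : l1) : l1norm (k *: x) <= `|k| * l1norm x.
Proof.
apply: l1norm_le => n.
rewrite (le_trans _ (ler_wpM2l (normr_ge0 k) (l1norm_ge x n)))//.
by rewrite mulr_sumr ler_sum// => i _; rewrite normrM.
Qed.

Lemma l1norm0_eq0 (x : l1) : l1norm x = 0 -> x = 0.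
Proof.
move=> x0; apply/val_inj/funext => n; apply/eqP.
by rewrite -normr_le0 -x0; exact: l1norm_coord.
Qed.

Lemma l1normZ (k : R) (x : l1) : l1norm (k *: x) = `|k| * l1norm x.
Proof.
apply/eqP; rewrite eq_le l1normZ_le/=.
have [->|k0] := eqVneq k 0.
  rewrite normr0 mul0r; apply: le_trans (l1norm_coord _ 0%N).
  exact: normr_ge0.
rewrite -ler_pdivlMl ?normr_gt0//.
by rewrite -{1}[x](scalerK k0) -normfV l1normZ_le.
Qed.

HB.instance Definition _ :=
  Lmodule_isNormed.Build R l1 l1normD l1normZ l1norm0_eq0.

Lemma l1_complete (F : set_system l1) : ProperFilter F -> cauchy F -> cvg F.
Proof.
move=> FF /cauchy_ballP Fc.
have coord_lip (u v : l1) n : `|u n - v n| <= `|u - v|.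
  exact: (l1norm_coord (u - v)).
have cvg_coord n : cvg ((fun u : l1 => u n : R) @ F).
  apply: cauchy_cvg; apply/cauchy_exP => e e0.
  have /cauchyP/(_ _ e0)[u Fu] : cauchy F by exact/cauchy_ballP.
  exists (u n).
  suff : F [set v : l1 | ball (u n) e (v n)] by [].
  apply: filterS Fu => v; rewrite /= -!ball_normE /=.
  by apply: le_lt_trans; exact: coord_lip.
pose y n : R := lim ((fun u : l1 => u n : R) @ F).
have close (e : R) : 0 < e ->
    F [set u : l1 | forall n, \sum_(0 <= i < n) `|u i - y i| <= e].
  move=> e0.
  have Fe : F [set u | F (ball u e)].
    exact: (@nearP_dep l1 l1 F F _ _ _ (Fc e e0)).
  apply: filterS Fe => u uv n.
  have cvy : (fun v : l1 => \sum_(0 <= i < n) `|u i - v i|) @ F -->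
      (\sum_(0 <= i < n) `|u i - y i| : R).
    apply: cvg_big => [|i _]; first exact: add_continuous.
    apply: cvg_norm; apply: cvgB; first exact: cvg_cst.
    exact: cvg_coord.
  apply: (cvgr_to_le cvy); apply: filterS uv => v.
  rewrite -ball_normE/= => /ltW; apply: le_trans.
  exact: (l1norm_ge (u - v)).
have sy : y \in summable_seq.
  have /filter_ex[u uy] := close 1 ltr01.
  have [] // := @summable_seq_bounded y (l1norm u + 1) => n.
  rewrite (le_trans _ (lerD (l1norm_ge u n) (uy n)))// -big_split/=.
  rewrite ler_sum// => i _.
  by rewrite -{1}(subKr (u i) (y i)) (le_trans (ler_normB _ _)).
apply/cvg_ex; exists (L1seq sy); apply/cvgrPdist_le => e e0.
apply: filterS (close e e0) => u uy; rewrite distrC.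
exact: (@l1norm_le (u - L1seq sy)).
Qed.

HB.instance Definition _ := Uniform_isComplete.Build l1 l1_complete.

End l1.

(* Main.v *)
Require Import Defs.
From HB Require Import structures.
From mathcomp Require Import all_boot all_order all_algebra.
From mathcomp Require Import all_classical all_reals all_analysis.
From mathcomp Require Import measurable_realfun ring lra zify.


(** The space is a Laakso space, realized inside l_infinity. Let [h m t] be the
    distance from [t] to the odd multiples of [2 ^- m], the wormholes of level
    [m]. A point is a height [t] in [0, 1] together with numbers [u m] such that
    [`|u m| = h m t]; the metric is the supremum of all differences of
    coordinates. The sign of [u m] names one of two branches of level [m], and the
    branches of level [m] are glued where [h m t = 0], that is at the wormholes of
    level [m]. A choice of all signs, a sequence of coins, gives a line along
    which the height is an isometric parameter. The space carries the image [nu]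
    of the uniform measure on pairs (height, coins).

    - Geometry. Let [c] be the multiple of [2 ^- l] nearest to the height of [x].
      Points within [2 ^- (l + 1)] of [x] have the signs of [x] on all levels
      [m <= l], except for the single level of which [c] may be a wormhole
      ([ball_side]). Hence balls have measure comparable to the square of the
      radius ([nu_Ahlfors]), and a ball is comparable to a cell, the product of a
      window of heights and a cylinder of coins ([ball_cell]). Compactness holds
      because the space is a continuous image of an interval times a Cantor set.

    - The Poincare inequality with exponent 1 ([laakso_Poincare]). Along lines an
      upper gradient bounds oscillations. To pass from one line of a cell to
      another, walk along the line towards [c]: at height [c + 2 ^- (l + j)] there
      is a wormhole of level [l + j], where coin [l + j] can be averaged out for
      free. The average over finitely many coins is compared with the value at
      [c] by telescoping; flips of coins preserve the measure, so that the total
      cost is one passage over the cell ([cell_estimate]).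

    - No embedding in a space [V] with the Radon-Nikodym property
      ([laakso_not_embeds_RNP]). A curve may change its branch of level [m]
      whenever it passes a wormhole of level [m], and remains 1-Lipschitz. On each
      interval between two wormholes the two branches have midpoints at distance
      [2 * 2 ^- m], so under a bilipschitz map at least one of the images is far
      from the mean of the images of the ends. Choosing that branch on every
      interval of a sparse sequence of levels makes the image of the curve nowhere
      differentiable.

    - The embedding in L1 ([laakso_embeds_L1]). A random slice cuts every line at
      one height. At stage [n] it sits at a multiple of [2 ^- n] on each line, and
      it proceeds by a step -1, 0 or 1 in units of [2 ^- (n + 1)], decided by coins
      that belong to the vertex where it sits; lines through a common vertex share
      these coins, and lines at different vertices have independent ones. A
      point is sent to the indicator of the event that the slice runs below it,
      mixed with its height. Crossings of any line are uniformly distributed at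
      each stage ([slice_law]), which bounds the distance of images from above
      ([coinP_apart_le]). For the lower bound ([mdist_le_apart]), let [m] be a level
      at which two points at distance [d] and of nearly equal heights have
      opposite signs. With probability comparable to [d] the slice visits on both
      lines a vertex near them up to which the lines look the same; it may then
      diverge on them, running below one point and above the other.

    - The Radon-Nikodym property of l1 ([l1_radon_nikodym]). Coordinates of a
      Lipschitz curve are integrals of densities [k i], by the Radon-Nikodym
      theorem ([lipschitz_density]). Difference quotients show that the sum of
      [`|k i t|] is bounded, so almost every [t] is a point of differentiability of
      all coordinates and of the integrals of the tails of that sum; the latter
      dominate the tails of the increments of the curve ([l1_derivable]). *)

Set Implicit Arguments.
Unset Strict Implicit.
Unset Printing Implicit Defensive.

Import Order.TTheory GRing.Theory Num.Theory.
Import numFieldNormedType.Exports.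

Local Open Scope classical_set_scope.
Local Open Scope ring_scope.

(** * Dyadic grids and wormhole levels *)

Section grids.
Context {R : realType}.
Implicit Types (m n l : nat) (s t c w : R) (k : int).

Definition e2 n : R := 2^-1 ^+ n.

Lemma e2_gt0 n : 0 < e2 n.
Proof. by rewrite exprn_gt0// invr_gt0. Qed.

Lemma e2_ge0 n : 0 <= e2 n.
Proof. exact/ltW/e2_gt0. Qed.

Lemma e2_neq0 n : e2 n != 0.
Proof. by rewrite gt_eqF// e2_gt0. Qed.

Lemma e2S n : e2 n = 2 * e2 n.+1.
Proof. by rewrite /e2 exprS mulrA divff// mul1r. Qed.

Lemma e2D m n : e2 (m + n) = e2 m * e2 n.
Proof. exact: exprD. Qed.

Lemma e2_le m n : (m <= n)%N -> e2 n <= e2 m.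
Proof.
by move=> mn; rewrite ler_wiXn2l// ?invr_ge0// invf_le1// ler1n.
Qed.

Lemma e2_le1 n : e2 n <= 1.
Proof. exact: (@e2_le 0). Qed.

Lemma e2_small (e : R) : 0 < e -> exists n, e2 n < e.
Proof.
move=> e0; have e20 : (@GRing.exp R 2^-1 n) @[n --> \oo] --> (0 : R).
  by apply: cvg_expr; rewrite ger0_norm ?invr_ge0// invf_lt1// ltr1n.
have /cvgrPdist_lt/(_ _ e0)[n _ /(_ n (leqnn n))] := e20.
rewrite /= sub0r normrN => hn; exists n.
by move: hn; rewrite ger0_norm// -/(e2 n) e2_ge0.
Qed.

(** The factor [q] allows the dyadic windows to be shifted. *)
Lemma e2_window (q r : R) : 0 < r -> r <= q ->
  exists n, q * e2 n.+1 < r <= q * e2 n.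
Proof.
move=> r0 rq; have q0 := lt_le_trans r0 rq.
have [n] := @e2_small (r / q) (divr_gt0 r0 q0).
rewrite ltr_pdivlMr// mulrC => nr.
have : exists n, q * e2 n < r by exists n.
move=> /ex_minnP[[|j]]; first by rewrite /e2 expr0 mulr1 ltNge rq.
move=> jr jmin; exists j; rewrite jr/= leNgt; apply/negP => /jmin.
by rewrite ltnn.
Qed.

Definition grid n c := exists k, c = k%:~R * e2 n.

Lemma grid_le m n c : (m <= n)%N -> grid m c -> grid n c.
Proof.
move=> /subnKC <- [k ->]; exists (k * (2 ^ (n - m))%N%:Z).
rewrite e2D intrM -pmulrn natrX; set d := (n - m)%N.
have -> : k%:~R * 2 ^+ d * (e2 m * e2 d) = k%:~R * e2 m * (2 * 2^-1) ^+ d :> R.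
  by rewrite exprMn /e2; ring.
by rewrite divff// expr1n mulr1.
Qed.

Lemma grid_sep n a c : grid n a -> grid n c -> a != c -> e2 n <= `|a - c|.
Proof.
move=> [k ->] [j ->] ac; rewrite -mulrBl normrM (ger0_norm (e2_ge0 n)).
rewrite ler_peMl ?e2_ge0// -intrB -intr_norm ler1z.
have kj : k != j by apply: contra ac => /eqP ->.
lia.
Qed.

Lemma grid_eq n a c : grid n a -> grid n c -> `|a - c| < e2 n -> a = c.
Proof.
move=> ga gc; apply: contraTeq => ac; rewrite -leNgt.
exact: grid_sep ga gc ac.
Qed.

Lemma gridD n a c : grid n a -> grid n c -> grid n (a + c).
Proof. by move=> [k ->] [j ->]; exists (k + j); rewrite intrD mulrDl. Qed.

Lemma grid_e2 n : grid n (e2 n).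
Proof. by exists 1; rewrite mul1r. Qed.

Lemma grid1 n : grid n 1.
Proof. by apply: (@grid_le 0) => //; exists 1; rewrite mulr1. Qed.

Lemma grid_near n t : 0 <= t <= 1 ->
  exists c, [/\ grid n c, `|t - c| <= e2 n.+1 & 0 <= c <= 1].
Proof.
move=> /andP[t0 t1].
pose k := Num.floor (t / e2 n); have e0 := e2_gt0 n.
have : k%:~R <= t / e2 n < (k + 1)%:~R.
  by rewrite /k floor_le_tmp/= floorD1_gt.
rewrite ler_pdivlMr// ltr_pdivrMr// intrD mulrDl mul1r => /andP[k1 k2].
have gk : grid n (k%:~R * e2 n) by exists k.
have gk1 : grid n (k%:~R * e2 n + e2 n) by apply: gridD => //; exact: grid_e2.
have e2n := e2S n.
have lo : 0 <= k%:~R * e2 n.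
  by rewrite mulr_ge0 ?e2_ge0// ler0z floor_ge0 divr_ge0// ltW.
have [h|h] := leP t (k%:~R * e2 n + e2 n.+1).
  exists (k%:~R * e2 n); split => //; last lra.
  by rewrite ger0_norm; lra.
exists (k%:~R * e2 n + e2 n); split => //.
  by rewrite ler0_norm; lra.
apply/andP; split; first lra.
rewrite leNgt; apply/negP => h1.
have := grid_sep gk1 (grid1 n) (negbT (gt_eqF h1)).
by rewrite ger0_norm; lra.
Qed.

(** The odd integer nearest to [s]. *)
Definition odd_near s : int := 2 * Num.floor (s / 2) + 1.

(** The wormholes of level [m] are the odd multiples of [e2 m]; [h m t] is the
    distance from [t] to the nearest one. *)
Definition h m t : R := `|t - (odd_near (t / e2 m))%:~R * e2 m|.

Lemma hP m t : exists k, h m t = `|t - (2 * k + 1)%:~R * e2 m|.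
Proof. by exists (Num.floor (t / e2 m / 2)). Qed.

Lemma h_ge0 m t : 0 <= h m t. Proof. exact: normr_ge0. Qed.

Lemma h_le m t k : h m t <= `|t - (2 * k + 1)%:~R * e2 m|.
Proof.
have e0 := e2_gt0 m; rewrite /h.
pose s := t / e2 m; have ts : t = s * e2 m by rewrite divfK// e2_neq0.
rewrite -/s ts -!mulrBl !normrM ler_pM2r ?normr_gt0 ?e2_neq0//.
rewrite /odd_near; set j := Num.floor (s / 2).
have : j%:~R <= s / 2 < (j + 1)%:~R by rewrite /j floor_le_tmp/= floorD1_gt.
rewrite ler_pdivlMr// ltr_pdivrMr// => /andP[j1 j2].
have j3 : `|s - (2 * j + 1)%:~R| <= 1.
  by move: j1 j2; rewrite !(intrD,intrM) => j1 j2; rewrite ler_norml; lra.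
have [<-//|kj] := eqVneq k j.
apply: le_trans j3 _.
have [kj'|kj'] : (k + 1 <= j) \/ (j + 1 <= k) by lia.
  have : (k + 1)%:~R <= j%:~R :> R by rewrite ler_int.
  by move: j1 j2; rewrite !(intrD,intrM) => j1 j2 jk; rewrite ler_normr; lra.
have : (j + 1)%:~R <= k%:~R :> R by rewrite ler_int.
by move: j1 j2; rewrite !(intrD,intrM) => j1 j2 jk; rewrite ler_normr; lra.
Qed.

Lemma h_lip m s t : `|h m s - h m t| <= `|s - t|.
Proof.
wlog st : s t / h m t <= h m s.
  have [/[swap]|/ltW /[swap]] := leP (h m t) (h m s); first by apply.
  by move=> wl ?; rewrite distrC (distrC s); exact: wl.
rewrite ger0_norm ?subr_ge0// lerBlDr.
have [k ->] := hP m t.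
by rewrite (le_trans (h_le m s k))// (le_trans _ (ler_normD _ _))// addrA subrK.
Qed.

Lemma h_bound m t : h m t <= e2 m.
Proof.
have e0 := e2_gt0 m; rewrite /h.
pose s := t / e2 m; have ts : t = s * e2 m by rewrite divfK// e2_neq0.
rewrite -/s {1}ts -!mulrBl normrM (ger0_norm (e2_ge0 m)) ler_piMl ?e2_ge0//.
rewrite /odd_near; set j := Num.floor (s / 2).
have : j%:~R <= s / 2 < (j + 1)%:~R by rewrite /j floor_le_tmp/= floorD1_gt.
rewrite ler_pdivlMr// ltr_pdivrMr// => /andP[].
rewrite !(intrD,intrM) => j1 j2; rewrite ler_norml; lra.
Qed.

Lemma h_odd m k : h m ((2 * k + 1)%:~R * e2 m) = 0.
Proof. by apply/eqP; rewrite eq_le h_ge0 andbT (le_trans (h_le m _ k))// subrr normr0. Qed.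

Lemma h_near m t : exists w, [/\ h m w = 0, grid m w & h m t = `|t - w|].
Proof.
have [k hk] := hP m t; exists ((2 * k + 1)%:~R * e2 m).
by rewrite h_odd; split=> //; exists (2 * k + 1).
Qed.

Lemma h_le_dist m t w : h m w = 0 -> h m t <= `|t - w|.
Proof. by move=> w0; have := h_lip m t w; rewrite w0 subr0 ger0_norm// h_ge0. Qed.

Lemma h0_odd m c : h m c = 0 -> exists k, c = (2 * k + 1)%:~R * e2 m.
Proof.
have [k ->] := hP m c => /normr0_eq0/eqP; rewrite subr_eq0 => /eqP ->.
by exists k.
Qed.

Lemma h0_grid m c : h m c = 0 -> grid m c.
Proof. by move=> /h0_odd[k ->]; exists (2 * k + 1). Qed.

(** Points of a coarser grid lie halfway between wormholes of level [n]. *)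
Lemma h_coarse m n c : (m < n)%N -> grid m c -> h n c = e2 n.
Proof.
move=> mn gc; apply/eqP; rewrite eq_le h_bound/=.
have [w [w0 gw ->]] := h_near n c.
apply: grid_sep => //; first exact: grid_le (ltnW mn) gc.
apply/eqP => cw; have [k wk] := h0_odd w0.
have : grid n.-1 w by rewrite -cw; apply: grid_le gc; lia.
case: n mn {gw w0} wk => // n _ -> [j /=]; rewrite (e2S n) mulrA.
move/(mulIf (e2_neq0 _)) => kj.
have /eqP : (2 * k + 1)%:~R = (j * 2)%:~R :> R by rewrite kj intrM.
by rewrite eqr_int; lia.
Qed.

(** The level of a wormhole is the number of its binary digits. *)
Lemma h0_unique m n c : h m c = 0 -> h n c = 0 -> m = n.
Proof.
wlog mn : m n / (m < n)%N.
  have [mn|nm|//] := ltngtP m n => wl hm hn; first exact: wl.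
  by apply/esym; exact: wl.
move=> /h0_grid gm hn; have := h_coarse mn gm.
by rewrite hn => /esym/eqP; rewrite (negbTE (e2_neq0 _)).
Qed.

(** Near a grid point there are wormholes of all finer levels: these are the
    heights where branches can be changed on the way to the point. *)
Lemma h_shift m n c (b : bool) : (m < n)%N -> grid m c ->
  h n (c + (-1) ^+ b * e2 n) = 0.
Proof.
move=> mn [k ->]; have -> : n = (m + (n - m).-1.+1)%N by lia.
set d := (n - m).-1; have -> : (m + d.+1)%N = (m + d).+1 by rewrite addnS.
have [j ->] : grid (m + d) (k%:~R * e2 m).
  by apply: (@grid_le m); [lia|exists k].
have -> : j%:~R * e2 (m + d) + (-1) ^+ b * e2 (m + d).+1 =
    (2 * (j - b%:Z) + 1)%:~R * e2 (m + d).+1.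
  by rewrite (e2S (m + d)) !(intrD,intrM,intrN); case: b => /=;
    rewrite ?expr0 ?expr1; ring.
exact: h_odd.
Qed.

Lemma grid_h m n c : (m <= n)%N -> grid n c -> h m c != 0 -> e2 n <= h m c.
Proof.
move=> mn gc hc; have [w [w0 gw hw]] := h_near m c.
rewrite hw; apply: grid_sep => //; first exact: grid_le gw.
by apply: contra hc => /eqP ->; rewrite w0.
Qed.

End grids.

(** * The Laakso space *)

(** A point is a height [pos] together with, for each level [m], a signed copy
    [co m] of the distance from the height to the wormholes of level [m]: the
    two branches of level [m] carry opposite signs and are glued exactly at the
    wormholes, where the distance vanishes. *)
Record laakso (R : realType) := Laakso {
  pos : R;
  co : nat -> R;
  laaksoP : (0 <= pos <= 1) /\ forall m, `|co m| = h m pos }.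

Section laakso_space.
Context {R : realType}.
Local Notation X := (laakso R).
Implicit Types (x y z : X) (s t r : R) (b : nat -> bool) (m n : nat).

HB.instance Definition _ := gen_eqMixin X.
HB.instance Definition _ := gen_choiceMixin X.

Lemma laakso_eq x y : pos x = pos y -> co x =1 co y -> x = y.
Proof.
case: x y => [t u p] [s v q] /= ts /funext uv.
by move: p q; rewrite ts uv => p q; rewrite (Prop_irrelevance p q).
Qed.

Lemma pos01 x : 0 <= pos x <= 1.
Proof. by case: (laaksoP x). Qed.

Lemma norm_co x m : `|co x m| = h m (pos x).
Proof. by case: (laaksoP x). Qed.

Lemma norm_co_le x m : `|co x m| <= e2 m.
Proof. by rewrite norm_co h_bound. Qed.

Definition co_gap x y : set R := range (fun m => `|co x m - co y m|).

(** The distance that l_infinity induces on the sequences of coordinates. *)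
Definition ldist x y : R := Num.max `|pos x - pos y| (sup (co_gap x y)).

Lemma co_gap_sup x y : has_sup (co_gap x y).
Proof.
split; first by exists `|co x 0%N - co y 0%N|, 0%N.
exists 2 => _ [m _ <-]; rewrite (le_trans (ler_normB _ _))//.
have := norm_co_le x m; have := norm_co_le y m; have := @e2_le1 R m; lra.
Qed.

Lemma ldist_le x y r :
  ldist x y <= r <-> `|pos x - pos y| <= r /\ forall m, `|co x m - co y m| <= r.
Proof.
rewrite /ldist ge_max; split.
  move=> /andP[-> h]; split=> // m; apply: le_trans h.
  by apply: ub_le_sup; [case: (co_gap_sup x y)|exists m].
move=> [-> h]/=; apply: ge_sup; first by case: (co_gap_sup x y).
by move=> _ [m _ <-].
Qed.

Lemma ldist_pos x y : `|pos x - pos y| <= ldist x y.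
Proof. by have [] := (ldist_le x y (ldist x y)).1 (lexx _). Qed.

Lemma ldist_co x y m : `|co x m - co y m| <= ldist x y.
Proof. by have [] := (ldist_le x y (ldist x y)).1 (lexx _). Qed.

Let ldistxx x : ldist x x = 0.
Proof.
apply/eqP; rewrite eq_le (le_trans _ (ldist_pos x x))// andbT.
by apply/ldist_le; split=> [|m]; rewrite subrr normr0.
Qed.

Let ldist_positivity x y : ldist x y = 0 -> x = y.
Proof.
move=> xy0; have zero (a c : R) : `|a - c| <= ldist x y -> a = c.
  by rewrite xy0 normr_le0 subr_eq0 => /eqP.
by apply: laakso_eq => [|m]; apply: zero; [exact: ldist_pos|exact: ldist_co].
Qed.

Let ldist_sym x y : ldist x y = ldist y x.
Proof.
have sym u v : ldist u v <= ldist v u.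
  by apply/ldist_le; split=> [|m]; rewrite distrC; [exact: ldist_pos|exact: ldist_co].
by apply/eqP; rewrite eq_le !sym.
Qed.

Let ldist_triangle y x z : ldist x z <= ldist x y + ldist y z.
Proof.
apply/ldist_le; split=> [|m].
  by rewrite (le_trans (ler_distD (pos y) _ _))// lerD// ldist_pos.
by rewrite (le_trans (ler_distD (co y m) _ _))// lerD// ldist_co.
Qed.

HB.instance Definition _ :=
  isMetric.Build R X ldistxx ldist_positivity ldist_sym ldist_triangle.

Lemma mdist_leP x y r :
  mdist x y <= r <-> `|pos x - pos y| <= r /\ forall m, `|co x m - co y m| <= r.
Proof. exact: ldist_le. Qed.

Lemma mdist_pos x y : `|pos x - pos y| <= mdist x y.
Proof. exact: ldist_pos. Qed.

Lemma mdist_co x y m : `|co x m - co y m| <= mdist x y.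
Proof. exact: ldist_co. Qed.

Definition clamp t : R := Num.max 0 (Num.min 1 t).

Lemma clampP t : [\/ t <= 0 /\ clamp t = 0, 0 <= t <= 1 /\ clamp t = t |
  1 <= t /\ clamp t = 1].
Proof.
rewrite /clamp; have [t1|t1] := leP 1 t; first by apply: Or33; rewrite max_r.
have [t0|t0] := leP 0 t; first by apply: Or32; rewrite (ltW t1).
by apply: Or31; rewrite ltW.
Qed.

Lemma clamp01 t : 0 <= clamp t <= 1.
Proof. by case: (clampP t) => [] [t0 ->]//; rewrite ?lexx ?ler01. Qed.

Lemma clamp_id t : 0 <= t <= 1 -> clamp t = t.
Proof. by move=> /andP[t0 t1]; rewrite /clamp min_r// max_r. Qed.

Lemma clamp_lip s t : `|clamp s - clamp t| <= `|s - t|.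
Proof.
have [st|/ltW st] := leP s t.
  rewrite [leRHS]ler0_norm ?subr_le0// ler_norml.
  by case: (clampP s) => [] [s0 ->]; case: (clampP t) => [] [t0 ->];
    apply/andP; split; lra.
rewrite [leRHS]ger0_norm ?subr_ge0// ler_norml.
by case: (clampP s) => [] [s0 ->]; case: (clampP t) => [] [t0 ->];
  apply/andP; split; lra.
Qed.

Definition sg (b : bool) : R := (-1) ^+ b.

Lemma normr_sg (b : bool) : `|sg b| = 1.
Proof. exact: normr_sign. Qed.

(** The height is projected to [0, 1] so that lines are total functions. *)
Definition pt t b : X.
Proof.
exists (clamp t) (fun m => sg (b m) * h m (clamp t)).
split=> [|m]; first exact: clamp01.
by rewrite normrM normr_sg mul1r ger0_norm// h_ge0.
Defined.

Definition side x m : bool := co x m < 0.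

Lemma coE x m : co x m = sg (side x m) * h m (pos x).
Proof.
rewrite /sg /side -norm_co; case: ltP => [/ltr0_norm ->|/ger0_norm ->].
  by rewrite expr1 mulrN mulN1r opprK.
by rewrite mul1r.
Qed.

Lemma pt_side x : pt (pos x) (side x) = x.
Proof. by apply: laakso_eq => [|m] /=; rewrite clamp_id ?pos01// -coE. Qed.

HB.instance Definition _ := isPointed.Build X (pt 0 xpred0).

(** Opposite signs add up: crossing from one branch to the other costs the
    distances of both points to the wormholes. *)
Lemma co_opp x y m : side x m != side y m ->
  `|co x m - co y m| = h m (pos x) + h m (pos y).
Proof.
rewrite [co x m]coE [co y m]coE /sg; have hx := h_ge0 m (pos x).
have hy := h_ge0 m (pos y).
by case: (side x m) (side y m) => [] [] //= _;
  rewrite ?expr1 ?expr0 ?mulN1r ?mul1r;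
  [rewrite ler0_norm; lra|rewrite ger0_norm; lra].
Qed.

Lemma co_same x y m : side x m = side y m ->
  `|co x m - co y m| <= `|pos x - pos y|.
Proof.
move=> xy; rewrite [co x m]coE [co y m]coE xy -mulrBr normrM normr_sg mul1r.
exact: h_lip.
Qed.

(** A level on which the branches agree contributes no more than the heights do,
    because [h] is 1-Lipschitz. *)
Lemma mdist_pt_le s t b c r : `|s - t| <= r ->
  (forall m, b m != c m -> h m (clamp s) + h m (clamp t) <= r) ->
  mdist (pt s b) (pt t c) <= r.
Proof.
move=> str bc; apply/mdist_leP; split=> [|m] /=.
  exact: le_trans (clamp_lip s t) str.
have [bcm|/bc] := eqVneq (b m) (c m).
  rewrite bcm -mulrBr normrM normr_sg mul1r (le_trans (h_lip _ _ _))//.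
  exact: le_trans (clamp_lip s t) str.
apply: le_trans; rewrite (le_trans (ler_normB _ _))// !normrM !normr_sg !mul1r.
by rewrite !ger0_norm ?h_ge0.
Qed.

Lemma mdist_pt s t b : 0 <= s <= 1 -> 0 <= t <= 1 ->
  mdist (pt s b) (pt t b) = `|s - t|.
Proof.
move=> s01 t01; apply/eqP; rewrite eq_le; apply/andP; split.
  by apply: mdist_pt_le => // m; rewrite eqxx.
by have := mdist_pos (pt s b) (pt t b); rewrite /= !clamp_id.
Qed.

Lemma pt_eq t b c : 0 <= t <= 1 -> (forall m, b m = c m \/ h m t = 0) ->
  pt t b = pt t c.
Proof.
move=> t01 bc; apply: laakso_eq => //= m; rewrite clamp_id//.
by have [->//|->] := bc m; rewrite !mulr0.
Qed.

Lemma mdist_le2 x y : mdist x y <= 2.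
Proof.
apply/mdist_leP; split=> [|m].
  by move: (pos01 x) (pos01 y) => /andP[? ?] /andP[? ?]; rewrite ler_norml; lra.
rewrite (le_trans (ler_normB _ _))//.
have := norm_co_le x m; have := norm_co_le y m; have := @e2_le1 R m; lra.
Qed.

(** The local structure of the space at scale [e2 l]: to leave the branch of
    [x] of a level [m <= l] costs the distance from [x] to a wormhole of that
    level, and [c] is the only point of the grid that is near enough. *)
Lemma ball_side l x y c : grid l c -> `|pos x - c| <= e2 l.+1 ->
  mdist x y < e2 l.+1 ->
  forall m, (m <= l)%N -> side x m = side y m \/ h m c = 0.
Proof.
move=> gc xc xy m ml; have [|/co_opp xym] := eqVneq (side x m) (side y m).
  by left.
right; have [w [w0 gw xw]] := h_near m (pos x).
suff -> : c = w by [].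
apply: (grid_eq gc (grid_le ml gw)).
have := mdist_co x y m; rewrite xym xw => hm.
have := h_ge0 m (pos y); have := ler_distD (pos x) c w.
by rewrite (e2S l) (distrC c (pos x)); lra.
Qed.

End laakso_space.

Definition laakso_pmetric (R : realType) : pmetricType R := laakso R.

(** * A coin-tossing space *)

Section coins.
Context {R : realType}.
Implicit Types (z t : R) (k j n : nat) (A D : set R).
Local Notation mu := (@lebesgue_measure R).

Definition dig n z : int := Num.floor (z / e2 n).

Lemma dig_itv n z : (dig n z)%:~R * e2 n <= z < (dig n z + 1)%:~R * e2 n.
Proof.
have e0 := @e2_gt0 R n.
by rewrite -ler_pdivlMr// -ltr_pdivrMr// floor_le_tmp/= floorD1_gt.
Qed.

Lemma dig_eq n z (i : int) : i%:~R * e2 n <= z < (i + 1)%:~R * e2 n ->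
  dig n z = i.
Proof.
have e0 := @e2_gt0 R n.
rewrite -ler_pdivlMr// -ltr_pdivrMr// => iz.
exact: floor_def.
Qed.

(** The [k]-th coin is the [k]-th binary digit of the fractional part. Fairness
    and independence all come from the maps [flip k], which preserve Lebesgue
    measure, reverse coin [k] and leave the other coins alone. *)
Definition coin k z : bool := dig k.+1 z == 2 * dig k z + 1.

Lemma dig_step k z : dig k.+1 z = 2 * dig k z + coin k z.
Proof.
rewrite /coin; have /andP[a1 a2] := dig_itv k z.
have [e|e] := ltP z ((2 * dig k z + 1)%:~R * e2 k.+1).
  have -> : dig k.+1 z = 2 * dig k z.
    by apply: dig_eq; rewrite e andbT; move: a1; rewrite (e2S k) intrM; lra.
  by rewrite (_ : (_ == _) = false) ?addr0//; lia.
have -> : dig k.+1 z = 2 * dig k z + 1 by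
  apply: dig_eq; rewrite e/=; move: a2; rewrite (e2S k) !(intrD,intrM); lra.
by rewrite eqxx.
Qed.

Definition flip k z : R := z + (-1) ^+ coin k z * e2 k.+1.

Lemma dig_addl n z (i : int) : dig n (z + i%:~R * e2 n) = dig n z + i.
Proof.
apply: dig_eq; have /andP[a1 a2] := dig_itv n z.
by move: a1 a2; rewrite !(intrD,intrM); lra.
Qed.

Lemma dig_flipS k j z :
  dig (k.+1 + j) (flip k z) = dig (k.+1 + j) z + (-1) ^+ coin k z * (2 ^ j)%N%:Z.
Proof.
rewrite /flip -(dig_addl (k.+1 + j)); congr (dig _ (_ + _)).
have E : (2 : R) ^+ j * e2 j = 1 by rewrite -exprMn mulfV// expr1n.
transitivity ((-1) ^+ coin k z * e2 k.+1 * (2 ^+ j * e2 j) : R).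
  by rewrite E mulr1.
by rewrite e2D intrM rmorph_sign -pmulrn natrX; ring.
Qed.

Lemma dig_inj k j z t : (j <= k)%N -> dig k z = dig k t -> dig j z = dig j t.
Proof.
move=> /subnKC <-; elim: (k - j)%N => [|d IH]; first by rewrite addn0.
rewrite addnS !dig_step => e; apply: IH; move: e.
by case: (coin _ z) (coin _ t) => [] []; lia.
Qed.

Lemma dig_flip_le k j z : (j <= k)%N -> dig j (flip k z) = dig j z.
Proof.
move=> jk; apply: (dig_inj jk).
have := dig_flipS k 0 z; rewrite addn0 !dig_step expn0 mulr1.
by case: (coin k z) (coin k _) => [] []; rewrite ?expr0 ?expr1; lia.
Qed.

Lemma coin_flip k z : coin k (flip k z) = ~~ coin k z.
Proof.
have := dig_flipS k 0 z; rewrite addn0 !dig_step expn0 mulr1 dig_flip_le//.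
by case: (coin k z) (coin k _) => [] []; rewrite ?expr0 ?expr1; lia.
Qed.

Lemma coin_flip_neq k j z : j != k -> coin j (flip k z) = coin j z.
Proof.
rewrite neq_ltn => /orP[jk|kj].
  have := dig_step j (flip k z); have := dig_step j z.
  rewrite (dig_flip_le _ jk) (dig_flip_le _ (ltnW jk)).
  by case: (coin j z) (coin j _) => [] []; lia.
move: (subnKC kj); move: (j - k.+1)%N => d jE; subst j => {kj}.
have := dig_step (k.+1 + d) (flip k z); have := dig_step (k.+1 + d) z.
rewrite -!addnS !dig_flipS expnS PoszM => ->.
move: (coin (k.+1 + d) z) (coin (k.+1 + d) (flip k z)) => c c'.
by case: c c' (coin k z) => [] [] []; rewrite ?expr0 ?expr1; lia.
Qed.

Lemma flipK k : involutive (flip k).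
Proof.
move=> z; rewrite {1}/flip coin_flip /flip.
by case: (coin k z) => /=; rewrite ?expr0 ?expr1; ring.
Qed.

Lemma measurable_dig n (i : int) : measurable [set z | dig n z = i].
Proof.
rewrite (_ : [set _ | _] = `[i%:~R * e2 n, (i + 1)%:~R * e2 n[%classic).
  exact: measurable_itv.
apply/seteqP; split=> z /=; rewrite in_itv/=.
  by move=> <-; exact: dig_itv.
exact: dig_eq.
Qed.

Lemma measurable_coin k (b : bool) : measurable [set z | coin k z = b].
Proof.
rewrite (_ : [set _ | _] =
    \bigcup_(i in [set: int]) [set z | dig k.+1 z = 2 * i + b]).
  apply: countable_bigcupT_measurable => [|i]; last exact: measurable_dig.
  exact: countableP.
apply/seteqP; split=> z /=.
  by move=> <-; exists (dig k z) => //=; exact: dig_step.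
move=> [i _ /=]; rewrite dig_step.
by case: (coin k z) b => [] []; lia.
Qed.

Lemma translation_measurable (c : R) : measurable_fun setT (fun z : measurableTypeR R => z + c : measurableTypeR R).
Proof. exact: measurable_funD. Qed.

Lemma lebesgue_translation (c : R) A : measurable A ->
  mu [set z | A (z + c)] = mu A.
Proof.
move=> mA.
pose T : measurableTypeR R -> measurableTypeR R := fun z => z + c.
rewrite -[LHS]/(pushforward mu T A).
apply/esym/lebesgue_measure_unique => //=.
  exact: translation_measurable.
move=> _ _ [[a b]] _ <-; rewrite /pushforward.
rewrite (_ : T @^-1` _ = `]a - c, b - c]%classic).
  rewrite !lebesgue_measure_itv/= !lte_fin ltrD2r.
  by case: ifP => // _; rewrite -!EFinB; congr EFin; ring.
by apply/seteqP; split=> z /=; rewrite /T !in_itv/= ltrBlDr lerBrDr.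
Qed.

Lemma measurable_flip k : measurable_fun setT (flip k : measurableTypeR R -> measurableTypeR R).
Proof.
move=> _ A mA; rewrite setTI.
rewrite (_ : _ @^-1` _ =
  ([set z | coin k z = false] `&` [set z | A (z + e2 k.+1)]) `|`
  ([set z | coin k z = true] `&` [set z | A (z + - e2 k.+1)])).
  have mt (c : R) : measurable [set z | A (z + c)].
    rewrite -[X in measurable X]setTI; exact: (@translation_measurable c).
  by apply: measurableU; apply: measurableI;
    [exact: (measurable_coin k false)|exact: mt|
     exact: (measurable_coin k true)|exact: mt].
apply/seteqP; split=> z /=; rewrite /flip.
  by case: (coin k z) => /=; rewrite ?expr0 ?expr1 ?mulN1r ?mul1r; [right|left].
by case: (coin k z) => /= -[] [] //; rewrite ?expr0 ?expr1 ?mulN1r ?mul1r.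
Qed.

(** On each of the two sets where coin [k] is constant, the flip is a
    translation onto the other one. *)
Lemma lebesgue_flip k A : measurable A -> mu [set z | A (flip k z)] = mu A.
Proof.
move=> mA; pose B b := [set z : R | coin k z = b].
have mB b : measurable (B b) by exact: measurable_coin.
have split_B D : measurable D -> mu D = (mu (D `&` B true) + mu (D `&` B false))%E.
  move=> mD; rewrite -measureU; try (apply: measurableI => //; exact: mB).
    rewrite -setIUr (_ : B true `|` B false = setT) ?setIT//.
    by apply/seteqP; split=> z //= _; rewrite /B/=; case: (coin k z); [left|right].
  by apply/seteqP; split=> z //= [[_]]; rewrite /B/= => -> [].
have mfA : measurable [set z | A (flip k z)].
  by rewrite -[X in measurable X]setTI; exact: measurable_flip.
rewrite split_B// [RHS]split_B// addeC.
have half b : [set z | A (flip k z)] `&` B (~~ b) =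
    [set z : R | (A `&` B b) (z + (-1) ^+ (~~ b) * e2 k.+1)].
  apply/seteqP; split=> z /=; rewrite /B/=.
    move=> [Az zb]; rewrite -zb -/(flip k z); split=> //.
    by rewrite coin_flip zb negbK.
  move=> [Az zb].
  have {}zb : coin k z = ~~ b.
    have : flip k (z + (-1) ^+ (~~ b) * e2 k.+1) = z.
      by rewrite /flip zb; case: (b) => /=; rewrite ?expr0 ?expr1; ring.
    by move=> <-; rewrite coin_flip zb.
  by split=> //; rewrite /flip zb.
by congr (_ + _)%E; [rewrite (half true)|rewrite (half false)];
  rewrite lebesgue_translation//; apply: measurableI => //; exact: mB.
Qed.

End coins.

Section coin_probability.
Context {R : realType}.
Implicit Types (z t : R) (k j n : nat) (A D : set R) (b : bool).
Local Notation mu := (@lebesgue_measure R).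
Local Notation Om := (measurableTypeR R).

Definition leb01 : set Om -> \bar R := mrestr mu (measurable_itv `[0%R, 1%R]).
HB.instance Definition _ := Measure.on leb01.

Lemma leb01T : leb01 setT = 1%E.
Proof. by rewrite /leb01 /mrestr setTI lebesgue_measure_itv/= lte01 oppr0 adde0. Qed.

HB.instance Definition _ :=
  Measure_isProbability.Build _ _ _ leb01 leb01T.

Definition coinP : set Om -> \bar R := mrestr mu (measurable_itv `[0%R, 1%R[).
HB.instance Definition _ := Measure.on coinP.

Lemma coinPT : coinP setT = 1%E.
Proof. by rewrite /coinP /mrestr setTI lebesgue_measure_itv/= lte01 oppr0 adde0. Qed.

HB.instance Definition _ :=
  Measure_isProbability.Build _ _ _ coinP coinPT.

Lemma coinP_flip k A : measurable A -> coinP [set z | A (flip k z)] = coinP A.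
Proof.
move=> mA; rewrite /coinP /mrestr -[RHS](lebesgue_flip k); last first.
  by apply: measurableI => //; exact: measurable_itv.
congr mu; apply/seteqP.
have dig0 z : (z \in `[0, 1[) = (dig 0 z == 0).
  rewrite in_itv/=; apply/idP/eqP => [z01|z0].
    by apply: dig_eq; rewrite mul0r add0r mul1r.
  by have := dig_itv 0 z; rewrite z0 mul0r add0r mul1r.
split=> z /= [Az]; rewrite dig0 => z0; split=> //; move: z0; rewrite dig0.
  by rewrite dig_flip_le.
by rewrite dig_flip_le.
Qed.

(** The flip exchanges the two halves of [A]. *)
Lemma coinP_half k b A : measurable A -> (forall z, A (flip k z) -> A z) ->
  coinP (A `&` [set z | coin k z = b]) = ((2^-1)%:E * coinP A)%E.
Proof.
move=> mA fA; pose B b := [set z : R | coin k z = b].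
have mAB c : measurable (A `&` B c).
  by apply: measurableI => //; exact: measurable_coin.
have AE c : coinP (A `&` B c) = coinP (A `&` B (~~ c)).
  rewrite -(coinP_flip k (mAB c)); congr coinP; apply/seteqP; split=> z /=.
    by rewrite /B/= coin_flip => -[/fA ? <-]; rewrite negbK.
  rewrite /B/= coin_flip => -[Az ->]; rewrite negbK; split=> //.
  by apply: fA; rewrite flipK.
have : coinP A = (coinP (A `&` B b) + coinP (A `&` B (~~ b)))%E.
  have BB : A = (A `&` B b) `|` (A `&` B (~~ b)).
    apply/seteqP; split=> z /=; last by case=> -[].
    by rewrite /B/=; case: (coin k z) (b) => [] []; [left|right|right|left].
  rewrite {1}BB; apply: measureU; [exact: mAB|exact: mAB|].
  by apply/seteqP; split=> z //= [[_]]; rewrite /B/= => -> []; case: (b).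
rewrite -AE -/(B b) => ->; have f : coinP (A `&` B b) \is a fin_num.
  apply: fin_num_measure; exact: mAB.
by rewrite -(fineK f) -EFinD -EFinM; congr EFin; lra.
Qed.

Lemma integral_flip k (D : set Om) (F : Om -> \bar R) : measurable D ->
  (forall z, D (flip k z) <-> D z) ->
  measurable_fun setT F -> (forall z, 0 <= F z)%E ->
  (\int[coinP]_(z in D) F (flip k z) = \int[coinP]_(z in D) F z)%E.
Proof.
move=> mD Dk mF F0.
transitivity (\int[pushforward coinP (flip k : Om -> Om)]_(z in D) F z)%E.
  rewrite ge0_integral_pushforward//.
  - by congr integral; apply/seteqP; split=> z /= /Dk.
  - exact: measurable_flip.
  - exact: measurable_funS mF.
apply: eq_measure_integral => //=; first exact: measurable_flip.
by move=> _ A mA _; exact: coinP_flip.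
Qed.

Lemma measurable_coins (s : seq nat) (P : set (seq bool)) :
  measurable [set z : Om | P [seq coin i z | i <- s]].
Proof.
rewrite (_ : [set _ | _] =
    \bigcup_(w in P) [set z | [seq coin i z | i <- s] = w]); last first.
  apply/seteqP; split=> [z Pz|z [w Pw /= zw]]; last by rewrite /= zw.
  by exists [seq coin i z | i <- s].
rewrite bigcup_mkcond; apply: countable_bigcupT_measurable => [|w].
  exact: countableP.
case: ifP => // _; elim: s w => [|i s IH] [|b w]/=.
- by rewrite (_ : [set _ | _] = setT)//; apply/seteqP; split.
- by rewrite (_ : [set _ | _] = set0)//; apply/seteqP; split.
- by rewrite (_ : [set _ | _] = set0)//; apply/seteqP; split.
rewrite (_ : [set _ | _] = [set z | coin i z = b] `&`
    [set z | [seq coin i z | i <- s] = w]).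
  by apply: measurableI => //; exact: measurable_coin.
by apply/seteqP; split=> z /=; [case|case=> -> ->].
Qed.

Lemma measurable_cyl (s : seq nat) (b : nat -> bool) :
  measurable [set z : Om | forall i, i \in s -> coin i z = b i].
Proof.
rewrite (_ : [set _ | _] =
  [set z | [seq coin i z | i <- s] = [seq b i | i <- s]]).
  exact: (measurable_coins s (fun w => w = [seq b i | i <- s])).
by apply/seteqP; split=> z /=; move/eq_in_map.
Qed.

Lemma coinP_cyl (s : seq nat) (b : nat -> bool) : uniq s ->
  coinP [set z : Om | forall i, i \in s -> coin i z = b i] = (e2 (size s))%:E.
Proof.
elim: s => [_|k s IH /= /andP[ks us]].
  rewrite (_ : [set _ | _] = setT) ?coinPT//; last by apply/seteqP; split.
rewrite (_ : [set _ | _] = [set z | forall i, i \in s -> coin i z = b i] `&`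
    [set z | coin k z = b k]).
  rewrite coinP_half ?IH//; first by rewrite /e2 exprS EFinM.
    exact: measurable_cyl.
  move=> z /= zs i si; rewrite -(zs i si) coin_flip_neq//.
  by apply: contraNneq ks => <-.
apply/seteqP; split=> z /=.
  by move=> h; split; [move=> i si|]; apply: h; rewrite ?in_cons ?eqxx ?si ?orbT.
by move=> [h zk] i; rewrite in_cons => /orP[/eqP ->|/h].
Qed.

End coin_probability.

(** * The measure and its Ahlfors regularity *)

Lemma open_mball (R : realType) (X : metricType R) (x : X) (r : R) :
  open (ball x r).
Proof.
rewrite openE => y; rewrite ballEmdist/= => xy.
apply/nbhs_ballP; exists (r - mdist x y); rewrite /= ?subr_gt0// => z.
rewrite !ballEmdist/= => yz; rewrite (le_lt_trans (metric_triangle _ y _))//.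
by rewrite -ltrBrDl.
Qed.

(** The preimage of an open set is a countable union of level sets of the maps
    [q n]. *)
Lemma measurable_countable_approx (R : realType) (d : measure_display)
    (T : measurableType d) (X : pmetricType R) (C : countType)
    (q : nat -> T -> C) (c : nat -> C -> X) (f : T -> X) :
  (forall n w, measurable [set t | q n t = w]) ->
  (forall n t, mdist (f t) (c n (q n t)) <= e2 n) ->
  measurable_fun [set: T] (f : T -> borel X).
Proof.
move=> mq fq; apply: (@measurability _ _ _ (borel X) _ _ (@open X)) => // _ [U oU <-].
rewrite setTI (_ : _ @^-1` U = \bigcup_n
    [set t | (ball (c n (q n t)) (2 * e2 n) `<=` U)%classic]).
  apply: bigcupT_measurable => n.
  pose S := [set w | (ball (c n w) (2 * e2 n) `<=` U)%classic].
  rewrite (_ : [set _ | _] = \bigcup_(w in S) [set t | q n t = w]).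
    rewrite bigcup_mkcond; apply: countable_bigcupT_measurable => [|w].
      exact: countableP.
    by case: ifP => _; [exact: mq|exact: measurable0].
  apply/seteqP; split=> [t St|t [w Sw /= tw]]; last by rewrite /= tw.
  by exists (q n t).
apply/seteqP; split=> t /=; last first.
  move=> [n _ /=]; apply; rewrite ballEmdist/= metric_sym.
  by rewrite (le_lt_trans (fq n t))// ltr_pMl ?e2_gt0// ltr1n.
move=> Uft; have /nbhs_ballP[/= e e0 fe] : nbhs (f t) U by exact: open_nbhs_nbhs.
have [n ne] := @e2_small R (e / 3) (divr_gt0 e0 (ltr0Sn _ 2)).
exists n => //= y; rewrite ballEmdist/= => yn; apply: fe.
rewrite ballEmdist/= (le_lt_trans (metric_triangle _ (c n (q n t)) _))//.
by have := fq n t; lra.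
Qed.

Section laakso_measure.
Context {R : realType}.
Local Notation X := (laakso R).
Local Notation Om := (measurableTypeR R).
Local Notation mu := (@lebesgue_measure R).
Implicit Types (x y : X) (s t r c : R) (l m n : nat).

Definition line (p : Om * Om) : X := pt p.1 (fun m => coin m p.2).

Lemma measurable_line : measurable_fun setT (line : Om * Om -> borel X).
Proof.
pose q n (p : Om * Om) := (dig n.+1 p.1, [seq coin i p.2 | i <- iota 0 n.+1]).
pose c n (w : int * seq bool) : X := pt (w.1%:~R * e2 n.+1) (nth false w.2).
apply: (@measurable_countable_approx R _ _ X _ q c).
  move=> n [i w]; rewrite (_ : [set _ | _] = [set t | dig n.+1 t = i] `*`
      [set z | [seq coin j z | j <- iota 0 n.+1] = w]).
    apply: measurableX; first exact: measurable_dig.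
    exact: (@measurable_coins _ _ (fun v => v = w)).
  by apply/seteqP; split=> -[t z] /=; rewrite /q/=; [case=> -> ->|case=> -> ->].
move=> n [t z]; apply: mdist_pt_le.
  rewrite /=; have := dig_itv n.+1 t; rewrite intrD mulrDl mul1r => /andP[a1 a2].
  by rewrite (e2S n) ger0_norm; have := @e2_ge0 R n.+1; lra.
move=> m; have [mn|nm _] := ltnP m n.+1.
  have -> : nth false (q n (t, z)).2 m = coin m z.
    by rewrite (nth_map 0%N) ?size_iota// nth_iota.
  by rewrite eqxx.
rewrite (e2S n) mulr2n mulrDl mul1r.
by apply: lerD; rewrite (le_trans (h_bound _ _))// e2_le.
Qed.

(** A uniformly random height on a uniformly random line. *)
Definition nu : set (borel X) -> \bar R :=
  @pushforward _ _ (Om * Om)%type (borel X) R (leb01 \x coinP)%E line.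

HB.instance Definition _ := Measure.copy nu
  (@measure_function_pushforward__canonical__measure_function_Measure
    _ _ _ _ _ (leb01 \x coinP)%E _ measurable_line).

Lemma nuT : nu setT = 1%E.
Proof.
rewrite /nu /pushforward preimage_setT -setXTT.
transitivity (@leb01 R setT * @coinP R setT)%E; last by rewrite leb01T coinPT mule1.
exact: product_measure1E.
Qed.

Lemma measurable_ballX x r : measurable (ball x r : set (borel X)).
Proof.
by apply: sub_sigma_algebra; exact: open_mball.
Qed.

Lemma measurable_line_ball x r : measurable (line @^-1` ball x r).
Proof.
rewrite -[X in measurable X]setTI; apply: measurable_line => //.
exact: measurable_ballX.
Qed.

Lemma nu_le1 (A : set (borel X)) : measurable A -> (nu A <= 1)%E.
Proof. by move=> mA; rewrite -nuT le_measure ?inE. Qed.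

(** Near [c] a branch of a level of which [c] is a wormhole can be changed at no
    cost, so that level is left free. *)
Definition cyl_levels l c : seq nat := [seq m <- iota 0 l.+1 | h m c != 0%R].

Definition cyl x l c : set Om :=
  [set z | forall m, m \in cyl_levels l c -> coin m z = side x m].

Lemma measurable_cylX x l c : measurable (cyl x l c).
Proof. exact: measurable_cyl. Qed.

(** A height is a wormhole of at most one level, so at most one level is
    dropped. *)
Lemma size_cyl_levels l c : (l <= size (cyl_levels l c))%N.
Proof.
rewrite size_filter -[X in (X <= _)%N]/(l.+1.-1) -[X in X.-1](size_iota 0 l.+1).
have := count_predC (fun m => h m c != 0%R) (iota 0 l.+1).
suff : (count (predC (fun m => h m c != 0%R)) (iota 0 l.+1) <= 1)%N by lia.
rewrite -size_filter.
have : uniq [seq m <- iota 0 l.+1 | predC (fun m => h m c != 0%R) m].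
  by rewrite filter_uniq// iota_uniq.
case E : [seq m <- _ | _] => [//|a [//|b w]] /= /andP[+ _].
have : a \in a :: b :: w by rewrite mem_head.
have : b \in a :: b :: w by rewrite !in_cons eqxx orbT.
rewrite -E !mem_filter /= !negbK => /andP[/eqP hb _] /andP[/eqP ha _].
by rewrite (h0_unique ha hb) mem_head.
Qed.

Lemma coinP_cylX x l c : (coinP (cyl x l c) <= (e2 l)%:E)%E.
Proof.
rewrite /cyl coinP_cyl ?filter_uniq ?iota_uniq// lee_fin.
by apply: e2_le; exact: size_cyl_levels.
Qed.

Definition window l c : set Om := [set s | `|clamp s - c| <= e2 l].

Lemma measurable_clamp : measurable_fun setT (clamp : Om -> Om).
Proof. by apply: measurable_maxr => //; exact: measurable_minr. Qed.

Lemma measurable_window l c : measurable (window l c).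
Proof.
rewrite (_ : window l c = clamp @^-1` `[c - e2 l, c + e2 l]%classic).
  by rewrite -[X in measurable X]setTI; apply: measurable_clamp.
by apply/seteqP; split=> s; rewrite /window/= in_itv/= ler_distl.
Qed.

Lemma line_clamp t z : line (clamp t, z) = line (t, z).
Proof.
by apply: laakso_eq => [|m] /=; rewrite (clamp_id (clamp01 _)).
Qed.

Lemma line_ball_sub l x c p : grid l c -> `|pos x - c| <= e2 l.+1 ->
  mdist x (line p) < e2 l.+1 -> window l c p.1 /\ cyl x l c p.2.
Proof.
case: p => t0 z; rewrite -line_clamp /window /=; move: (clamp01 t0).
move: (clamp t0) => t t01 gc xc tz.
have tc : `|t - c| < e2 l.
  rewrite (e2S l) distrC.
  have := mdist_pos x (line (t, z)); rewrite /line/= clamp_id//.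
  have := ler_distD (pos x) c t; rewrite (distrC c (pos x)).
  by move: tz xc; lra.
split; first exact: ltW.
move=> m; rewrite mem_filter mem_iota add0n => /andP[mc /andP[_ ml]].
have [|/eqP] := ball_side gc xc tz ml; last by rewrite (negbTE mc).
rewrite /side /line/= clamp_id// /sg => xm.
have ht : 0 < h m t.
  rewrite lt_neqAle h_ge0 andbT; apply: contra mc => /eqP ht.
  have tg := @grid_le _ m l _ ml (h0_grid (esym ht)).
  by rewrite (grid_eq gc tg) -?ht// distrC.
rewrite xm; case: (coin m z) => /=; rewrite ?expr1 ?expr0 ?mulN1r ?mul1r.
  by rewrite oppr_lt0 ht.
by rewrite ltNge ltW.
Qed.

Lemma leb01_window l c : (leb01 (window l c) <= (2 * e2 l)%:E)%E.
Proof.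
apply: (@le_trans _ _ (mu `[c - e2 l, c + e2 l]%classic)); last first.
  rewrite lebesgue_measure_itv/= lte_fin; case: ifP => _; rewrite lee_fin.
    by have := @e2_ge0 R l; lra.
  by rewrite mulr_ge0// e2_ge0.
apply: le_measure; rewrite ?inE; [|exact: measurable_itv|].
  by apply: measurableI; [exact: measurable_window|exact: measurable_itv].
move=> s [/=]; rewrite /window/= => + s01; rewrite clamp_id.
  by rewrite in_itv/= ler_distl.
by move: s01; rewrite in_itv.
Qed.

(** Up to constants, the ball of radius [e2 l] around the points of the lines through
    [x] at height [c]. *)
Definition cell x l c : set (Om * Om) := window l c `*` cyl x l c.

Lemma measurable_cell x l c : measurable (cell x l c).
Proof.
by apply: measurableX; [exact: measurable_window|exact: measurable_cylX].
Qed.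

(** A ball of radius about [e2 l] lies over a window of length comparable to
    [e2 l] and over a cylinder that fixes at least [l] coins: each factor
    contributes one power of the radius. *)
Lemma nu_ball_le x r : 0 < r -> (nu (ball x r) <= (32 * r ^+ 2)%:E)%E.
Proof.
move=> r0; have [r1|r1] := leP r 2^-1; last first.
  apply: le_trans (nu_le1 (measurable_ballX x r)) _.
  by rewrite lee_fin; nra.
have [l] := e2_window r0 r1; rewrite -[2^-1]expr1 -/(e2 1) -!e2D !add1n.
move=> /andP[r2 r3]; have [c [gc xc _]] := grid_near l (pos01 x).
apply: (@le_trans _ _ ((leb01 \x coinP)%E (cell x l c))); last first.
  apply: (@le_trans _ _ ((2 * e2 l)%:E * (e2 l)%:E)%E).
    rewrite [leLHS](product_measure1E leb01 coinP (measurable_window l c)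
      (measurable_cylX x l c)).
    by apply: lee_pmul => //; [exact: leb01_window|exact: coinP_cylX].
  rewrite -EFinM lee_fin; move: r2; rewrite (e2S l) (e2S l.+1) => r2.
  by have := @e2_gt0 R l.+2; nra.
rewrite {1}/nu /pushforward; apply: le_measure; rewrite ?inE.
- exact: measurable_line_ball.
- exact: measurable_cell.
- move=> p /=; rewrite ballEmdist/= => xp.
  by apply: line_ball_sub => //; exact: lt_le_trans r3.
Qed.

(** The ball contains the points over an interval of length [e2 n.+1] near the
    height of [x] that share the first [n.+1] branches of [x]. *)
Lemma nu_ball_ge x r : 0 < r -> r <= 2 ->
  ((16^-1 * r ^+ 2)%:E <= nu (ball x r))%E.
Proof.
move=> r0 r2; have [n /andP[n1 n2]] := e2_window r0 r2.
have [a [xa a0 a1]] : exists a, [/\ a <= pos x <= a + e2 n.+1, 0 <= a &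
    a + e2 n.+1 <= 1].
  have := pos01 x; have := @e2_le1 R n; have := @e2_gt0 R n.+1; rewrite (e2S n).
  move=> ? ? /andP[? ?]; have [?|?] := leP (pos x) 2^-1.
    by exists (pos x); split; lra.
  by exists (pos x - e2 n.+1); split; lra.
pose I := `[a, a + e2 n.+1]%classic : set Om.
pose C := [set z : Om | forall m, m \in iota 0 n.+1 -> coin m z = side x m].
have mI : measurable I by exact: measurable_itv.
have mC : measurable C by exact: measurable_cyl.
have CE : coinP C = (e2 n.+1)%:E by rewrite coinP_cyl ?iota_uniq// size_iota.
have IE : leb01 I = (e2 n.+1)%:E.
  rewrite /leb01 /mrestr (_ : _ `&` _ = I).
    by rewrite lebesgue_measure_itv/= lte_fin ltrDl e2_gt0 -EFinB; congr EFin; ring.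
  apply/seteqP; split=> [s []//|s /= s1]; split=> //; move: s1.
  by rewrite /I/= !in_itv/=; lra.
apply: (@le_trans _ _ ((leb01 \x coinP)%E (I `*` C))).
  have -> : (leb01 \x coinP)%E (I `*` C) = (leb01 I * coinP C)%E.
    exact: product_measure1E.
  rewrite IE CE -EFinM lee_fin.
  by move: n2; rewrite (e2S n) => n2; nra.
rewrite {1}/nu /pushforward; apply: le_measure; rewrite ?inE.
- exact: measurableX.
- exact: measurable_line_ball.
move=> [s z] [/=]; rewrite /I/= in_itv/= => sa zx; rewrite ballEmdist/=.
apply: le_lt_trans n1; rewrite -(pt_side x) /line -(e2S n); apply: mdist_pt_le.
  by rewrite ler_norml (e2S n) /=; have := @e2_gt0 R n.+1; lra.
move=> m; have [mn|nm _] := ltnP m n.+1.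
  by rewrite /= zx ?eqxx// mem_iota.
rewrite (e2S n) mulrDl mul1r.
by apply: lerD; rewrite (le_trans (h_bound _ _))// e2_le.
Qed.

Lemma nu_ball_big x r : 2 < r -> nu (ball x r) = 1%E.
Proof.
move=> r2; rewrite -nuT; congr nu; apply/seteqP; split=> // y _.
by rewrite ballEmdist/=; exact: le_lt_trans (mdist_le2 x y) r2.
Qed.

Lemma nu_ball_gt0 x r : 0 < r -> (0 < nu (ball x r))%E.
Proof.
move=> r0; have [r2|r2] := leP r 2; last by rewrite nu_ball_big// lte01.
by apply: lt_le_trans (nu_ball_ge x r0 r2); rewrite lte_fin mulr_gt0// exprn_gt0.
Qed.

Lemma nu_ball_lty x r : (nu (ball x r) < +oo)%E.
Proof. by apply: le_lt_trans (nu_le1 (measurable_ballX x r)) _; exact: ltry. Qed.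

Lemma nu_Ahlfors : Ahlfors_regular nu.
Proof.
exists 2, 32; split=> // [|x r r0 rd]; first by rewrite ler1n.
have r2 : r <= 2.
  rewrite -lee_fin (le_trans rd)//; apply: ge_ereal_sup => _ [[a b] _ <-].
  by rewrite lee_fin mdist_le2.
rewrite powR_mulrn; last exact: ltW.
apply/andP; split; last exact: nu_ball_le.
apply: le_trans (nu_ball_ge x r0 r2); rewrite lee_fin.
by have := exprn_gt0 2 r0; lra.
Qed.

Lemma nu_ball_dbl x (k r : R) : 1 <= k -> 0 < r ->
  (nu (ball x (k * r)) <= (512 * k ^+ 2)%:E * nu (ball x r))%E.
Proof.
move=> k1 r0; have [r2|r2] := leP r 2.
  have kr : 0 < k * r by rewrite mulr_gt0// (lt_le_trans ltr01).
  apply: le_trans (nu_ball_le x kr) _.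
  rewrite (le_trans _ (lee_wpmul2l _ (nu_ball_ge x r0 r2)))//.
    by rewrite -EFinM lee_fin; lra.
  by rewrite lee_fin; nra.
rewrite (nu_ball_big x r2) mule1.
apply: le_trans (nu_le1 (measurable_ballX x _)) _.
by rewrite lee_fin; nra.
Qed.

Lemma nu_doubling : doubling nu.
Proof.
exists (512 * 2 ^+ 2) => [|x r r0]; first by lra.
by rewrite nu_ball_gt0// nu_ball_lty; split=> //; apply: nu_ball_dbl => //; rewrite ler1n.
Qed.

End laakso_measure.

(** * Upper gradients along lines *)

Section upper_gradient_line.
Context {R : realType}.
Local Notation X := (laakso R).
Local Notation Om := (measurableTypeR R).
Local Notation mu := (@lebesgue_measure R).
Implicit Types (x y : X) (a b s t c : R) (z : Om).

Lemma lipschitz_cst_gt0 (f : X -> R) :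
  lipschitz_dist (@mdist R X) norm_dist f ->
  exists2 L : R, 0 < L & forall x y, `|f x - f y| <= L * mdist x y.
Proof.
move=> [L fL]; exists (`|L| + 1); first by rewrite ltr_pwDr.
move=> x y; apply: le_trans (fL x y) _; rewrite ler_wpM2r ?mdist_ge0//.
by rewrite (le_trans (ler_norm _))// lerDl.
Qed.

Lemma measurable_lipschitz (f : X -> R) :
  lipschitz_dist (@mdist R X) norm_dist f ->
  measurable_fun setT (f : borel X -> measurableTypeR R).
Proof.
move=> /lipschitz_cst_gt0[L L0 fL].
apply: (measurability _ (RGenOpens.measurableE R)).
move=> _ [V [u [v Vuv]] <-].
rewrite setTI; apply: sub_sigma_algebra; rewrite /= openE => x /= Ux.
have oV : open V by rewrite Vuv; exact: interval_open.
have /nbhs_ballP[/= e e0 Ue] : nbhs (f x) V by exact: open_nbhs_nbhs.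
apply/nbhs_ballP; exists (e / L); rewrite /= ?divr_gt0// => y.
rewrite ballEmdist/= => xy; apply: Ue; rewrite -ball_normE/=.
by rewrite (le_lt_trans (fL _ _))// mulrC -ltr_pdivlMr.
Qed.

Lemma curve_variation_line z a b l : 0 <= a -> b <= 1 -> itv_partition a b l ->
  curve_variation a b (fun t => line (t, z)) l = b - a.
Proof.
move=> a0 b1 abl; rewrite -(@nondecreasing_variation _ a b idfun l)//.
have l01 i : (i < (size l).+1)%N -> 0 <= nth b (a :: l) i <= 1.
  move=> il; rewrite (le_trans a0 (itv_partition_nth_ge il abl))/=.
  by rewrite (le_trans (itv_partition_nth_le il abl)).
rewrite /curve_variation /variation !big_nat; apply: eq_bigr => i /= il.
rewrite distrC; apply: mdist_pt; first exact: (l01 i (leqW il)).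
exact: (l01 i.+1).
Qed.

Lemma curve_length_line z a b : 0 <= a -> a <= b -> b <= 1 ->
  curve_length a b (fun t => line (t, z)) = (b - a)%:E.
Proof.
move=> a0 ab b1; rewrite /curve_length (_ : [set _ | _ in _] = [set (b - a)%:E]).
  by rewrite ereal_sup1.
apply/seteqP; split=> [_ [l abl <-]|_ ->] /=; first by rewrite curve_variation_line.
move: ab; rewrite le_eqVlt => /orP[/eqP ba|ab].
  subst b; have aa : itv_partition a a [::] by split=> //=; exact/eqP.
  by exists [::] => //; rewrite curve_variation_line.
exists [:: b]; first by apply: itv_partition1.
by rewrite curve_variation_line//; apply: itv_partition1.
Qed.

Lemma rectifiable_line z a b : 0 <= a -> a <= b -> b <= 1 ->
  rectifiable_curve a b (fun t => line (t, z)).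
Proof.
move=> a0 ab b1; split=> //; last by rewrite curve_length_line// ltry.
apply: continuous_subspaceT => t; apply/metricType_numDomainType.cvgrPdist_lt => e e0.
near=> s; rewrite (@le_lt_trans _ _ `|t - s|)//.
  by apply: mdist_pt_le => // m; rewrite eqxx.
Unshelve. all: by end_near. Qed.

Lemma measurable_line_fix z : measurable_fun setT (fun s : Om => line (s, z) : borel X).
Proof.
apply: (measurableT_comp measurable_line).
exact: pair2_measurable.
Qed.

(** Lines are parametrized by arclength, so that the line integral is an integral over
    heights. *)
Lemma upper_gradient_line (f : X -> R) (g : X -> \bar R) z a b :
  upper_gradient f g -> 0 <= a -> a <= b -> b <= 1 ->
  (`|f (line (a, z)) - f (line (b, z))|%:E <=
    \int[mu]_(s in `[a, b]) g (line (s, z)))%E.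
Proof.
move=> [mg g0 fg] a0 ab b1.
apply: le_trans (fg _ _ _ (rectifiable_line z a0 ab b1)) _.
rewrite /line_integral curve_length_line//=.
pose T : Om -> Om := fun s => s + a.
have mT : measurable_fun setT T by exact: translation_measurable.
have mG : measurable_fun setT (fun s : Om => g (line (s, z))).
  exact: (measurableT_comp mg (measurable_line_fix z)).
have -> : (\int[mu]_(s in `[a, b]) g (line (s, z)) =
    \int[pushforward mu T]_(s in `[a, b]) g (line (s, z)))%E.
  apply/esym; apply: eq_measure_integral => //= A mA _.
  exact: (lebesgue_translation a mA).
rewrite ge0_integral_pushforward//; last exact: measurable_funS mG.
rewrite (_ : _ @^-1` _ = `[0, b - a]%classic); last first.
  by apply/seteqP; split=> s /=; rewrite /T !in_itv/=; lra.
rewrite le_eqVlt; apply/orP; left; apply/eqP; apply: eq_integral => s.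
rewrite inE/= in_itv/= => /andP[s0 sba]; congr g; rewrite /arclength_param.
case: xgetP => [u uE [uab]|no]; last first.
  exfalso; apply: (no (s + a)); split; first by rewrite in_itv/=; lra.
  by rewrite curve_length_line ?addrK//; lra.
move: uab; rewrite in_itv/= => /andP[au ub].
rewrite curve_length_line//; last exact: le_trans b1.
by move=> [usa]; rewrite /T/= -usa subrK.
Qed.

End upper_gradient_line.

(** * Averaging over coins *)

Section averaging.
Context {R : realType}.
Local Notation Om := (measurableTypeR R).
Implicit Types (F G : Om -> R) (C : set Om) (k l j : nat) (z : Om).

Definition avg2 k F z : R := (F z + F (flip k z)) / 2.

(** [avg l j F] averages [F] over the coins [l + 1], ..., [l + j]. *)
Fixpoint avg l j F : Om -> R :=
  if j is i.+1 then avg l i (avg2 (l + i.+1) F) else F.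

Lemma measurable_avg2 k F : measurable_fun setT F ->
  measurable_fun setT (avg2 k F).
Proof.
move=> mF; apply: measurable_funM => //; apply: measurable_funD => //.
by apply: (measurableT_comp mF); exact: measurable_flip.
Qed.

Lemma measurable_avg l j F : measurable_fun setT F ->
  measurable_fun setT (avg l j F).
Proof.
elim: j F => [//|j IH] F mF /=; apply: IH; exact: measurable_avg2.
Qed.

Lemma avgB l j F G z :
  avg l j (fun z => F z - G z) z = avg l j F z - avg l j G z.
Proof.
elim: j F G => [//|j IH] F G /=; rewrite -IH; congr (avg _ _ _ z).
by apply/funext => u; rewrite /avg2; lra.
Qed.

Lemma avg_bound l j F (e : R) : (forall z, `|F z| <= e) ->
  forall z, `|avg l j F z| <= e.
Proof.
elim: j F => [//|j IH] F Fe /=; apply: IH => z.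
rewrite /avg2 normrM [X in _ * X]ger0_norm// ler_pdivrMr//.
by rewrite (le_trans (ler_normD _ _))//; have := Fe z; have := Fe (flip (l + j.+1) z); lra.
Qed.

Lemma avg2_inv k F : (forall z, F (flip k z) = F z) -> avg2 k F = F.
Proof. by move=> Fk; apply/funext => z; rewrite /avg2 Fk; lra. Qed.

(** Flips preserve the measure, so averaging over coins contracts the L1 norm. *)
Lemma int_avg l j C F : measurable C ->
  (forall k z, (l < k)%N -> C (flip k z) <-> C z) -> measurable_fun setT F ->
  (\int[coinP]_(z in C) `|avg l j F z|%:E <= \int[coinP]_(z in C) `|F z|%:E)%E.
Proof.
move=> mC Ck; elim: j F => [//|j IH] F mF /=.
have mabs (E : Om -> R) : measurable_fun setT E ->
    measurable_fun setT (fun z => `|E z|%:E).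
  by move=> mE; apply/measurable_EFinP; exact: measurableT_comp.
have mFk : measurable_fun setT (fun z => F (flip (l + j.+1) z)).
  by apply: (measurableT_comp mF); exact: measurable_flip.
apply: le_trans (IH _ (measurable_avg2 _ mF)) _.
apply: (@le_trans _ _ (\int[coinP]_(z in C)
    ((2^-1)%:E * (`|F z|%:E + `|F (flip (l + j.+1) z)|%:E)))%E).
  apply: ge0_le_integral => //=.
  - by apply: measurable_funTS; apply: mabs; exact: measurable_avg2.
  - apply: measurable_funTS; apply: measurable_funeM.
    by apply: emeasurable_funD; exact: mabs.
  - move=> z _; rewrite -EFinD -EFinM lee_fin /avg2 normrM.
    rewrite [X in _ * X]ger0_norm//.
    by have := ler_normD (F z) (F (flip (l + j.+1) z)); lra.
have mS (E : Om -> R) : measurable_fun setT E -> measurable_fun C (fun z : Om => `|E z|%:E).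
  by move=> mE; apply: measurable_funTS; exact: mabs.
rewrite ge0_integralZl_EFin//; last exact: emeasurable_funD (mS _ mF) (mS _ mFk).
rewrite ge0_integralD//; [|exact: mS|exact: mS].
rewrite (@integral_flip _ (l + j.+1) C (fun z => `|F z|%:E))//.
- set I := (\int[coinP]_(z in C) _)%E.
  have I0 : (0 <= I)%E by apply: integral_ge0.
  move: I0; case: I => [r| |]//; rewrite ?leey//.
  by rewrite lee_fin => r0; rewrite -EFinD -EFinM lee_fin; lra.
- by move=> z; apply: Ck; lia.
- exact: mabs.
- by move=> z _; rewrite adde_ge0.
Qed.

(** One coin at a time: outcomes that disagree on the averaged coin are paired with
    each other's flips. *)
Lemma avg_osc (p : pred nat) l j F (e : R) :
  (forall m, (l < m)%N -> p m) ->
  (forall z z', (forall m, (m <= l + j)%N -> p m -> coin m z = coin m z') ->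
    `|F z - F z'| <= e) ->
  forall z z', (forall m, (m <= l)%N -> p m -> coin m z = coin m z') ->
    `|avg l j F z - avg l j F z'| <= e.
Proof.
move=> pl; elim: j F => [|j IH] F Fe z z'; first by rewrite addn0 in Fe => /Fe.
move=> zz' /=; apply: IH zz' => {}z {}z' zz'; rewrite /avg2 -mulrBl.
set k := (l + j.+1)%N; rewrite normrM [X in _ * X]ger0_norm// ler_pdivrMr//.
have flips (u v : Om) : (forall m, (m < k)%N -> p m -> coin m u = coin m v) ->
    coin k u = coin k v -> `|F u - F v| <= e.
  move=> uv uvk; apply: Fe => m; rewrite leq_eqVlt => /orP[/eqP -> //|].
  exact: uv.
have lt m : (m < k)%N -> (m <= l + j)%N by rewrite /k addnS.
have ne m : (m < k)%N -> (m == k) = false by lia.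
have [E|E] := eqVneq (coin k z) (coin k z').
  have h1 : `|F z - F z'| <= e by apply: flips => // m /lt; exact: zz'.
  have h2 : `|F (flip k z) - F (flip k z')| <= e.
    apply: flips; last by rewrite !coin_flip E.
    by move=> m mk pm; rewrite !coin_flip_neq ?ne//; exact: zz' (lt _ mk) pm.
  by rewrite opprD addrACA (le_trans (ler_normD _ _))//; lra.
have h1 : `|F z - F (flip k z')| <= e.
  apply: flips; last by rewrite coin_flip; move: E; case: (coin k z) (coin k z') => [] [].
  by move=> m mk pm; rewrite coin_flip_neq ?ne//; exact: zz' (lt _ mk) pm.
have h2 : `|F (flip k z) - F z'| <= e.
  apply: flips; last by rewrite coin_flip; move: E; case: (coin k z) (coin k z') => [] [].
  by move=> m mk pm; rewrite coin_flip_neq ?ne//; exact: zz' (lt _ mk) pm.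
rewrite opprD addrACA addrC [X in `|X|](_ : _ =
  (F z - F (flip k z')) + (F (flip k z) - F z')); last by ring.
by rewrite (le_trans (ler_normD _ _))//; lra.
Qed.

End averaging.

Section tonelli.
Context {R : realType}.
Local Notation Om := (measurableTypeR R).
Local Open Scope ereal_scope.
Variables (m1 m2 : {sigma_finite_measure set Om -> \bar R}).
Variables (D C : set Om) (F : Om * Om -> \bar R).
Hypotheses (mD : measurable D) (mC : measurable C).
Hypotheses (mF : measurable_fun setT F) (F0 : forall p, 0 <= F p).

Let mFr (E : set (Om * Om)) : measurable E -> measurable_fun setT (F \_ E).
Proof.
by move=> mE; apply/(measurable_restrictT F mE); exact: measurable_funTS.
Qed.

Let F0r (E : set (Om * Om)) p : 0 <= (F \_ E) p.
Proof. by apply: erestrict_ge0 => q _; exact: F0. Qed.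

Lemma measurable_int_fst :
  measurable_fun setT (fun z => \int[m1]_(s in D) F (s, z)).
Proof.
have mE : measurable (D `*` [set: Om]) by exact: measurableX.
have := @measurable_fun_fubini_tonelli_G _ _ _ _ _ m1 _ (mFr mE) (F0r _).
congr measurable_fun; apply/funext => z; rewrite /fubini_G [RHS]integral_mkcond.
by apply: eq_integral => s _; rewrite /patch in_setX in_setT andbT.
Qed.

Lemma measurable_int_snd :
  measurable_fun setT (fun s => \int[m2]_(z in C) F (s, z)).
Proof.
have mE : measurable ([set: Om] `*` C) by exact: measurableX.
have := @measurable_fun_fubini_tonelli_F _ _ _ _ _ m2 _ (mFr mE) (F0r _).
congr measurable_fun; apply/funext => z; rewrite /fubini_F [RHS]integral_mkcond.
by apply: eq_integral => s _; rewrite /patch in_setX in_setT.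
Qed.

Lemma tonelli_rect1 : \int[m1 \x m2]_(p in D `*` C) F p =
  \int[m1]_(s in D) \int[m2]_(z in C) F (s, z).
Proof.
have mE : measurable (D `*` C) by exact: measurableX.
rewrite integral_mkcond (fubini_tonelli1 _ (mFr mE))// [RHS]integral_mkcond.
apply: eq_integral => s _; rewrite /fubini_F /patch; case: ifP => sD.
  by rewrite [RHS]integral_mkcond; apply: eq_integral => z _; rewrite /patch in_setX sD.
by apply: integral0_eq => z _; rewrite in_setX sD.
Qed.

Lemma tonelli_rect2 : \int[m1 \x m2]_(p in D `*` C) F p =
  \int[m2]_(z in C) \int[m1]_(s in D) F (s, z).
Proof.
have mE : measurable (D `*` C) by exact: measurableX.
rewrite integral_mkcond (fubini_tonelli2 _ (mFr mE))// [RHS]integral_mkcond.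
apply: eq_integral => s _; rewrite /fubini_G /patch; case: ifP => sD.
  rewrite [RHS]integral_mkcond; apply: eq_integral => z _.
  by rewrite /patch in_setX sD andbT.
by apply: integral0_eq => z _; rewrite in_setX sD andbF.
Qed.

End tonelli.

(** * The Poincare inequality *)

Section segments.
Context {R : realType}.
Local Notation Om := (measurableTypeR R).
Local Notation mu := (@lebesgue_measure R).

Definition seg (a b : R) : set Om := `[Num.min a b, Num.max a b]%classic.

Lemma segC (a b : R) : seg a b = seg b a.
Proof. by rewrite /seg minC maxC. Qed.

Lemma measurable_seg (a b : R) : measurable (seg a b).
Proof. exact: measurable_itv. Qed.

Lemma integral_seg_cat (F : Om -> \bar R) (a b c : R) :
  measurable_fun setT F -> (forall s, 0 <= F s)%E ->
  (a <= b <= c) || (c <= b <= a) ->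
  (\int[mu]_(s in seg a b) F s + \int[mu]_(s in seg b c) F s =
   \int[mu]_(s in seg a c) F s)%E.
Proof.
move=> mF F0; wlog abc : a c / a <= b <= c.
  move=> wl /orP[h|h]; first by apply: wl => //; rewrite h.
  by rewrite addeC (segC a b) (segC b c) (segC a c); apply: wl => //; rewrite h.
move=> _; case/andP: abc => ab bc; have ac := le_trans ab bc.
rewrite /seg (min_l ab) (max_r ab) (min_l bc) (max_r bc) (min_l ac) (max_r ac).
rewrite -[X in (X + _)%E]integral_itv_bndo_bndc; last exact: measurable_funTS.
rewrite -ge0_integral_setU//; [|exact: measurable_funTS|].
  by congr integral; rewrite -itv_bndbnd_setU// bnd_simp.
rewrite disj_set2E; apply/eqP/seteqP; split=> // s [] /=; rewrite !in_itv/=.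
by move=> /andP[_ sb] /andP[bs _]; have := lt_le_trans sb bs; rewrite ltxx.
Qed.

End segments.

Section poincare.
Context {R : realType}.
Local Notation X := (laakso R).
Local Notation Om := (measurableTypeR R).
Local Notation mu := (@lebesgue_measure R).
Variables (f : X -> R) (g : X -> \bar R) (L : R).
Hypotheses (L0 : 0 < L) (fL : forall x y, `|f x - f y| <= L * mdist x y).
Hypothesis fg : upper_gradient f g.

Let H (s : R) (z : Om) : R := f (line (s, z)).
Let G (s : R) (z : Om) : \bar R := g (line (s, z)).

Let lip_f : lipschitz_dist (@mdist R X) norm_dist f.
Proof. by exists L => x y; exact: fL. Qed.

Let mHp : measurable_fun setT (fun p : Om * Om => f (line p)).
Proof. exact: measurableT_comp (measurable_lipschitz lip_f) measurable_line. Qed.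

Let mH s : measurable_fun setT (H s : Om -> Om).
Proof. by apply: (measurableT_comp mHp); exact: pair1_measurable. Qed.

Let mGp : measurable_fun setT (fun p : Om * Om => g (line p)).
Proof. by case: fg => mg _ _; exact: measurableT_comp mg measurable_line. Qed.

Let mG z : measurable_fun setT (fun s : Om => G s z).
Proof. by apply: (measurableT_comp mGp); exact: pair2_measurable. Qed.

Let g0 x : (0 <= g x)%E.
Proof. by case: fg => _ g0 _; exact: g0. Qed.

Let G0 s z : (0 <= G s z)%E.
Proof. exact: g0. Qed.

Let mabs (E : Om -> Om) : measurable_fun setT E ->
  measurable_fun setT (fun z => `|E z|%:E).
Proof. by move=> mE; apply/measurable_EFinP; exact: measurableT_comp. Qed.

Let mB (E F : Om -> R) : measurable_fun setT (E : Om -> Om) ->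
  measurable_fun setT (F : Om -> Om) ->
  measurable_fun setT (fun z => E z - F z : Om).
Proof. exact: measurable_funB. Qed.

Let mint a b : measurable_fun setT (fun z => \int[mu]_(s in seg a b) G s z)%E.
Proof.
apply: (@measurable_int_fst _ _ (seg a b) (fun p => g (line p))) => //.
  exact: measurable_seg.
Qed.

Let H_seg a b z : 0 <= a <= 1 -> 0 <= b <= 1 ->
  (`|H a z - H b z|%:E <= \int[mu]_(s in seg a b) G s z)%E.
Proof.
wlog ab : a b / a <= b.
  have [ab|/ltW ba] := leP a b => wl ha hb; first exact: wl.
  by rewrite distrC segC; exact: wl.
move=> /andP[a0 _] /andP[_ b1]; rewrite /seg (min_l ab) (max_r ab).
exact: upper_gradient_line.
Qed.

Let int_H_seg (C : set Om) a b : measurable C -> 0 <= a <= 1 -> 0 <= b <= 1 ->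
  (\int[coinP]_(z in C) `|H a z - H b z|%:E <=
   \int[coinP]_(z in C) \int[mu]_(s in seg a b) G s z)%E.
Proof.
move=> mC a01 b01; apply: ge0_le_integral => //.
- by apply: measurable_funTS; apply: mabs; apply: mB => //.
- by apply: measurable_funTS; exact: mint.
- by move=> z _; exact: H_seg.
Qed.

(** Walking from [c + e2 l.+1] towards [c] through the wormholes
    [c + e2 (l + j)] (on the side chosen by [b]) randomizes the coins of levels
    [l + 1], [l + 2], ... one after the other, at a total cost of a single
    passage over the segment. *)
Let int_chain (C : set Om) l c (b : bool) (w := fun j => c + (-1) ^+ b * e2 (l + j)) J :
  measurable C -> (forall k z, (l < k)%N -> C (flip k z) <-> C z) ->
  grid l c -> 0 <= c <= 1 -> 0 <= w 0%N <= 1 ->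
  (\int[coinP]_(z in C) `|H (w 1%N) z - avg l J (H (w J.+1)) z|%:E <=
   \int[coinP]_(z in C) \int[mu]_(s in seg (w J.+1) (w 1%N)) G s z)%E.
Proof.
move=> mC Ck gc c01 w01.
have w_between i j : (i <= j)%N -> (w j <= w i <= w 0%N) || (w 0%N <= w i <= w j).
  move=> ij; have h1 := @e2_le R (l + i) (l + j) (leq_add (leqnn l) ij).
  have h2 := @e2_le R (l + 0) (l + i) (leq_add (leqnn l) (leq0n i)).
  by rewrite /w; case: (b); rewrite ?expr1 ?expr0 ?mulN1r ?mul1r; [apply/orP; right|apply/orP; left]; lra.
have wj01 j : 0 <= w j <= 1.
  have h2 := @e2_le R (l + 0) (l + j) (leq_add (leqnn l) (leq0n j)).
  have h3 := @e2_ge0 R (l + j).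
  by move: w01; rewrite /w; case: (b); rewrite ?expr1 ?expr0 ?mulN1r ?mul1r; lra.
(* The branches of level [l + j.+1] are glued at height [w j.+1]. *)
have Hflip j z : H (w j.+1) (flip (l + j.+1) z) = H (w j.+1) z.
  rewrite /H /line; congr f; apply: pt_eq => //= m.
  have [->|ml] := eqVneq m (l + j.+1)%N; last by left; rewrite coin_flip_neq.
  by right; apply: (h_shift (m := l)) => //; lia.
have avgH j : avg l j.+1 (H (w j.+1)) = avg l j (H (w j.+1)).
  by rewrite /= avg2_inv.
elim: J => [|J IH].
  rewrite [X in (X <= _)%E](_ : _ = 0)%E; first by apply: integral_ge0 => z _; apply: integral_ge0 => s _; exact: G0.
  by apply: integral0_eq => z _; rewrite /= subrr normr0.
have mA j i : measurable_fun setT (avg l j (H (w i)) : Om -> Om) by apply: measurable_avg; exact: mH.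
apply: (@le_trans _ _ (\int[coinP]_(z in C)
   (`|H (w 1%N) z - avg l J (H (w J.+1)) z|%:E +
    `|avg l J.+1 (fun z => H (w J.+1) z - H (w J.+2) z) z|%:E))%E).
  apply: ge0_le_integral; first exact: mC.
  - by move=> z _; rewrite lee_fin normr_ge0.
  - by apply: measurable_funTS; apply: mabs; apply: mB; [exact: mH|exact: mA].
  - apply: measurable_funTS; apply: emeasurable_funD; apply: mabs.
      by apply: mB; [exact: mH|exact: mA].
    by apply: measurable_avg; apply: mB; exact: mH.
  - by move=> z _; rewrite -EFinD lee_fin avgB avgH ler_distD.
rewrite (ge0_integralD _ mC); last 4 first.
- by move=> z _; rewrite lee_fin normr_ge0.
- by apply: measurable_funTS; apply: mabs; apply: mB; [exact: mH|exact: mA].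
- by move=> z _; rewrite lee_fin normr_ge0.
- by apply: measurable_funTS; apply: mabs; apply: measurable_avg; apply: mB; exact: mH.
have step : (\int[coinP]_(z in C) `|avg l J.+1 (fun z => H (w J.+1) z - H (w J.+2) z) z|%:E <=
   \int[coinP]_(z in C) \int[mu]_(s in seg (w J.+2) (w J.+1)) G s z)%E.
  apply: le_trans (int_avg J.+1 mC Ck _) _; first apply: mB => //.
  by rewrite segC; exact: int_H_seg.
apply: le_trans (leeD IH step) _.
rewrite addeC -(ge0_integralD coinP mC); last 4 first.
- by move=> z _; apply: integral_ge0 => s _; exact: G0.
- by apply: measurable_funTS; exact: mint.
- by move=> z _; apply: integral_ge0 => s _; exact: G0.
- by apply: measurable_funTS; exact: mint.
rewrite le_eqVlt; apply/orP; left; apply/eqP; apply: eq_integral => z _.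
apply: integral_seg_cat => //.
have := @e2_le R (l + J.+1) (l + J.+2); have := @e2_le R (l + 1) (l + J.+1).
rewrite !leq_add2l => /(_ isT) h1 /(_ (leqnSn _)) h2.
by rewrite /w; case: (b); rewrite ?expr1 ?expr0 ?mulN1r ?mul1r; [apply/orP; right|apply/orP; left]; lra.
Qed.

Lemma cyl_flip (x : X) l c k z : (l < k)%N -> cyl x l c (flip k z) <-> cyl x l c z.
Proof.
move=> lk; suff ce m : m \in cyl_levels l c -> coin m (flip k z) = coin m z.
  by split=> cz m mc; rewrite -?(cz _ mc) ce.
by rewrite mem_filter mem_iota => /andP[_ ml]; apply: coin_flip_neq; lia.
Qed.

Let M (x : X) l c : \bar R :=
  (\int[coinP]_(z in cyl x l c) \int[leb01]_(s in window l c) G s z)%E.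

Let int_seg_window l c a b z : 0 <= a <= 1 -> 0 <= b <= 1 ->
  `|a - c| <= e2 l -> `|b - c| <= e2 l ->
  (\int[mu]_(s in seg a b) G s z <= \int[leb01]_(s in window l c) G s z)%E.
Proof.
move=> a01 b01 ac bc.
have sub s : seg a b s -> 0 <= s <= 1 /\ `|s - c| <= e2 l.
  rewrite /seg/= in_itv/= ge_min le_max.
  by move: ac bc; rewrite !ler_distl; case: (leP a b); lra.
have -> : (\int[mu]_(s in seg a b) G s z = \int[leb01]_(s in seg a b) G s z)%E.
  apply: eq_measure_integral => A mA As.
  rewrite -[LHS]/(mu A) -[RHS]/(mu (A `&` `[0%R, 1%R]%classic)) setIidl//.
  by move=> s /As/sub[]; rewrite /= in_itv.
apply: ge0_subset_integral; [exact: measurable_seg|exact: measurable_window|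
  by apply: measurable_funTS; exact: mG|by move=> s _; exact: G0|].
by move=> s /sub[s01 sc]; rewrite /window/= clamp_id.
Qed.

Let int_seg_M (x : X) l c a b : 0 <= a <= 1 -> 0 <= b <= 1 ->
  `|a - c| <= e2 l -> `|b - c| <= e2 l ->
  (\int[coinP]_(z in cyl x l c) \int[mu]_(s in seg a b) G s z <= M x l c)%E.
Proof.
move=> a01 b01 ac bc; apply: ge0_le_integral.
- exact: measurable_cylX.
- by move=> z _; apply: integral_ge0 => s _; exact: G0.
- by apply: measurable_funTS; exact: mint.
- apply: measurable_funTS.
  apply: (@measurable_int_fst _ _ (window l c) (fun p => g (line p))) => //.
    exact: measurable_window.
- by move=> z _; exact: int_seg_window.
Qed.

(** One of the two neighbours of [c] in the grid belongs to [0, 1]. *)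
Let side_ex l (c s : R) : grid l c -> 0 <= c <= 1 -> 0 <= s <= 1 -> `|s - c| <= e2 l ->
  exists b : bool, 0 <= c + (-1) ^+ b * e2 l <= 1.
Proof.
move=> gc c01 s01 sc; have e0 := @e2_gt0 R l; have e1 := @e2_le1 R l.
have [h|h] := leP (c + e2 l) 1.
  by exists false; rewrite expr0 mul1r; lra.
exists true; rewrite expr1 mulN1r; suff : 1 <= c by lra.
rewrite leNgt; apply/negP => c1.
by have := grid_sep (@grid1 R l) gc (negbT (gt_eqF c1)); rewrite ger0_norm; lra.
Qed.

(** Once the coins up to level [l + J] are averaged out, at height [c] only the
    branches of levels beyond [l + J] can make a difference, and they are within
    a multiple of [e2 (l + J.+1)]. *)
Let mean_near (x : X) l c (b : bool) J z0 z : grid l c -> 0 <= c <= 1 ->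
  0 <= c + (-1) ^+ b * e2 l <= 1 -> cyl x l c z0 -> cyl x l c z ->
  `|avg l J (H (c + (-1) ^+ b * e2 (l + J.+1))) z - avg l J (H c) z0| <=
  L * (3 * e2 (l + J.+1)).
Proof.
move=> gc c01 w01 Cz0 Cz; set w := c + _.
have wc : `|w - c| = e2 (l + J.+1).
  by rewrite /w addrC addKr normrM normr_sign mul1r ger0_norm// e2_ge0.
have near z' : `|H w z' - H c z'| <= L * e2 (l + J.+1).
  apply: le_trans (fL _ _) _; rewrite ler_wpM2l ?(ltW L0)//.
  by apply: mdist_pt_le; rewrite /= ?wc// => m; rewrite eqxx.
have osc : `|avg l J (H c) z - avg l J (H c) z0| <= L * (2 * e2 (l + J.+1)).
  apply: (@avg_osc R (fun m => h m c != 0)).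
  - by move=> m lm; rewrite (h_coarse lm gc) e2_neq0.
  - move=> u v uv; apply: le_trans (fL _ _) _; rewrite ler_wpM2l ?(ltW L0)//.
    apply: mdist_pt_le => /=.
      by rewrite subrr normr0 mulr_ge0// e2_ge0.
    move=> m uvm; rewrite clamp_id//.
    have [hm|hm] := eqVneq (h m c) 0.
      by rewrite hm addr0 mulr_ge0// e2_ge0.
    have [ml|ml] := leqP m (l + J).
      by move: uvm; rewrite (uv m ml hm) eqxx.
    have em : e2 m <= e2 (l + J.+1) :> R by apply: e2_le; rewrite addnS.
    by have := h_bound m c; lra.
  - move=> m ml hm; have mc : m \in cyl_levels l c.
      by rewrite mem_filter hm mem_iota.
    by rewrite (Cz m mc) (Cz0 m mc).
have avgn := @avg_bound R l J _ _ near z; rewrite avgB in avgn.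
apply: le_trans (ler_distD (avg l J (H c) z) _ _) _; lra.
Qed.

Let H_clamp s z : H (clamp s) z = H s z.
Proof. by rewrite /H line_clamp. Qed.

(** On a fixed height [s] of the cell: go along the lines from [s] to the first
    wormhole next to [c], and from there towards [c]. *)
Let level_estimate (x : X) l c J z0 s : grid l c -> 0 <= c <= 1 ->
  cyl x l c z0 -> window l c s ->
  (\int[coinP]_(z in cyl x l c) `|H s z - avg l J (H c) z0|%:E <=
   M x l c + M x l c + (L * (3 * e2 (l + J.+1)))%:E)%E.
Proof.
move=> gc c01 Cz0; rewrite /window/= => ws.
under eq_integral do rewrite -H_clamp.
have := clamp01 s; move: (clamp s) ws => {}s ws s01.
have [b w01b] := side_ex gc c01 s01 ws; have w01 := w01b.
pose w j := c + (-1) ^+ b * e2 (l + j); rewrite -[l]addn0 -/(w 0%N) in w01.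
have wc j : `|w j - c| = e2 (l + j).
  by rewrite /w addrC addKr normrM normr_sign mul1r ger0_norm// e2_ge0.
have wj01 j : 0 <= w j <= 1.
  have h2 := @e2_le R (l + 0) (l + j) (leq_add (leqnn l) (leq0n j)).
  have h3 := @e2_ge0 R (l + j).
  by move: w01; rewrite /w; case: (b); rewrite ?expr1 ?expr0 ?mulN1r ?mul1r; lra.
have wcl j : `|w j - c| <= e2 l by rewrite wc e2_le// leq_addr.
have mC := measurable_cylX x l c.
set C := cyl x l c; set K := avg l J (H c) z0; set e := L * _.
have e0 : 0 <= e by rewrite /e !mulr_ge0 ?(ltW L0)// e2_ge0.
have mA : measurable_fun setT (avg l J (H (w J.+1)) : Om -> Om).
  by apply: measurable_avg; exact: mH.
have mSW : measurable_fun C (fun z => `|H s z - H (w 1%N) z|%:E).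
  by apply: measurable_funTS; apply: mabs; apply: mB.
have mWA : measurable_fun C (fun z => `|H (w 1%N) z - avg l J (H (w J.+1)) z|%:E).
  by apply: measurable_funTS; apply: mabs; apply: mB.
apply: (@le_trans _ _ (\int[coinP]_(z in C) ((`|H s z - H (w 1%N) z|%:E +
    `|H (w 1%N) z - avg l J (H (w J.+1)) z|%:E) + e%:E))%E).
  apply: ge0_le_integral => //.
  - by apply: measurable_funTS; apply: mabs; apply: mB => //; exact: measurable_cst.
  - by apply: emeasurable_funD => //; apply: emeasurable_funD.
  - move=> z Cz; rewrite -!EFinD lee_fin.
    have k1 := mean_near J gc c01 w01b Cz0 Cz.
    have k2 := ler_distD (H (w 1%N) z) (H s z) K.
    have k3 := ler_distD (avg l J (H (w J.+1)) z) (H (w 1%N) z) K.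
    move: k1; rewrite -/(w J.+1) -/K -/e; lra.
rewrite (ge0_integralD _ mC); last 4 first.
- by move=> z _; rewrite adde_ge0.
- exact: emeasurable_funD.
- by move=> z _; rewrite lee_fin.
- exact: measurable_cst.
rewrite (ge0_integralD _ mC _ mSW _ mWA); last 2 first.
- by move=> z _; rewrite lee_fin.
- by move=> z _; rewrite lee_fin.
apply: leeD; first apply: leeD.
- apply: le_trans (int_H_seg mC s01 (wj01 1%N)) _.
  exact: (int_seg_M x s01 (wj01 1%N) ws (wcl 1%N)).
- apply: le_trans (int_chain J mC _ gc c01 (wj01 0%N)) _.
    by move=> k z; exact: cyl_flip.
  exact: (int_seg_M x (wj01 J.+1) (wj01 1%N) (wcl J.+1) (wcl 1%N)).
- rewrite integral_cst// -[leRHS]mule1; apply: lee_wpmul2l => //.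
  apply: le_trans (coinP_cylX x l c) _; by rewrite lee_fin e2_le1.
Qed.

Let cyl_neq0 (x : X) l c : exists z, cyl x l c z.
Proof.
apply: contrapT => /forallNP C0.
have : coinP (cyl x l c) = 0%E.
  by rewrite (_ : cyl x l c = set0) ?measure0//; apply/seteqP; split=> // z /C0.
rewrite /cyl coinP_cyl ?filter_uniq ?iota_uniq// => -[] /eqP.
by rewrite (negbTE (e2_neq0 _)).
Qed.

(** The constant [K] is the average, over the coins [l + 1], ..., [l + J], of the
    values at height [c]; the error [e] accounts for the levels beyond [l + J]. *)
Lemma cell_estimate (x : X) l c (e : R) : grid l c -> 0 <= c <= 1 -> 0 < e ->
  exists K : R,
  (\int[leb01 \x coinP]_(p in cell x l c) `|f (line p) - K|%:E <=
   (2 * e2 l)%:E *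
   (2%:E * \int[leb01 \x coinP]_(p in cell x l c) g (line p) + e%:E))%E.
Proof.
move=> gc c01 e0; have [z0 Cz0] := cyl_neq0 x l c.
have [J Je] : exists J, e2 J < e / (L * 3) :> R.
  by apply: e2_small; rewrite divr_gt0// mulr_gt0.
exists (avg l J (H c) z0); set K := avg _ _ _ _.
have mW := measurable_window l c; have mC := measurable_cylX x l c.
have ME : (\int[leb01 \x coinP]_(p in cell x l c) g (line p) = M x l c)%E.
  apply: (@tonelli_rect2 _ _ _ (window l c) (cyl x l c)
    (fun p => g (line p))) => //.
have M0 : (0 <= M x l c)%E.
  by apply: integral_ge0 => z _; apply: integral_ge0 => s _; exact: G0.
have bound s : window l c s ->
    (\int[coinP]_(z in cyl x l c) `|H s z - K|%:E <= 2%:E * M x l c + e%:E)%E.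
  move=> ws; apply: le_trans (level_estimate J gc c01 Cz0 ws) _.
  apply: leeD.
    by rewrite [in leRHS](_ : 2 = 1 + 1 :> R)// EFinD ge0_muleDl ?lee_fin// mul1e.
  rewrite lee_fin; move: Je; rewrite ltr_pdivlMr ?mulr_gt0// => Je.
  have ab : e2 (l + J.+1) <= e2 J :> R by apply: e2_le; rewrite -addSnnS leq_addl.
  have : 0 <= L * (e2 J - e2 (l + J.+1)) by rewrite mulr_ge0 ?(ltW L0)// subr_ge0.
  by lra.
rewrite ME (@tonelli_rect1 _ _ _ (window l c) (cyl x l c)
    (fun p => `|f (line p) - K|%:E))//; last first.
  by apply/measurable_EFinP; apply: measurableT_comp => //;
    apply: measurable_funB => //; exact: measurable_cst.
apply: (@le_trans _ _ (\int[leb01]_(s in window l c)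
    (cst (2%:E * M x l c + e%:E) s))%E).
  apply: ge0_le_integral => //.
  - by move=> s _; apply: integral_ge0 => z _; rewrite lee_fin.
  - apply: measurable_funTS.
    apply: (@measurable_int_snd _ _ (cyl x l c) (fun p => `|f (line p) - K|%:E)) => //.
    by apply/measurable_EFinP; apply: measurableT_comp => //;
      apply: measurable_funB => //; exact: measurable_cst.
rewrite integral_cst// muleC; apply: lee_wpmul2r; last exact: leb01_window.
by rewrite adde_ge0 ?mule_ge0 ?lee_fin// ltW.
Qed.

End poincare.

Section average.
Context {R : realType} {X : pmetricType R}.
Variable m : {measure set (borel X) -> \bar R}.

(** Averages are optimal constants up to a factor of two. *)
Lemma integral_dev_average (B : set (borel X)) (h : X -> R) (K : R) :
  measurable B -> (0 < m B < +oo)%E ->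
  m.-integrable B (EFin \o (h : borel X -> R)) ->
  (\int[m]_(y in B) `|h y - average m B h|%:E <=
    2%:E * \int[m]_(y in B) `|h y - K|%:E)%E.
Proof.
move=> mB /andP[B0 Boo] ih.
have Bfin : m B \is a fin_num by rewrite ge0_fin_numE.
have [b bE] : exists b, m B = b%:E by exists (fine (m B)); rewrite fineK.
have b0 : 0 < b by rewrite -lte_fin -bE.
have icst (k : R) : m.-integrable B (EFin \o cst k).
  apply/integrableP; split; first exact/measurable_EFinP.
  by rewrite (eq_integral (cst `|k|%:E))// integral_cst// bE -EFinM ltry.
have cstE (k : R) : (\int[m]_(y in B) k%:E = k%:E * b%:E)%E.
  by rewrite -bE; exact: (integral_cst m mB k%:E).
have iD (k : R) : m.-integrable B (EFin \o (fun y => h y - k)).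
  exact: (integrableB mB ih (icst k)).
have mD (k : R) : measurable_fun B (fun y : borel X => `|h y - k|%:E).
  by apply/measurable_EFinP; apply: measurableT_comp => //; apply/measurable_EFinP; apply: measurable_int (iD k).
have [I IE] : exists I, (\int[m]_(y in B) (h y)%:E = I%:E)%E.
  by exists (fine (\int[m]_(y in B) (h y)%:E)%E); rewrite fineK// integrable_fin_num.
have avE : average m B h = b^-1 * I by rewrite /average bE /Rintegral IE.
have intE : (\int[m]_(y in B) (h y - K)%:E = (I - K * b)%:E)%E.
  by rewrite (integralB_EFin mB ih (icst K)) IE [X in (_ - X)%E](cstE K).
have dev : (`|I - K * b|%:E <= \int[m]_(y in B) `|h y - K|%:E)%E.
  have := le_abse_integral m mB (measurable_int _ (iD K)).
  by rewrite [X in (`|X| <= _)%E]intE.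
apply: (@le_trans _ _ (\int[m]_(y in B) (`|h y - K|%:E + `|K - average m B h|%:E))%E).
  apply: ge0_le_integral => //; first exact: emeasurable_funD.
  by move=> y _; rewrite -EFinD lee_fin ler_distD.
rewrite ge0_integralD//.
rewrite [X in (_ + X)%E](_ : _ = `|I - K * b|%:E).
  by rewrite (_ : 2 = 1 + 1)// EFinD ge0_muleDl ?lee_fin// mul1e; exact: leeD.
rewrite cstE -EFinM avE; congr EFin.
rewrite -[X in _ * X](gtr0_norm b0) -normrM -[RHS]normrN; congr (`|_|).
by field; rewrite gt_eqF.
Qed.

End average.

Section laakso_poincare.
Context {R : realType}.
Local Notation X := (laakso R).
Local Notation Om := (measurableTypeR R).

(** Transfers [cell_estimate] to balls. The first inclusion is [ball_side]; for
    the second, points of a cell are joined through the height [c], where the only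
    branches that they do not share are glued or of size at most [e2 l.+1]. *)
Lemma ball_cell (x : X) (r : R) : 0 < r -> exists l c,
  [/\ grid l c, 0 <= c <= 1, e2 l <= 4 * r,
    line @^-1` ball x r `<=` cell x l c &
    cell x l c `<=` line @^-1` ball x (6 * r)].
Proof.
move=> r0; have [r1|r1] := leP r 2^-1; last first.
  (* Level 0 has its only wormhole of [0, 1] at height 1, so that this cell is
     everything. *)
  exists 0%N, 1; split=> //; rewrite ?ler01 ?lexx//.
  - exact: grid1.
  - by rewrite /e2 expr0; lra.
  - move=> [t z] _; split.
      rewrite /window/= /e2 expr0 ler_distl; have := clamp01 t; lra.
    move=> m; rewrite mem_filter mem_iota => /andP[+ m0].
    have -> : m = 0%N by lia.
    have := @h_odd R 0 0; rewrite mulr0 add0r mul1r /e2 expr0 => ->.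
    by rewrite eqxx.
  - move=> p _ /=; rewrite ballEmdist/=; apply: le_lt_trans (mdist_le2 _ _) _.
    lra.
have [l] := e2_window r0 r1; rewrite -[2^-1]expr1 -/(e2 1) -!e2D !add1n.
move=> /andP[r2 r3]; have [c [gc xc c01]] := grid_near l (pos01 x).
have eS := e2S (R := R) l; have eS2 := e2S (R := R) l.+1.
exists l, c; split=> //; first by lra.
  move=> p /=; rewrite ballEmdist/= => xp.
  by apply: line_ball_sub => //; exact: lt_le_trans r3.
move=> [t z] [/=]; rewrite /window/= => tc Cz; rewrite ballEmdist/=.
rewrite -(pt_side x) -line_clamp /line /=.
have t01 := clamp01 t; set s := clamp t in tc t01 *.
apply: (@le_lt_trans _ _ (e2 l + e2 l.+1)); last by lra.
have dist1 : `|pos x - s| <= e2 l + e2 l.+1.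
  by rewrite (le_trans (ler_distD c _ _))// addrC lerD// distrC.
apply: mdist_pt_le => // m; rewrite !clamp_id ?pos01//.
have [hm|hm] := eqVneq (h m c) 0.
  move=> _; have := h_le_dist (pos x) hm; have := h_le_dist s hm.
  by lra.
have [ml|ml] := leqP m l.
  by rewrite (Cz m) ?eqxx// mem_filter hm mem_iota add0n ltnS.
move=> _; have em : e2 m <= e2 l.+1 :> R by apply: e2_le.
by have := h_bound m (pos x); have := h_bound m s; lra.
Qed.

Lemma laakso_poincare_ball (f : X -> R) (g : X -> \bar R) (x : X) (r : R) :
  lipschitz_dist (@mdist R X) norm_dist f -> upper_gradient f g -> 0 < r ->
  (\int[nu]_(y in ball x r) `|f y - average nu (ball x r) f|%:E <=
   (32 * r)%:E * \int[nu]_(y in ball x (6 * r)) g y)%E.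
Proof.
move=> fL fg r0; have [L L0 fLL] := lipschitz_cst_gt0 fL.
have mf := measurable_lipschitz fL.
have [mg g0 _] := fg.
set B := ball x r; set B' := ball x (6 * r).
have mB : measurable (B : set (borel X)) by exact: measurable_ballX.
have mB' : measurable (B' : set (borel X)) by exact: measurable_ballX.
have Bfin : (0 < nu B < +oo)%E by rewrite nu_ball_gt0// nu_ball_lty.
have fint : nu.-integrable B (EFin \o (f : borel X -> R)).
  apply: measurable_bounded_integrable => //.
  - by case/andP: Bfin.
  - exact: measurable_funTS.
  - exists (`|f x| + L * 2); split; first exact: num_real.
    move=> M ML y _ /=; apply: le_trans (ltW ML).
    rewrite -[f y](subrK (f x)) (le_trans (ler_normD _ _))// addrC lerD2l.
    by apply: le_trans (fLL _ _) _; rewrite ler_wpM2l ?(ltW L0)// mdist_le2.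
have [l [c [gc c01 el sub1 sub2]]] := ball_cell x r0.
set I := (\int[nu]_(y in B') g y)%E.
have I0 : (0 <= I)%E by apply: integral_ge0 => y _; exact: g0.
apply/lee_addgt0Pr => e e0.
have e1 : 0 < e / (16 * r) by rewrite divr_gt0// mulr_gt0.
have [K KE] := cell_estimate L0 fLL fg x gc c01 e1.
apply: le_trans (integral_dev_average K mB Bfin fint) _.
have m1 : measurable_fun setT (fun y : borel X => `|f y - K|%:E).
  by apply/measurable_EFinP; apply: measurableT_comp => //;
    apply: measurable_funB => //; exact: measurable_cst.
have m1l : measurable_fun setT (fun p : Om * Om => `|f (line p) - K|%:E).
  exact: measurableT_comp m1 measurable_line.
have mgl : measurable_fun setT (fun p : Om * Om => g (line p)).
  exact: measurableT_comp mg measurable_line.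
have k1 : (\int[nu]_(y in B) `|f y - K|%:E <=
    \int[leb01 \x coinP]_(p in cell x l c) `|f (line p) - K|%:E)%E.
  rewrite (ge0_integral_pushforward measurable_line _ mB)//; last exact: measurable_funTS.
  apply: ge0_subset_integral; [exact: measurable_line_ball|exact: measurable_cell|
    exact: measurable_funTS|by move=> p _; rewrite lee_fin|exact: sub1].
have k2 : (\int[leb01 \x coinP]_(p in cell x l c) g (line p) <= I)%E.
  rewrite /I (ge0_integral_pushforward measurable_line _ mB')//; last exact: measurable_funTS.
  apply: ge0_subset_integral; [exact: measurable_cell|exact: measurable_line_ball|
    exact: measurable_funTS|by move=> p _; exact: g0|exact: sub2].
have k3 : (\int[nu]_(y in B) `|f y - K|%:E <=
    (8 * r)%:E * (2%:E * I + (e / (16 * r))%:E))%E.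
  apply: le_trans k1 _; apply: le_trans KE _.
  apply: lee_pmul.
  - by rewrite lee_fin mulr_ge0// e2_ge0.
  - rewrite adde_ge0 ?lee_fin ?(ltW e1)// mule_ge0//.
    by apply: integral_ge0 => p _; exact: g0.
  - by rewrite lee_fin; lra.
  - by apply: leeD => //; apply: lee_wpmul2l.
apply: le_trans (lee_wpmul2l _ k3) _ => //.
rewrite ge0_muleDr ?mule_ge0 ?lee_fin ?(ltW e1)// ge0_muleDr; last 2 first.
- by rewrite !mule_ge0// lee_fin; lra.
- by rewrite -EFinM lee_fin mulr_ge0// ?(ltW e1)//; lra.
rewrite !muleA -!EFinM; apply: leeD.
  by apply: lee_wpmul2r => //; rewrite lee_fin; lra.
rewrite lee_fin le_eqVlt; apply/orP; left; apply/eqP; field.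
by rewrite gt_eqF.
Qed.

Lemma laakso_Poincare : Poincare_inequality (nu : {measure set (borel X) -> \bar R}).
Proof.
(* The factor [512 * 6 ^+ 2] compares the measure of the ball of radius [6 * r]
   with that of the ball of radius [r]. *)
exists 1, (32 * (512 * 6 ^+ 2)), 6; split=> //; [lra|lra|].
move=> x r r0 f g fL fg; rewrite invr1.
set B := ball x r; set B' := ball x (6 * r); rewrite /=.
have [_ g0 _] := fg.
have -> : (\int[nu]_(y in B') (g y `^ 1) = \int[nu]_(y in B') g y)%E.
  by apply: eq_integral => y _; rewrite poweRe1//; exact: g0.
set I := (\int[nu]_(y in B') g y)%E.
have I0 : (0 <= I)%E by apply: integral_ge0 => y _; exact: g0.
have r60 : 0 < 6 * r by rewrite mulr_gt0.
have nuE (s : R) : exists b, nu (ball x s) = b%:E.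
  exists (fine (nu (ball x s))); rewrite fineK// ge0_fin_numE//.
  exact: nu_ball_lty.
have [b bE] : exists b, nu B = b%:E by exact: nuE.
have [b' b'E] : exists b, nu B' = b%:E by exact: nuE.
have b0 : 0 < b by rewrite -lte_fin -bE; exact: nu_ball_gt0.
have b'0 : 0 < b' by rewrite -lte_fin -b'E; exact: nu_ball_gt0.
have bb' : b' <= 512 * 6 ^+ 2 * b.
  rewrite -lee_fin EFinM -bE -b'E; apply: nu_ball_dbl => //; lra.
have FE := laakso_poincare_ball x fL fg r0; rewrite -/B -/B' -/I in FE.
rewrite bE b'E !inver (gt_eqF b0) (gt_eqF b'0) poweRe1; last first.
  by rewrite mule_ge0// lee_fin invr_ge0 ltW.
apply: (@le_trans _ _ (b^-1%:E * ((32 * r)%:E * I))%E).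
  by apply: lee_wpmul2l => //; rewrite lee_fin invr_ge0 ltW.
rewrite !muleA -!EFinM; apply: lee_wpmul2r => //; rewrite lee_fin.
rewrite mulrC ler_pdivrMr// mulrAC ler_pdivlMr//.
have : 0 <= r * (512 * 6 ^+ 2 * b - b').
  by apply: mulr_ge0; [exact: ltW|rewrite subr_ge0; exact: bb'].
by lra.
Qed.

End laakso_poincare.

(** * Compactness *)

Section laakso_compact.
Context {R : realType}.
Local Notation X := (laakso R).

(** The Cantor set is that of all branches; the parametrization is continuous
    because branches of high levels hardly move a point. *)
Lemma laakso_compact : compact [set: X].
Proof.
pose F (p : R * cantor_space) : X := pt p.1 p.2.
have -> : [set: X] = F @` (`[0, 1]%classic `*` [set: cantor_space]).
  apply/seteqP; split=> // x _; exists (pos x, side x : cantor_space).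
    by split=> //=; rewrite in_itv/= pos01.
  exact: pt_side.
apply: continuous_compact; last first.
  by apply: compact_setX; [exact: segment_compact|exact: cantor_space_compact].
apply: continuous_subspaceT => -[t b].
apply/metricType_numDomainType.cvgrPdist_lt => e e0.
have [n ne] := @e2_small R (e / 2) (divr_gt0 e0 (ltr0Sn _ 1)).
have nb : \forall c \near (b : cantor_space), forall m, (m < n)%N -> c m = b m.
  elim: n {ne} => [|n IH]; first by apply: (@nearW _ (nbhs (b : cantor_space))) => c m; rewrite ltn0.
  have nn : \forall c \near (b : cantor_space), c n = b n.
    have pc : (fun c : cantor_space => c n) @ b --> b n.
      exact: (@proj_continuous nat (fun=> bool) n b).
    by apply: (pc [set b n]); exact: discrete_set1.
  apply: (@filterS _ (nbhs (b : cantor_space)) _ _ _ _ (filterI IH nn)) => c [cm cn] m; rewrite ltnS leq_eqVlt => /orP[/eqP ->//|].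
  exact: cm.
exists ([set s | `|t - s| < e2 n], [set c | forall m, (m < n)%N -> c m = b m]) => /=.
  split; last exact: nb.
  by have := nbhsx_ballx t (e2 n) (e2_gt0 n); rewrite -ball_normE.
move=> [s c] [/= ts bc]; apply: (@le_lt_trans _ _ (2 * e2 n)); last by lra.
apply: mdist_pt_le; first by have := @e2_ge0 R n; lra.
move=> m; have [mn|nm _] := ltnP m n; first by rewrite /= bc// eqxx.
rewrite mulrDl mul1r; apply: lerD; rewrite (le_trans (h_bound _ _))// e2_le//.
Qed.

End laakso_compact.

(** * Bilipschitz images contain nowhere differentiable curves *)

Section curves_in_laakso.
Context {R : realType}.
Local Notation X := (laakso R).
Implicit Types (s t c : R) (m i j : nat) (k : int) (B : nat -> int -> bool).

(** The components of the complement of the wormholes of level [m], numbered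
    so that component [k] is centred at [2 * k * e2 m]. *)
Definition component m t : int := Num.floor ((t / e2 m + 1) / 2).

Lemma component_itv m t :
  (2 * (component m t)%:~R - 1) * e2 m <= t < (2 * (component m t)%:~R + 1) * e2 m.
Proof.
have e0 := @e2_gt0 R m; rewrite -ler_pdivlMr// -ltr_pdivrMr//.
have /andP[] := floor_itv ((t / e2 m + 1) / 2); rewrite -/(component m t) intrD.
by move=> h1 h2; apply/andP; split; lra.
Qed.

Lemma component_center m k : component m (2 * k%:~R * e2 m) = k.
Proof.
apply: floor_def; rewrite mulfK ?e2_neq0// ler_pdivlMr// ltr_pdivrMr// intrD.
by apply/andP; split; lra.
Qed.

(** A wormhole separates the two components. *)
Lemma component_neq m s t : component m s != component m t -> h m s + h m t <= `|s - t|.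
Proof.
wlog st : s t / component m s < component m t.
  move=> wl; rewrite neq_lt => /orP[st|ts].
    by apply: wl => //; rewrite lt_eqF.
  by rewrite addrC distrC; apply: wl => //; rewrite lt_eqF.
move=> _; have /andP[_ s1] := component_itv m s; have /andP[t1 _] := component_itv m t.
set w := (2 * (component m t)%:~R - 1) * e2 m in t1.
have w0 : h m w = 0.
  rewrite /w (_ : _ - 1 = (2 * (component m t - 1) + 1)%:~R) ?h_odd//.
  by rewrite !(intrD, intrM, intrN); ring.
have sw : s <= w.
  apply: le_trans (ltW s1) _; rewrite ler_pM2r ?e2_gt0//.
  have : (component m s + 1)%:~R <= (component m t)%:~R :> R by rewrite ler_int; lia.
  by rewrite intrD; lra.
have := h_le_dist s w0; have := h_le_dist t w0.
rewrite (ger0_norm (_ : 0 <= t - w)) ?subr_ge0// (ler0_norm (_ : s - w <= 0)) ?subr_le0//.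
by rewrite (ler0_norm (_ : s - t <= 0)) ?subr_le0 ?(le_trans sw)//; lra.
Qed.

(** The curve that passes component [k] of level [m] on the branch [B m k];
    the branch may change from one component to the next because the wormholes
    between them glue the branches together. *)
Definition curve B t : X := pt t (fun m => B m (component m (clamp t))).

Lemma curve_lip B s t : mdist (curve B s) (curve B t) <= `|s - t|.
Proof.
apply: mdist_pt_le => // m Bm.
apply: le_trans (component_neq _) (clamp_lip s t).
by apply: contra Bm => /eqP ->.
Qed.

End curves_in_laakso.

Section zigzag.
Context {R : realType} {V : normedModType R}.
Local Notation X := (laakso R).
Variables (F : X -> V) (L : R) (q : nat).
Hypotheses (L1 : 1 <= L) (q0 : (0 < q)%N) (qL : e2 q <= (8 * L ^+ 2)^-1).
Hypothesis FL : forall x y,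
  L^-1 * mdist x y <= `|F x - F y| <= L * mdist x y.
Implicit Types (s t c : R) (m i j : nat) (k : int) (B : nat -> int -> bool).

Let L0 : 0 < L. Proof. exact: lt_le_trans L1. Qed.

Definition mid m k : R := 2 * k%:~R * e2 m.
Definition lft m k : R := (2 * k%:~R - 1) * e2 m.
Definition rgt m k : R := (2 * k%:~R + 1) * e2 m.

Definition set_level B m (b : bool) : nat -> int -> bool :=
  fun n k => if n == m then b else B n k.

(** The deviation from the midpoint when component [k] of level [m] is passed on
    branch [b]. *)
Definition bend B m k b : R :=
  `|F (curve (set_level B m b) (mid m k)) -
    2^-1 *: (F (curve B (lft m k)) + F (curve B (rgt m k)))|.

(** Branches of the levels [q * i] are chosen recursively so that the image of
    the curve bends; the other levels are not used, so that later choices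
    perturb the curve by much less than the bends already made. *)
Fixpoint branches i : nat -> int -> bool :=
  if i is j.+1 then
    fun m k => if m == (q * j)%N then bend (branches j) m k false < L^-1 * e2 m
               else branches j m k
  else fun _ _ => false.

Definition zigzag : nat -> int -> bool := fun m => branches m.+1 m.

Lemma h_mid m k : h m (mid m k) = e2 m.
Proof.
have [w [w0 gw hw]] := h_near m (mid m k); have [j wj] := h0_odd w0.
apply/eqP; rewrite eq_le h_bound hw; apply: grid_sep => //.
  by exists (2 * k); rewrite intrM.
apply/eqP; rewrite wj /mid => /(mulIf (e2_neq0 m)) kj.
have /eqP : (2 * k)%:~R = (2 * j + 1)%:~R :> R by rewrite -kj intrM.
by rewrite eqr_int; lia.
Qed.

(** The two candidates are the images of points at distance [2 * e2 m], so they
    cannot both be near the midpoint. *)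
Lemma bend_ex B m k : 0 <= mid m k <= 1 ->
  L^-1 * e2 m <= bend B m k (bend B m k false < L^-1 * e2 m).
Proof.
move=> c01; case: ltP => // bf; rewrite leNgt; apply/negP => bt.
set p := fun b => F (curve (set_level B m b) (mid m k)).
set a := 2^-1 *: (F (curve B (lft m k)) + F (curve B (rgt m k))).
have : `|p true - p false| < 2 * (L^-1 * e2 m).
  rewrite (le_lt_trans (ler_distD a _ _))// mulrDl mul1r.
  by rewrite ltrD// distrC.
apply/negP; rewrite -leNgt.
have /andP[+ _] := FL (curve (set_level B m true) (mid m k))
  (curve (set_level B m false) (mid m k)).
apply: le_trans; rewrite mulrCA ler_pM2l ?invr_gt0//.
apply: le_trans (mdist_co _ _ m) => /=; rewrite clamp_id// /set_level eqxx.
rewrite h_mid /sg expr1 expr0 mulN1r mul1r -opprD normrN ger0_norm.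
  by rewrite mulrDl mul1r.
by rewrite addr_ge0// e2_ge0.
Qed.

Lemma branches_stable i j m : (m < q * i)%N ->
  branches (i + j) m = branches i m.
Proof.
move=> mi; elim: j => [|j IH]; first by rewrite addn0.
rewrite addnS /= -IH; apply/funext => k; rewrite ifN//.
by apply: contraTneq mi => ->; rewrite -leqNgt leq_mul2l leq_addr orbT.
Qed.

Lemma branches_unset i m : (q * i <= m)%N -> branches i m = fun=> false.
Proof.
elim: i => [//|i IH] im; apply/funext => k /=; rewrite ifN ?IH//.
  by apply: leq_trans im; rewrite leq_mul2l leqnSn orbT.
by apply: contraTneq im => ->; rewrite -ltnNge ltn_mul2l q0 ltnSn.
Qed.

Lemma zigzag_lt i m : (m < q * i)%N -> zigzag m = branches i m.
Proof.
move=> mi; rewrite /zigzag; have mm : (m < q * m.+1)%N.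
  by rewrite (leq_trans (ltnSn m))// leq_pmull.
have [im|im] := leqP i m.+1.
  by rewrite -(subnKC im) branches_stable.
by rewrite -(subnKC (ltnW im)) branches_stable.
Qed.

Lemma zigzag_unused i m : (q * i < m < q * i.+1)%N -> zigzag m = fun=> false.
Proof.
move=> /andP[h1 h2]; rewrite (zigzag_lt h2); apply/funext => k /=.
by rewrite gtn_eqF// branches_unset// ltnW.
Qed.

Lemma zigzag_chosen i k :
  zigzag (q * i)%N k = (bend (branches i) (q * i) k false < L^-1 * e2 (q * i)).
Proof.
rewrite (@zigzag_lt i.+1) /= ?eqxx//.
by rewrite ltn_mul2l q0 ltnSn.
Qed.

Let lip B B' t (e : R) : 0 <= e -> (forall m, B m (component m (clamp t)) != B' m (component m (clamp t)) ->
  2 * h m (clamp t) <= e) -> `|F (curve B t) - F (curve B' t)| <= L * e.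
Proof.
move=> e0 BB'; have /andP[_ /le_trans] := FL (curve B t) (curve B' t); apply.
rewrite ler_wpM2l ?(ltW L0)//; apply: mdist_pt_le; first by rewrite subrr normr0.
by move=> m /BB'; rewrite mulrDl mul1r.
Qed.

Let agree i m k : (m < q * i.+1)%N -> m != (q * i)%N ->
  zigzag m k = branches i m k.
Proof.
move=> mi mq; have [h|h] := ltnP m (q * i); first by rewrite (zigzag_lt h).
rewrite (branches_unset h) (@zigzag_unused i)// mi andbT.
by rewrite ltn_neqAle eq_sym mq.
Qed.

(** Half of the bend that was chosen at level [q * i] survives: the branches chosen
    later have levels at least [q * i.+1], hence move points by at most
    [2 * e2 (q * i.+1)], which the size of [q] makes negligible. *)
Lemma zigzag_bend i k (m := (q * i)%N) : 0 <= lft m k -> rgt m k <= 1 ->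
  (2 * L)^-1 * e2 m <= `|F (curve zigzag (mid m k)) -
    2^-1 *: (F (curve zigzag (lft m k)) + F (curve zigzag (rgt m k)))|.
Proof.
move=> l0 r1; have e0 := @e2_gt0 R m.
have lm : lft m k = mid m k - e2 m by rewrite /lft /mid; ring.
have rm : rgt m k = mid m k + e2 m by rewrite /rgt /mid; ring.
have c01 : 0 <= mid m k <= 1 by lra.
have l01 : 0 <= lft m k <= 1 by lra.
have r01 : 0 <= rgt m k <= 1 by lra.
pose e : R := 2 * e2 (q * i.+1); have eE : e = 2 * e2 m * e2 q.
  by rewrite /e mulnS addnC e2D; ring.
have ee0 : 0 <= e by rewrite mulr_ge0// e2_ge0.
have small n t : (q * i.+1 <= n)%N -> 2 * h n t <= e.
  move=> ni; rewrite ler_pM2l//; apply: le_trans (h_bound _ _) _; exact: e2_le.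
have hodd t : (t = lft m k \/ t = rgt m k) -> h m t = 0.
  case=> ->; last by rewrite /rgt -(h_odd m k) intrD intrM.
  by rewrite /lft -(h_odd m (k - 1)) !(intrD,intrM,intrN); congr h; ring.
have near_end t : 0 <= t <= 1 -> (t = lft m k \/ t = rgt m k) ->
    `|F (curve zigzag t) - F (curve (branches i) t)| <= L * e.
  move=> t01 /hodd ht; apply: lip => // n; rewrite clamp_id//.
  have [->|nm] := eqVneq n m; first by rewrite ht mulr0.
  have [ni|ni] := ltnP n (q * i.+1); last by move=> _; exact: small.
  by rewrite (agree _ ni nm) eqxx.
have near_mid : `|F (curve zigzag (mid m k)) -
    F (curve (set_level (branches i) m (zigzag m k)) (mid m k))| <= L * e.
  apply: lip => // n; rewrite clamp_id// /set_level.
  have [->|nm] := eqVneq n m; first by rewrite component_center eqxx.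
  have [ni|ni] := ltnP n (q * i.+1); last by move=> _; exact: small.
  by rewrite (agree _ ni nm) eqxx.
have := bend_ex (branches i) c01; rewrite -zigzag_chosen -/m /bend.
have := near_end _ l01 (or_introl erefl); have := near_end _ r01 (or_intror erefl).
move: near_mid; set a := F _; set a' := F _; set b := F _; set b' := F _.
set c := F _; set c' := F _ => aa' bb' cc' dev.
have tri : `|a' - 2^-1 *: (c' + b')| <= `|a - a'| + `|a - 2^-1 *: (c + b)| +
    2^-1 * (`|c - c'| + `|b - b'|).
  have -> : a' - 2^-1 *: (c' + b') = (a' - a) + (a - 2^-1 *: (c + b)) +
      2^-1 *: ((c - c') + (b - b')).
    rewrite addrA subrK (_ : (c - c') + (b - b') = (c + b) - (c' + b')); last first.
      by rewrite opprD addrACA.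
    by rewrite scalerBr addrA subrK.
  rewrite (le_trans (ler_normD _ _))// lerD//.
    by rewrite (le_trans (ler_normD _ _))// (distrC a').
  by rewrite normrZ ger0_norm ?invr_ge0// ler_wpM2l ?invr_ge0// ler_normD.
have Le : L * e <= (4 * L)^-1 * e2 m.
  have p0 : 0 <= 2 * L * e2 m by rewrite !mulr_ge0 ?(ltW L0) ?(ltW e0).
  have -> : L * e = 2 * L * e2 m * e2 q by rewrite eE; ring.
  have -> : (4 * L)^-1 * e2 m = 2 * L * e2 m * (8 * L ^+ 2)^-1.
    by field; rewrite gt_eqF.
  exact: ler_wpM2l.
have -> : (2 * L)^-1 * e2 m = L^-1 * e2 m - 2 * ((4 * L)^-1 * e2 m).
  by field; rewrite gt_eqF.
lra.
Qed.

End zigzag.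

Section nowhere_differentiable.
Context {R : realType} {V : normedModType R}.
Local Notation X := (laakso R).

Lemma differentiable_linear_approx (f : R -> V) (t : R) : differentiable f t ->
  exists v : V, forall e : R, 0 < e -> exists2 d : R, 0 < d &
    forall s, `|s - t| < d -> `|f s - f t - (s - t) *: v| <= e * `|s - t|.
Proof.
move=> /derivable1_diffP/cvg_ex[v fv]; exists v => e e0.
move/cvgrPdist_le : fv => /(_ _ e0); rewrite near_withinE => /nbhs_ballP[d /= d0 H].
exists d => // s st; have [->|sn] := eqVneq s t.
  by rewrite !subrr normr0 scale0r subr0 normr0 mulr0.
have s0 : s - t != 0 by rewrite subr_eq0.
have := H (s - t); rewrite -ball_normE/= sub0r normrN => /(_ st s0).
rewrite scaler1 subrK => vs.
have -> : f s - f t - (s - t) *: v =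
    - ((s - t) *: (v - (s - t)^-1 *: (f s - f t))).
  by rewrite scalerBr scalerA divff// scale1r opprB.
by rewrite normrN normrZ mulrC ler_wpM2r.
Qed.

(** An affine function has no deviation at midpoints, so differentiability at [t]
    forces the deviation on the components around [t] to be of smaller order than
    their length. *)
Lemma bend_not_differentiable (f : R -> V) (t b : R) (q : nat) : (0 < q)%N ->
  0 < b -> 0 < t < 1 ->
  (forall i k, 0 <= lft (q * i) k :> R -> rgt (q * i) k <= 1 :> R ->
    b * e2 (q * i) <= `|f (mid (q * i) k) -
      2^-1 *: (f (lft (q * i) k) + f (rgt (q * i) k))|) ->
  ~ differentiable f t.
Proof.
move=> q0 b0 /andP[t0 t1] bend /differentiable_linear_approx[v fv].
have [d d0 fd] := fv (b / 8) (divr_gt0 b0 (ltr0Sn _ 7)).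
(* Small enough for the component around [t] to stay in [0, 1]. *)
pose r := Num.min d (Num.min t (1 - t)).
have r0 : 0 < r by rewrite !lt_min d0 t0 subr_gt0.
have [n ne] := @e2_small R (r / 2) (divr_gt0 r0 (ltr0Sn _ 1)).
set m := (q * n)%N.
have em : e2 m < r / 2.
  by apply: le_lt_trans ne; apply: e2_le; rewrite leq_pmull.
have [rd rt rt1] : [/\ r <= d, r <= t & r <= 1 - t].
  by rewrite /r !ge_min !lexx !orbT.
have e0 := @e2_gt0 R m.
set k := component m t; have /andP[] := component_itv m t; rewrite -/k => lt tr.
have := bend n k; rewrite -/m.
have lm : lft m k = mid m k - e2 m :> R by rewrite /lft /mid; ring.
have rm : rgt m k = mid m k + e2 m :> R by rewrite /rgt /mid; ring.
rewrite -/(lft m k) -/(rgt m k) in lt tr.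
have l0 : 0 <= lft m k :> R by lra.
have r1 : rgt m k <= 1 :> R by lra.
move=> /(_ l0 r1); apply/negP; rewrite -ltNge.
have app s : `|s - t| <= 2 * e2 m ->
    `|f s - f t - (s - t) *: v| <= b / 4 * e2 m.
  move=> st; apply: le_trans (fd s _) _; first by lra.
  by rewrite (le_trans (ler_wpM2l _ st))// ?divr_ge0 ?(ltW b0)//; lra.
have a1 := app (mid m k); have a2 := app (lft m k); have a3 := app (rgt m k).
have -> : f (mid m k) - 2^-1 *: (f (lft m k) + f (rgt m k)) =
  (f (mid m k) - f t - (mid m k - t) *: v) -
  2^-1 *: ((f (lft m k) - f t - (lft m k - t) *: v) +
           (f (rgt m k) - f t - (rgt m k - t) *: v)).
  have -> : (f (lft m k) - f t - (lft m k - t) *: v) +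
           (f (rgt m k) - f t - (rgt m k - t) *: v) =
      (f (lft m k) + f (rgt m k)) - 2 *: (f t + (mid m k - t) *: v).
    rewrite scalerDr scalerA (_ : 2 * (mid m k - t) = (lft m k - t) + (rgt m k - t)); last first.
      by rewrite lm rm; ring.
    rewrite (_ : 2 *: f t = f t + f t); last by rewrite scaler_nat mulr2n.
    by rewrite addrACA (addrACA (f (lft m k))) -!opprD -addrA -opprD -scalerDl.
  rewrite scalerBr scalerA mulVf// scale1r opprB -(addrA (f (mid m k))) -opprD.
  by rewrite addrA subrK.
apply: le_lt_trans (ler_normB _ _) _; rewrite normrZ ger0_norm ?invr_ge0//.
have n1 : `|mid m k - t| <= 2 * e2 m by rewrite ler_norml; lra.
have n2 : `|lft m k - t| <= 2 * e2 m by rewrite ler_norml; lra.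
have n3 : `|rgt m k - t| <= 2 * e2 m by rewrite ler_norml; lra.
have nn := ler_normD (f (lft m k) - f t - (lft m k - t) *: v)
  (f (rgt m k) - f t - (rgt m k - t) *: v).
move: (a1 n1) (a2 n2) (a3 n3) nn => {}a1 {}a2 {}a3 nn.
have : 0 < b * e2 m by rewrite mulr_gt0.
lra.
Qed.

End nowhere_differentiable.

(** The image of the zigzag curve would be a Lipschitz curve that is
    differentiable at no point of the interval. *)
Theorem laakso_not_embeds_RNP (R : realType) (V : completeNormedModType R) :
  radon_nikodym_property V -> ~ bilipschitz_embeds_in_Banach (laakso R) V.
Proof.
move=> RNP [F [L L1 FL]].
have L0 : 0 < L := lt_le_trans ltr01 L1.
have [q qL] := @e2_small R (8 * L ^+ 2)^-1 (ltac:(by rewrite invr_gt0 mulr_gt0// exprn_gt0)).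
have q1L : e2 q.+1 <= (8 * L ^+ 2)^-1 by apply: le_trans (ltW qL); exact: e2_le.
pose f t : V := F (curve (zigzag F L q.+1) t).
have [A [mA A0 fA]] : {ae lebesgue_measure, forall t : R, differentiable f t}.
  apply: RNP; exists L => s t; have /andP[_ /le_trans] := FL
    (curve (zigzag F L q.+1) s) (curve (zigzag F L q.+1) t).
  by apply; rewrite ler_wpM2l ?(ltW L0)//; exact: curve_lip.
have : (lebesgue_measure (`]0%R, 1%R[%classic : set R) <= lebesgue_measure A)%E.
  apply: le_measure; rewrite ?inE//.
  move=> t; rewrite /= in_itv/= => t01; apply: fA => /=.
  apply: (@bend_not_differentiable _ _ f t (2 * L)^-1 q.+1) => //.
    by rewrite invr_gt0 mulr_gt0.
  by move=> i k l0 r1; exact: zigzag_bend.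
by rewrite A0 lebesgue_measure_itv/= lte01 oppr0 adde0 leNgt lte01.
Qed.

(** * Random slices *)

Section slices.
Context {R : realType}.
Local Notation Om := (measurableTypeR R).
Local Notation P := (@coinP R).
Implicit Types (z : Om) (n m i j : nat) (a : int) (b : nat -> bool) (E : set Om).

(** A vertex of stage [n] is a point at height [a * e2 n] whose branches matter up
    to level [n]. The branch of a level of which that height is a wormhole is
    masked, so that all lines through the vertex give it the same name. *)
Definition word n a b : seq bool :=
  [seq (if h m (a%:~R * e2 n : R) == 0 then false else b m) | m <- iota 0 n.+1].

(** Three disjoint families of coins: one to mix in the height, one for the start
    of the slice, and one for the steps, numbered by vertices. *)
Definition tag_key : nat :=
  pickle (None : option (option (nat * int * seq bool * bool))).
Definition start_key : nat :=
  pickle (Some None : option (option (nat * int * seq bool * bool))).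
Definition step_key (v : nat * int * seq bool * bool) : nat := pickle (Some (Some v)).

Lemma step_key_inj : injective step_key.
Proof. by move=> v w /(pcan_inj pickleK)[]. Qed.

Definition vkey n a b (i : bool) : nat := step_key (n, a, word n a b, i).

(** The height, in units of [e2 n], at which the random slice crosses the line
    with branches [b] at stage [n]: it makes one step [-1], [0] or [1] in the
    new unit, decided by two coins that belong to the current vertex. Lines that
    pass through the same vertex thus move together. *)
Fixpoint slice b n z : int :=
  if n is j.+1 then
    2 * slice b j z + coin (vkey j (slice b j z) b true) z
                    + coin (vkey j (slice b j z) b false) z - 1
  else coin start_key z.

Lemma slice_bounds b n z :
  2 * slice b n z - 1 <= slice b n.+1 z <= 2 * slice b n z + 1.
Proof. by rewrite /=; case: (coin _ z) (coin _ z) => [] []; lia. Qed.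

(** Later steps add up to less than one unit, so the slice stays between these
    two heights forever. *)
Definition upper b n z : R := (slice b n z + 1)%:~R * e2 n.
Definition lower b n z : R := (slice b n z - 1)%:~R * e2 n.

Lemma upper_mono b z i j : (i <= j)%N -> upper b j z <= upper b i z.
Proof.
move=> /subnKC <-; elim: (j - i)%N => [|d IH]; first by rewrite addn0.
apply: le_trans IH; rewrite addnS /upper (e2S (i + d)) mulrA.
rewrite ler_pM2r ?e2_gt0// -[2]/(2%:~R) -intrM ler_int.
by have /andP[_] := slice_bounds b (i + d) z; lia.
Qed.

Lemma lower_mono b z i j : (i <= j)%N -> lower b i z <= lower b j z.
Proof.
move=> /subnKC <-; elim: (j - i)%N => [|d IH]; first by rewrite addn0.
apply: le_trans IH _; rewrite addnS /lower (e2S (i + d)) mulrA.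
rewrite ler_pM2r ?e2_gt0// -[2]/(2%:~R) -intrM ler_int.
by have /andP[+ _] := slice_bounds b (i + d) z; lia.
Qed.

Lemma lower_le_upper b z i j : lower b i z <= upper b j z.
Proof.
apply: (le_trans (lower_mono b z (leq_maxl i j))).
apply: le_trans (upper_mono b z (leq_maxr i j)).
by rewrite /lower /upper ler_pM2r ?e2_gt0// ler_int; lia.
Qed.

Definition below b (t : R) : set Om := [set z | exists n, upper b n z < t].

Lemma not_below b t n z : t <= lower b n z -> ~ below b t z.
Proof.
move=> tn [j]; apply/negP; rewrite -leNgt.
exact: le_trans tn (lower_le_upper b z n j).
Qed.

Lemma measurable_slice b n a : measurable [set z | slice b n z = a].
Proof.
elim: n a => [|n IH] a /=.
  case: (a =P 0) => [->|a0].
    rewrite (_ : [set _ | _] = [set z | coin start_key z = false]).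
      exact: measurable_coin.
    by apply/seteqP; split=> z /=; case: (coin _ z).
  case: (a =P 1) => [->|a1].
    rewrite (_ : [set _ | _] = [set z | coin start_key z = true]).
      exact: measurable_coin.
    by apply/seteqP; split=> z /=; case: (coin _ z).
  rewrite (_ : [set _ | _] = set0)//; apply/seteqP; split=> z //=.
  by case: (coin _ z); [move=> /esym/a1|move=> /esym/a0].
rewrite (_ : [set _ | _] = \bigcup_(c in [set: int])
    ([set z | slice b n z = c] `&` [set z | [set w : seq bool |
      2 * c + nth false w 0 + nth false w 1 - 1 = a]
      [seq coin k z | k <- [:: vkey n c b true; vkey n c b false]]])).
  apply: countable_bigcupT_measurable => [|c]; first exact: countableP.
  by apply: measurableI; [exact: IH|exact: measurable_coins].
apply/seteqP; split=> z /=; first by move=> h; exists (slice b n z).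
by move=> [c _ [<-]].
Qed.

Lemma measurable_below b t : measurable (below b t).
Proof.
rewrite (_ : below b t = \bigcup_n \bigcup_(a in [set a : int | (a + 1)%:~R * e2 n < t])
   [set z | slice b n z = a]).
  apply: bigcupT_measurable => n; rewrite bigcup_mkcond.
  apply: countable_bigcupT_measurable => [|a]; first exact: countableP.
  by case: ifP => _; [exact: measurable_slice|exact: measurable0].
apply/seteqP; split=> z.
  by move=> [n nt]; exists n => //; exists (slice b n z).
by move=> [n _ [a /= at0 sa]]; exists n; rewrite /upper sa.
Qed.

(** Events that are decided before the steps of stage [n] are made. *)
Definition adapted n E := measurable E /\
  forall v, (n <= v.1.1.1)%N -> forall z, E (flip (step_key v) z) -> E z.

Lemma slice_flip b n v z : (n <= v.1.1.1)%N ->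
  slice b n (flip (step_key v) z) = slice b n z.
Proof.
elim: n => [|n IH] nv /=; first by rewrite coin_flip_neq// /start_key
  (inj_eq (pcan_inj pickleK)).
rewrite IH; last exact: ltnW.
have ne (i : bool) : vkey n (slice b n z) b i != step_key v.
  apply: contraTneq nv => /step_key_inj <- /=; by rewrite ltnn.
by rewrite !coin_flip_neq.
Qed.

Lemma adapted_slice b n a : adapted n [set z | slice b n z = a].
Proof.
split; first exact: measurable_slice.
by move=> v nv z /=; rewrite slice_flip.
Qed.

Lemma adaptedI n E F : adapted n E -> adapted n F -> adapted n (E `&` F).
Proof.
move=> [mE fE] [mF fF]; split; first exact: measurableI.
by move=> v nv z [/(fE v nv) ? /(fF v nv)].
Qed.

Lemma adaptedS n E : adapted n E -> adapted n.+1 E.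
Proof. by move=> [mE fE]; split=> // v nv; apply: fE; exact: ltnW. Qed.

(** Coins of different steps are fair and independent of the past. *)
Lemma coinP_adapted (V : seq (nat * int * seq bool * bool)) (c : nat -> bool) n E :
  adapted n E -> uniq V -> (forall v, v \in V -> v.1.1.1 = n) ->
  P (E `&` [set z | forall v, v \in V -> coin (step_key v) z = c (step_key v)]) =
  ((e2 (size V))%:E * P E)%E.
Proof.
move=> aE; elim: V => [_ _|v V IH /= /andP[vV uV] Vn].
  rewrite (_ : e2 _ = 1) ?mul1e; last exact: expr0.
  rewrite (_ : _ `&` _ = E)//.
  by apply/seteqP; split=> [z []|z].
have {}IH := IH uV (fun w wV => Vn w (@mem_behead _ (v :: V) w wV)).
set F := E `&` _ in IH.
rewrite (_ : _ `&` _ = F `&` [set z | coin (step_key v) z = c (step_key v)]).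
  rewrite coinP_half.
  - by rewrite IH muleA -EFinM /e2 exprS.
  - apply: measurableI; first by case: aE.
    rewrite (_ : [set _ | _] = [set z | forall k, k \in map step_key V -> coin k z = c k]).
      exact: measurable_cyl.
    apply/seteqP; split=> z /= h w; first by move=> /mapP[u uVV ->]; exact: h.
    by move=> wV; apply: h; rewrite mem_map//; exact: step_key_inj.
  - move=> z [Ez Fz]; split.
      by case: aE => _ /(_ v); rewrite Vn ?mem_head// => /(_ (leqnn _)); apply.
    move=> w wV; rewrite -(Fz w wV) coin_flip_neq//.
    by apply: contraNneq vV => /step_key_inj <-.
apply/seteqP; split=> z /=.
  move=> [Ez h]; split; last by apply: h; rewrite mem_head.
  by split=> // w wV; apply: h; rewrite in_cons wV orbT.
by move=> [[Ez h] zv]; split=> // w; rewrite in_cons => /orP[/eqP ->|/h].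
Qed.

End slices.

Section slice_law.
Context {R : realType}.
Local Notation Om := (measurableTypeR R).
Local Notation P := (@coinP R).
Implicit Types (z : Om) (n m i j : nat) (a k : int) (b : nat -> bool) (E : set Om).

Definition steps n a b : seq (nat * int * seq bool * bool) :=
  [:: (n, a, word (R := R) n a b, true); (n, a, word (R := R) n a b, false)].

Lemma sliceS b n z a : slice b n z = a -> slice b n.+1 z =
  2 * a + coin (vkey (R := R) n a b true) z + coin (vkey (R := R) n a b false) z - 1.
Proof. by move=> /= ->. Qed.

Let move2 b n a E (c : bool) : adapted n E -> (forall z, E z -> slice b n z = a) ->
  P (E `&` [set z | slice b n.+1 z = 2 * a + (if c then 1 else -1)]) = ((e2 2)%:E * P E)%E.
Proof.
move=> aE Ea; rewrite -(@coinP_adapted R (steps n a b) (fun=> c) n E)//; last first.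
- by move=> v; rewrite !inE => /orP[] /eqP ->.
- by rewrite /= !inE; apply/andP; split=> //; apply/eqP => -[].
congr P; apply/seteqP; split=> z [Ez]; have sa := Ea z Ez.
  move=> /= h; split=> // v; rewrite !inE; move: h; rewrite -/(slice b n.+1 z) (sliceS sa) /vkey.
  move=> h /orP[] /eqP ->; move: h; case: (coin _ z) (coin _ z) c => [] [] []; lia.
move=> h; split=> //; rewrite /= -/(slice b n.+1 z) (sliceS sa) /vkey.
by rewrite !h ?inE ?eqxx ?orbT//; case: c {h}; lia.
Qed.

Lemma coinP_up b n a E : adapted n E -> (forall z, E z -> slice b n z = a) ->
  P (E `&` [set z | slice b n.+1 z = 2 * a + 1]) = ((e2 2)%:E * P E)%E.
Proof. exact: (@move2 b n a E true). Qed.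

Lemma coinP_down b n a E : adapted n E -> (forall z, E z -> slice b n z = a) ->
  P (E `&` [set z | slice b n.+1 z = 2 * a - 1]) = ((e2 2)%:E * P E)%E.
Proof. exact: (@move2 b n a E false). Qed.

Lemma coinP_stay b n a E : adapted n E -> (forall z, E z -> slice b n z = a) ->
  P (E `&` [set z | slice b n.+1 z = 2 * a]) = ((e2 1)%:E * P E)%E.
Proof.
move=> aE Ea; have mE := aE.1.
have mS c : measurable (E `&` [set z | slice b n.+1 z = c]).
  by apply: measurableI => //; exact: measurable_slice.
have EE : E = (E `&` [set z | slice b n.+1 z = 2 * a]) `|`
    ((E `&` [set z | slice b n.+1 z = 2 * a + 1]) `|`
     (E `&` [set z | slice b n.+1 z = 2 * a - 1])).
  apply/seteqP; split=> z; last by case=> [|[]] [].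
  move=> Ez; have := sliceS (Ea z Ez); rewrite /setU /setI /mkset.
  by case: (coin _ z) (coin _ z) => [] [] ->; [right; left|left|left|right; right]; split=> //; lia.
have : P E = (P (E `&` [set z | slice b n.+1 z = (2 * a)%R]) +
    (P (E `&` [set z | slice b n.+1 z = (2 * a + 1)%R]) +
     P (E `&` [set z | slice b n.+1 z = (2 * a - 1)%R])))%E.
  rewrite {1}EE measureU//; last 2 first.
  - exact: measurableU.
  - by apply/seteqP; split=> z // [[_ /=]] => h [] [_ /=]; rewrite h; lia.
  rewrite measureU//.
  by apply/seteqP; split=> z // [[_ /=]] => h [_ /=]; rewrite h; lia.
rewrite (coinP_up aE Ea) (coinP_down aE Ea).
have : P E \is a fin_num by exact: fin_num_measure.
have : P (E `&` [set z | slice b n.+1 z = 2 * a]) \is a fin_num.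
  exact: fin_num_measure.
move: (P E) (P (E `&` _)) => [p| |]// [q| |]// _ _; rewrite -!EFinM -!EFinD => -[pq].
congr EFin; move: pq; rewrite /e2 !exprS expr0; lra.
Qed.

Lemma coinP_start (c : bool) : P [set z | coin start_key z = c] = (2^-1)%:E.
Proof.
rewrite -[X in P X]setTI coinP_half// [X in (_ * X)%E](_ : _ = 1%E) ?mule1//.
exact: coinPT.
Qed.

Lemma coinP_slice_even b n a :
  P [set z | slice b n.+1 z = 2 * a] = ((e2 1)%:E * P [set z | slice b n z = a])%E.
Proof.
rewrite -(coinP_stay (adapted_slice b n a) (fun _ => id)).
congr P; apply/seteqP; split=> z; last by case.
rewrite /setI /mkset => h; split=> //; have := slice_bounds b n z; rewrite h; lia.
Qed.

Lemma coinP_slice_odd b n a : P [set z | slice b n.+1 z = 2 * a + 1] =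
  ((e2 2)%:E * P [set z | slice b n z = a] + (e2 2)%:E * P [set z | slice b n z = (a + 1)%R])%E.
Proof.
rewrite -(coinP_up (adapted_slice b n a) (fun _ => id)).
rewrite -(coinP_down (adapted_slice b n (a + 1)) (fun _ => id)).
have mS c c' : measurable ([set z : Om | slice b n z = c] `&` [set z | slice b n.+1 z = c']).
  by apply: measurableI; exact: measurable_slice.
rewrite -measureU//; last first.
  by apply/seteqP; split=> z // [[+ _] [+ _]]; rewrite /mkset => ->; lia.
congr P; apply/seteqP; split=> z; rewrite /setU /setI /mkset.
  move=> h; have : slice b n z = a \/ slice b n z = a + 1.
    by have := slice_bounds b n z; rewrite h; lia.
  by case=> hs; [left|right]; split=> //; lia.
by case=> -[_ ->]; lia.
Qed.

Lemma int_parity a : exists k, a = 2 * k \/ a = 2 * k + 1.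
Proof.
exists (a %/ 2)%Z; have := divz_eq a 2; have := modz_ge0 a (isT : (2 : int) != 0).
by have := ltz_pmod a (isT : (0 : int) < 2); lia.
Qed.

(** By induction on the stage: an even point is reached only by staying, with
    probability 1/2, and an odd one from each of its two neighbours with
    probability 1/4. On [0, 1] the probabilities thus keep halving. *)
Lemma slice_law b n a :
  (P [set z | slice b n z = a] <= (e2 n.+1)%:E)%E /\
  (0 <= a <= (2 ^ n)%N%:Z -> P [set z | slice b n z = a] = (e2 n.+1)%:E).
Proof.
elim: n a => [|n IH] a.
  have [->|a0] := eqVneq a 0.
    rewrite (_ : [set _ | _] = [set z | coin start_key z = false]).
      by rewrite coinP_start /e2 expr1.
    by apply/seteqP; split=> z /=; case: (coin _ z).
  have [->|a1] := eqVneq a 1.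
    rewrite (_ : [set _ | _] = [set z | coin start_key z = true]).
      by rewrite coinP_start /e2 expr1.
    by apply/seteqP; split=> z /=; case: (coin _ z).
  rewrite (_ : [set _ | _] = set0) ?measure0; last first.
    apply/seteqP; split=> z //=; move: a0 a1.
    by case: (coin _ z) => + + E; rewrite -E.
  by split; [rewrite lee_fin e2_ge0|rewrite expn0; lia].
have [k [->|->]] := int_parity a.
  rewrite coinP_slice_even (_ : e2 n.+2 = e2 1 * e2 n.+1); last by rewrite -e2D.
  have [h1 h2] := IH k; split.
    by rewrite EFinM lee_wpmul2l// lee_fin e2_ge0.
  move=> hk; rewrite h2//; move: hk; rewrite expnS PoszM; lia.
rewrite coinP_slice_odd.
have -> : e2 n.+2 = e2 2 * e2 n.+1 + e2 2 * e2 n.+1 :> R.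
  by rewrite /e2 !exprS expr0; lra.
have [h1 h2] := IH k; have [h3 h4] := IH (k + 1); split.
  by rewrite EFinD !EFinM leeD// lee_wpmul2l// lee_fin e2_ge0.
move=> hk; have hk2 : 0 <= k /\ k + 1 <= (2 ^ n)%N%:Z.
  by move: hk; rewrite expnS PoszM; lia.
by rewrite h2 ?h4//; lia.
Qed.

Lemma word_eq n a b b' :
  (forall m, (m <= n)%N -> b m = b' m \/ h m (a%:~R * e2 n : R) = 0) ->
  word (R := R) n a b = word (R := R) n a b'.
Proof.
move=> bb'; apply/eq_in_map => m; rewrite mem_iota add0n ltnS => /andP[_ mn].
by case: (bb' m mn) => [->//|->]; rewrite eqxx.
Qed.

Lemma word_neq n a b b' m : (m <= n)%N -> b m != b' m ->
  h m (a%:~R * e2 n : R) != 0 -> word (R := R) n a b != word (R := R) n a b'.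
Proof.
move=> mn bm hm; apply: contra bm => /eqP/eq_in_map/(_ m).
by rewrite mem_iota add0n ltnS mn (negbTE hm) => /(_ isT) ->.
Qed.

Lemma slice_step_eq b b' n z a : slice b n z = a -> slice b' n z = a ->
  word (R := R) n a b = word (R := R) n a b' -> slice b n.+1 z = slice b' n.+1 z.
Proof. by move=> sa sa' w; rewrite (sliceS sa) (sliceS sa') /vkey w. Qed.

Lemma slice_agree b b' n z : (forall m, (m < n)%N -> b m = b' m) ->
  slice b n z = slice b' n z.
Proof.
elim: n => [//|n IH] bb'.
have e : slice b n z = slice b' n z by apply: IH => m mn; apply: bb'; exact: ltnW.
apply: slice_step_eq (erefl _) (esym e) _; apply: word_eq => m mn; left.
exact: bb'.
Qed.

(** The slice moves in the same way on the two lines until it leaves a vertex where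
    they look different; before stage [n] this can only happen at points other
    than [u], that is after the slice has settled on one side of [u]. *)
Lemma slice_same_side b b' n (u : R) z : grid n u ->
  (forall m, (m < n)%N -> b m = b' m \/ h m u = 0) ->
  [\/ slice b n z = slice b' n z,
      u <= lower b n z /\ u <= lower b' n z |
      upper b n z <= u /\ upper b' n z <= u].
Proof.
move=> gu bb'; suff : forall j, (j <= n)%N ->
  [\/ slice b j z = slice b' j z,
      u <= lower b j z /\ u <= lower b' j z |
      upper b j z <= u /\ upper b' j z <= u] by apply.
elim=> [|j IH] jn; first exact: Or31.
case: (IH (ltnW jn)) => [e|[l l']|[l l']]; last 2 first.
- by apply: Or32; split; [apply: le_trans l _|apply: le_trans l' _]; exact: lower_mono.
- by apply: Or33; split; [apply: le_trans l|apply: le_trans l']; exact: upper_mono.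
set a := slice b j z in e; have sa : slice b j z = a by [].
have [au|au] := eqVneq (a%:~R * e2 j) u.
  apply: Or31; apply: (slice_step_eq sa (esym e)); apply: word_eq => m mj.
  by rewrite au; apply: bb'; exact: leq_ltn_trans jn.
have [gj|gj] := pselect (grid j u); last first.
  apply: Or31; apply: slice_agree => m mj; have [//|hm] := bb' m (leq_trans mj jn).
  by exfalso; apply: gj; exact: grid_le (h0_grid hm).
have ga : grid j (a%:~R * e2 j : R) by exists a.
have lm := lower_mono b z (leqnSn j); have lm' := lower_mono b' z (leqnSn j).
have um := upper_mono b z (leqnSn j); have um' := upper_mono b' z (leqnSn j).
move: lm lm' um um'; rewrite {1 3}/lower {2 4}/upper -e sa !intrD intrN !mulrDl => lm lm' um um'.
have := grid_sep ga gj au; case: (leP u (a%:~R * e2 j)) => ua.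
  by rewrite ger0_norm ?subr_ge0// => h; apply: Or32; split; lra.
by rewrite ltr0_norm ?subr_lt0// => h; apply: Or33; split; lra.
Qed.

(** Once [u] belongs to the grid of a stage, staying at [u] keeps the two crossings
    together; before that, the lines look the same. *)
Lemma coinP_joint b b' n k :
  (forall m, (m < n)%N -> b m = b' m \/ h m (k%:~R * e2 n : R) = 0) ->
  0 <= k <= (2 ^ n)%N%:Z ->
  ((e2 n.+1)%:E <= P [set z | slice b n z = k /\ slice b' n z = k])%E.
Proof.
elim: n k => [|n IH] k bb' kn.
  rewrite -((slice_law b 0 k).2 kn); apply: le_measure; rewrite ?inE.
  - exact: (@measurable_slice R b 0 k).
  - by have := measurableI _ _ (@measurable_slice R b 0 k) (@measurable_slice R b' 0 k).
  - by move=> z /= ->.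
have both_m n' k' : measurable [set z : Om | slice b n' z = k' /\ slice b' n' z = k'].
  by have := measurableI _ _ (@measurable_slice R b n' k') (@measurable_slice R b' n' k').
have [[k0 k0E]|gu] := pselect (grid n (k%:~R * e2 n.+1 : R)).
  have kk : k = 2 * k0.
    apply/eqP; rewrite -(@eqr_int R) intrM; apply/eqP.
    by apply: (mulIf (e2_neq0 n.+1)); rewrite k0E (e2S n); ring.
  set E := [set z : Om | slice b n z = k0 /\ slice b' n z = k0].
  have aE : adapted n E by apply: adaptedI; exact: adapted_slice.
  have PE : ((e2 n.+1)%:E <= P E)%E.
    apply: (IH k0) => [m mn|]; first by rewrite -k0E; apply: bb'; exact: ltnW.
    by move: kn; rewrite kk expnS PoszM; lia.
  apply: (@le_trans _ _ ((e2 1)%:E * P E)%E).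
    rewrite (_ : e2 n.+2 = e2 1 * e2 n.+1) -?e2D//.
    by rewrite EFinM lee_wpmul2l// lee_fin e2_ge0.
  rewrite -(@coinP_stay b n k0 E aE); last by move=> z [].
  rewrite le_measure ?inE//.
    by apply: measurableI; [case: aE|exact: measurable_slice].
  move=> z [[s1 s2] s3]; rewrite /mkset kk -(slice_step_eq s1 s2)//.
  by apply: word_eq => m mn; rewrite -k0E; apply: bb'.
rewrite -((slice_law b n.+1 k).2 kn) le_measure ?inE//; first exact: measurable_slice.
move=> z; rewrite /mkset => sk; split=> //; rewrite -sk; apply/esym; apply: slice_agree => m mn.
have [//|hm] := bb' m mn; exfalso; apply: gu; exact: grid_le (h0_grid hm).
Qed.

(** At different vertices the steps use different coins, four in total. *)
Lemma coinP_diverge b b' n a a' E : adapted n E ->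
  (forall z, E z -> slice b n z = a /\ slice b' n z = a') ->
  (a, word (R := R) n a b) != (a', word (R := R) n a' b') ->
  P (E `&` [set z | slice b n.+1 z = 2 * a - 1 /\ slice b' n.+1 z = 2 * a' + 1]) =
  ((e2 4)%:E * P E)%E.
Proof.
move=> aE Ea vv'; set V := steps n a b ++ steps n a' b'.
pose c (k : nat) := k \in map step_key (steps n a' b').
have uV : uniq V.
  have vne (i j : bool) : ((n, a, word (R := R) n a b, i) ==
      (n, a', word (R := R) n a' b', j) :> (nat * int * seq bool * bool)) = false.
    apply/negbTE; apply: contra vv' => /eqP vv; apply/eqP.
    exact: (congr1 (fun v => (v.1.1.2, v.1.2)) vv).
  rewrite [uniq V]/= !inE !vne !orbF andbT; apply/and3P; split=> //; by apply/eqP => -[].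
rewrite -(@coinP_adapted R V c n E)//; last first.
  by move=> v; rewrite !inE => /or4P[] /eqP ->.
have cV v : v \in steps n a b -> c (step_key v) = false.
  move=> vV; rewrite /c mem_map; last exact: step_key_inj.
  by move: uV; rewrite cat_uniq => /and3P[_ /hasPn h _]; apply: contraTF vV => /h.
have cV' v : v \in steps n a' b' -> c (step_key v) = true.
  by move=> vV; rewrite /c map_f.
congr P; apply/seteqP; split=> z [Ez]; have [sa sa'] := Ea z Ez.
  rewrite /mkset (sliceS sa) (sliceS sa') /vkey => -[h1 h2]; split=> // v.
  rewrite mem_cat => /orP[/[dup] vV|/[dup] vV]; [rewrite (cV v vV)|rewrite (cV' v vV)];
    rewrite !inE => /orP[] /eqP ->.
  - by move: h1; case: (coin _ z) (coin _ z) => [] []; lia.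
  - by move: h1; case: (coin _ z) (coin _ z) => [] []; lia.
  - by move: h2; case: (coin _ z) (coin _ z) => [] []; lia.
  - by move: h2; case: (coin _ z) (coin _ z) => [] []; lia.
rewrite /mkset => hc; split=> //; rewrite /mkset (sliceS sa) (sliceS sa') /vkey.
have ha (i : bool) : coin (step_key (n, a, word (R := R) n a b, i)) z = false.
  by rewrite hc ?cV// ?mem_cat !inE; case: i; rewrite eqxx ?orbT.
have ha' (i : bool) : coin (step_key (n, a', word (R := R) n a' b', i)) z = true.
  by rewrite hc ?cV'// ?mem_cat !inE; case: i; rewrite eqxx ?orbT.
rewrite (ha true) (ha false) (ha' true) (ha' false) /=; clear.
by split; lia.
Qed.

End slice_law.

(** * Embedding in L1 *)

Section L1_functions.
Context {R : realType} {d} {T : measurableType d} (mu : {measure set T -> \bar R}).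

(** The representative of a class agrees with the function only almost
    everywhere. *)
Lemma Lspace1_of_integrable (f : T -> R) : mu.-integrable setT (EFin \o f) ->
  exists F : LspaceType1 mu, (F : T -> R) = f %[ae mu].
Proof.
move=> intf.
have mf : measurable_fun setT (f : T -> measurableTypeR R).
  exact/measurable_EFinP/(measurable_int _ intf).
pose f1 : {mfun T >-> measurableTypeR R} :=
  HB.pack (f : T -> measurableTypeR R) (isMeasurableFun.Build _ _ _ _ _ mf).
pose F1 : {mfun_ mu, T >-> measurableTypeR R} := (\pi f1)%qT.
have F1f : (F1 : T -> R) = f %[ae mu].
  suff : ae_eq_op mu (repr F1) f1 by move=> /asboolP.
  by apply/eqmodP; exact: reprK.
have mF : measurable_fun setT (F1 : T -> R) by exact: (@measurable_funPT _ _ _ _ (repr F1)).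
have nF : finite_norm mu 1 F1.
  rewrite /finite_norm Lnorm1 (ae_eq_integral (fun x => `|(f x)%:E|)%E)//.
  - by move: intf => /integrableP[].
  - by apply: measurableT_comp => //; exact/measurable_EFinP.
  - by apply: measurableT_comp => //; exact/measurable_EFinP.
  - by apply: filterS F1f => x /(_ I) e _ /=; rewrite e.
pose F : LspaceType1 mu := HB.pack F1 (isFinLebesgue.Build d T R mu 1%E (lexx 1%E) F1 nF).
by exists F.
Qed.

Lemma bilipschitz_L1_of_integrable (X : metricType R) (F : X -> T -> R) (L : R) :
  (forall x, mu.-integrable setT (EFin \o F x)) -> 1 <= L ->
  (forall x y, L^-1 * mdist x y <= fine (\int[mu]_z `|(F x z - F y z)%:E|)%E <= L * mdist x y) ->
  bilipschitz_embeds_in_L1 X.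
Proof.
move=> intF L1 FL.
pose G x := projT1 (cid (Lspace1_of_integrable (intF x))).
have GF x : (G x : T -> R) = F x %[ae mu] by rewrite /G; case: cid.
exists d, T, mu, G, L => // x y; rewrite (_ : L1_dist _ _ = fine (\int[mu]_z `|(F x z - F y z)%:E|)%E)//.
have mG u : measurable_fun setT (G u : T -> R).
  have m (g : {mfun_ mu, T >-> measurableTypeR R}) : measurable_fun setT (g : T -> R).
    exact: (@measurable_funPT _ _ _ _ (repr g)).
  exact: m.
have mF u : measurable_fun setT (F u) by exact/measurable_EFinP/(measurable_int _ (intF u)).
rewrite /L1_dist Lnorm1; congr fine; apply: ae_eq_integral => //.
- by apply: measurableT_comp => //; apply/measurable_EFinP; exact: measurable_funB.
- by apply: measurableT_comp => //; apply/measurable_EFinP; exact: measurable_funB.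
- apply: filterS2 (GF x) (GF y) => z /(_ I) ex /(_ I) ey _ /=.
  by rewrite ex ey.
Qed.

End L1_functions.

Section slice_map.
Context {R : realType}.
Local Notation Om := (measurableTypeR R).
Local Notation P := (@coinP R).
Implicit Types (x y : laakso R) (z : Om) (n m i j : nat) (a : int) (b c : nat -> bool) (s t : R).

Definition heads : set Om := [set z | coin tag_key z = true].

(** On half of the space the map records the height, which takes care of points at
    very different heights; on the other half it records whether the slice runs
    below the point. *)
Definition slice_map x z : R :=
  pos x * \1_heads z + \1_(below (side x) (pos x) `\` heads) z.

Definition apart b t c s : set Om :=
  (below b t `\` below c s) `|` (below c s `\` below b t).

Lemma measurable_apart b t c s : measurable (apart b t c s).
Proof. by apply: measurableU; apply: measurableD; exact: measurable_below. Qed.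

Lemma slice_flip_tag b n z : slice b n (flip tag_key z) = slice b n z.
Proof.
elim: n => [|n IH] /=.
  by rewrite coin_flip_neq// /start_key /tag_key (inj_eq (pcan_inj pickleK)).
have ne (i : bool) : vkey (R := R) n (slice b n z) b i != tag_key.
  by rewrite /vkey /step_key /tag_key (inj_eq (pcan_inj pickleK)).
by rewrite IH !coin_flip_neq// ne.
Qed.

Lemma apart_flip b t c s z : apart b t c s (flip tag_key z) -> apart b t c s z.
Proof.
have fl b' t' : below b' t' (flip tag_key z) = below b' t' z.
  have up n : upper b' n (flip tag_key z) = upper b' n z by rewrite /upper slice_flip_tag.
  by apply/propext; split=> -[n h]; exists n; rewrite ?up// -up.
by rewrite /apart /setU /setD /mkset !fl.
Qed.

Lemma integrable_slice_map x : P.-integrable setT (EFin \o slice_map x).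
Proof.
have mh : measurable heads by exact: measurable_coin.
have mb : measurable (below (side x) (pos x) `\` heads).
  by apply: measurableD => //; exact: measurable_below.
rewrite (_ : EFin \o _ = (fun z => (pos x)%:E * (\1_heads z)%:E)%E \+
    (fun z => (\1_(below (side x) (pos x) `\` heads) z)%:E)); last first.
  by apply/funext => z; rewrite /= /slice_map EFinD EFinM.
apply: integrableD => //; last exact: integrable_indic.
by apply: integrableZl => //; exact: integrable_indic.
Qed.

(** The slice does not depend on the coin [tag_key]. *)
Lemma slice_map_dist x y :
  (\int[P]_z `|(slice_map x z - slice_map y z)%:E| =
   (2^-1)%:E * (`|pos x - pos y|%:E + P (apart (side x) (pos x) (side y) (pos y))))%E.
Proof.
set A := apart _ _ _ _; have mA : measurable A by exact: measurable_apart.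
have mh : measurable heads by exact: measurable_coin.
have mAh : measurable (A `\` heads) by exact: measurableD.
have fA z : A (flip tag_key z) -> A z by exact: apart_flip.
transitivity (\int[P]_z (`|pos x - pos y|%:E * (\1_heads z)%:E +
    (\1_(A `\` heads) z)%:E))%E.
  apply: eq_integral => z _; rewrite /slice_map -EFinM -EFinD abse_EFin; congr EFin.
  rewrite !indicE; have [zh|zh] := boolP (z \in heads).
    have nh B : (z \in B `\` heads) = false.
      by apply/negbTE/negP; rewrite inE => -[_]; apply; exact: set_mem.
    by rewrite !nh !addr0 !mulr1.
  have nh (B : set Om) : (z \in B `\` heads) = (z \in B).
    apply/idP/idP => [/set_mem[zB _]|/set_mem zB]; apply/mem_set => //.
    by split=> // /mem_set; exact/negP.
  rewrite !nh !mulr0 !add0r; have -> : (z \in A) =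
      ((z \in below (side x) (pos x)) != (z \in below (side y) (pos y))).
    rewrite /A /apart; move: (below _ _) (below _ _) => B C.
    apply/idP/idP => [/set_mem[] [z1 z2]|zBC].
    - by rewrite (@mem_set _ C z z1) (@memNset _ B z z2).
    - by rewrite (@mem_set _ B z z1) (@memNset _ C z z2).
    apply/mem_set; move: zBC.
    have [zB|zB] := boolP (z \in B); have [zC|zC] := boolP (z \in C) => // _.
      by right; split; [exact: set_mem|move=> /mem_set; exact/negP].
    by left; split; [exact: set_mem|move=> /mem_set; exact/negP].
  case: (_ \in _) (_ \in _) => [] [] /=; rewrite ?subrr ?subr0 ?sub0r ?normrN ?normr0 ?normr1//.
rewrite ge0_integralD//; first last.
- exact/measurable_EFinP/measurable_indic.
- by apply: measurable_funeM; exact/measurable_EFinP/measurable_indic.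
rewrite ge0_integralZl_EFin//; last exact/measurable_EFinP/measurable_indic.
rewrite !integral_indic// !setIT.
have Ph : P heads = (2^-1)%:E.
  rewrite -[X in P X]setTI coinP_half//.
  by rewrite [X in (_ * X)%E](_ : _ = 1%E) ?mule1//; exact: coinPT.
have PA : P (A `\` heads) = ((2^-1)%:E * P A)%E.
  rewrite -(@coinP_half R tag_key false A)//; congr P.
  by apply/seteqP; split=> z [Az]; rewrite /heads /mkset => /= h; split=> //;
    move: h; rewrite /mkset; case: (coin _ z).
by rewrite [X in (_ * X + _)%E]Ph [X in (_ + X)%E]PA muleDr// [in LHS]muleC.
Qed.

Lemma measurable_slice_in b n (D : set int) :
  measurable [set z : Om | D (slice b n z)].
Proof.
rewrite (_ : [set _ | _] = \bigcup_(a in D) [set z | slice b n z = a]).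
  rewrite bigcup_mkcond; apply: countable_bigcupT_measurable => [|a].
    exact: countableP.
  by case: ifP => _; [exact: measurable_slice|exact: measurable0].
apply/seteqP; split=> z; first by move=> h; exists (slice b n z).
by move=> [a /= Da ->].
Qed.

Lemma slice_interval b n (lo : int) (N : nat) :
  (P [set z | (lo <= slice b n z < lo + N%:Z)%R] <= (N%:R * e2 n.+1)%R%:E)%E.
Proof.
elim: N => [|N IH].
  rewrite mul0r (_ : [set _ | _] = set0) ?measure0//.
  by apply/seteqP; split=> z //=; lia.
have ms a : measurable [set z : Om | slice b n z = a] by exact: measurable_slice.
have mi M : measurable [set z : Om | lo <= slice b n z < lo + M%:Z].
  exact: (@measurable_slice_in b n [set a : int | lo <= a < lo + M%:Z]).
apply: (@le_trans _ _ (P ([set z | (lo <= slice b n z < lo + N%:Z)%R] `|`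
    [set z | slice b n z = lo + N%:Z]))).
  rewrite le_measure ?inE//; first exact: measurableU.
  move=> z; rewrite /setU /mkset => h.
  by have [->|ne] := eqVneq (slice b n z) (lo + N%:Z); [right|left]; lia.
apply: (le_trans (measureU2 _ (mi N) (ms _))).
rewrite -natr1 mulrDl mul1r EFinD leeD//.
by have [] := @slice_law R b n (lo + N%:Z).
Qed.

Lemma slice_window b n t :
  (P [set z | (`|(slice b n z)%:~R * e2 n - t| <= 3 * e2 n)%R] <= (4 * e2 n)%:E)%E.
Proof.
set k := Num.floor (t / e2 n); have e0 : 0 < e2 n :> R by exact: e2_gt0.
have /andP[k1 k2] : k%:~R <= t / e2 n < (k + 1)%:~R.
  by rewrite /k floor_le_tmp/= floorD1_gt.
have -> : 4 * e2 n = 8%:R * e2 n.+1 :> R by rewrite (e2S n); ring.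
apply: le_trans (slice_interval b n (k - 3) 8).
rewrite le_measure ?inE//.
- exact: (@measurable_slice_in b n [set a : int | `|a%:~R * e2 n - t| <= 3 * e2 n]).
- exact: (@measurable_slice_in b n [set a : int | k - 3 <= a < k - 3 + 8%:Z]).
move=> z; rewrite /mkset; set a := slice b n z.
rewrite ler_norml => /andP[h1 h2].
have tE : t = (t / e2 n) * e2 n by rewrite divfK// gt_eqF.
have h3 : t / e2 n - 3 <= a%:~R.
  by rewrite -(ler_pM2r e0) mulrBl -tE; lra.
have h4 : a%:~R <= t / e2 n + 3.
  by rewrite -(ler_pM2r e0) mulrDl -tE; lra.
have : (k - 3 <= a)%R by rewrite -(ler_int R) intrB; lra.
have : (a < k + 4)%R by rewrite -(ltr_int R) intrD; move: k2; rewrite intrD; lra.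
clear; lia.
Qed.

End slice_map.

Section slice_bounds.
Context {R : realType}.
Local Notation Om := (measurableTypeR R).
Local Notation P := (@coinP R).
Implicit Types (x y : laakso R) (z : Om) (n m i j : nat) (a k : int) (b c : nat -> bool)
  (s t : R) (E : set Om).

(** A slice that separates two nearby points has to be near one of them, since
    otherwise it runs on the same side of [u] on both lines. *)
Lemma apart_window x y n u z : grid n u -> `|pos x - u| <= e2 n.+1 ->
  mdist x y <= e2 n.+2 -> apart (side x) (pos x) (side y) (pos y) z ->
  `|(slice (side x) n z)%:~R * e2 n - pos x| <= 3 * e2 n \/
  `|(slice (side y) n z)%:~R * e2 n - pos y| <= 3 * e2 n.
Proof.
move=> gu xu xy az; have e0 : 0 < e2 n :> R by exact: e2_gt0.
have e1 : e2 n = 2 * e2 n.+1 :> R by exact: e2S.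
have e22 : e2 n.+1 = 2 * e2 n.+2 :> R by exact: e2S.
have xy' : mdist x y < e2 n.+1.
  by apply: le_lt_trans xy _; have := @e2_gt0 R n.+2; lra.
have same j : (j < n)%N -> side x j = side y j \/ h j u = 0.
  by move=> jn; exact: (ball_side gu xu xy' (ltnW jn)).
have lo b t : below b t z -> lower b n z < t.
  by move=> bt; rewrite ltNge; apply/negP => /not_below/(_ bt).
have up b t : ~ below b t z -> t <= upper b n z.
  by move=> bt; rewrite leNgt; apply/negP => h; apply: bt; exists n.
have := mdist_pos x y; rewrite ler_norml => /andP[xy1 xy2].
move: xu; rewrite ler_norml => /andP[xu1 xu2].
have win (v p : R) : - (3 * e2 n) <= v - p -> v - p <= 3 * e2 n -> `|v - p| <= 3 * e2 n.
  by move=> h1 h2; rewrite ler_norml h1 h2.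
have same_side := slice_same_side z gu same.
have {az} : (lower (side x) n z < pos x /\ pos y <= upper (side y) n z) \/
    (lower (side y) n z < pos y /\ pos x <= upper (side x) n z).
  by case: az => [] [/lo ? /up ?]; [left|right].
have {same_side} : [\/ (slice (side x) n z)%:~R = (slice (side y) n z)%:~R :> R,
    u <= lower (side x) n z /\ u <= lower (side y) n z |
    upper (side x) n z <= u /\ upper (side y) n z <= u].
  by case: same_side => [->|?|?]; [exact: Or31|exact: Or32|exact: Or33].
have lowerE w : lower (side w) n z = (slice (side w) n z)%:~R * e2 n - e2 n.
  by rewrite /lower intrD intrN mulrDl mulN1r.
have upperE w : upper (side w) n z = (slice (side w) n z)%:~R * e2 n + e2 n.
  by rewrite /upper intrD mulrDl mul1r.
rewrite !lowerE !upperE; clear lo up same gu xy' lowerE upperE.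
move: (pos x) (pos y) ((slice (side x) n z)%:~R : R) ((slice (side y) n z)%:~R : R)
  xy1 xy2 xu1 xu2 => t s A B xy1 xy2 xu1 xu2.
case=> [->|[l1 l2]|[l1 l2]] [[l3 l4]|[l3 l4]].
- by left; apply: win; lra.
- by left; apply: win; lra.
- by left; apply: win; lra.
- by right; apply: win; lra.
- by right; apply: win; lra.
- by left; apply: win; lra.
Qed.

(** The upper bound: by [slice_law] the slice is near a given point with
    probability comparable to the scale. *)
Lemma coinP_apart_le x y :
  (P (apart (side x) (pos x) (side y) (pos y)) <= (64 * mdist x y)%:E)%E.
Proof.
set A := apart _ _ _ _; have mA : measurable A by exact: measurable_apart.
have d0 : 0 <= mdist x y by exact: le_trans (mdist_pos x y).
have [/mdist_positivity xy|dp] := eqVneq (mdist x y) 0.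
  rewrite /A xy /apart !setDv setU0 measure0.
  by rewrite lee_fin mulr_ge0 ?ler0n//; exact: le_trans (mdist_pos y y).
have {}d0 : 0 < mdist x y by rewrite lt_def dp.
have [dq|dq] := leP (mdist x y) 4^-1; last first.
  apply: (@le_trans _ _ 1%E); first exact: probability_le1.
  by rewrite lee_fin; lra.
(* The scale [e2 n] is between 4 and 8 times the distance. *)
have [n /andP[n1 n2]] := e2_window d0 dq.
have q3 : 4^-1 * e2 n = e2 n.+2 :> R by rewrite /e2 !exprS; field.
have [u [gu xu _]] := grid_near n (pos01 x).
pose B (w : laakso R) := [set z : Om | `|(slice (side w) n z)%:~R * e2 n - pos w| <= 3 * e2 n].
have mB w : measurable (B w).
  exact: (@measurable_slice_in R (side w) n [set a | `|a%:~R * e2 n - pos w| <= 3 * e2 n]).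
apply: (@le_trans _ _ (P (B x `|` B y))).
  rewrite le_measure ?inE//; first exact: measurableU.
  by move=> z; apply: apart_window gu xu _; rewrite -q3.
apply: (le_trans (measureU2 _ (mB x) (mB y))).
apply: (@le_trans _ _ ((4 * e2 n)%:E + (4 * e2 n)%:E)%E).
  by apply: leeD; exact: slice_window.
rewrite -EFinD lee_fin; have e1 : e2 n = 2 * e2 n.+1 :> R by exact: e2S.
by move: n1; lra.
Qed.

(** After three steps -1 on one line and +1 on the other, the crossings are at
    distance [7 / 8 * e2 n] from the common height, and all later steps together
    move them by less than [1 / 8 * e2 n]. *)
Lemma coinP_apart_vertices b b' n a E s t : adapted n E ->
  (forall z, E z -> slice b n z = a /\ slice b' n z = a) ->
  word (R := R) n a b != word (R := R) n a b' ->
  (a%:~R - 3 / 4) * e2 n < t -> s <= (a%:~R + 3 / 4) * e2 n ->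
  ((e2 12)%:E * P E <= P (apart b t b' s))%E.
Proof.
move=> aE Ea ww tn sn.
have step j (c c' : int) F : adapted j F ->
    (forall z, F z -> slice b j z = c /\ slice b' j z = c') ->
    (c, word (R := R) j c b) != (c', word (R := R) j c' b') ->
  exists G, [/\ adapted j.+1 G, forall z, G z -> slice b j.+1 z = 2 * c - 1 /\ slice b' j.+1 z = 2 * c' + 1
    & P G = ((e2 4)%:E * P F)%E].
  move=> aF Fc cc'; exists (F `&` [set z | slice b j.+1 z = 2 * c - 1 /\ slice b' j.+1 z = 2 * c' + 1]).
  split; [|by move=> z []|exact: coinP_diverge].
  apply: adaptedI; first exact: adaptedS.
  have := adaptedI (@adapted_slice R b j.+1 (2 * c - 1)) (@adapted_slice R b' j.+1 (2 * c' + 1)).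
  exact.
have ne j (c c' : int) : c != c' -> (c, word (R := R) j c b) != (c', word (R := R) j c' b').
  by apply: contra => /eqP[-> _].
have [|E1 [aE1 E1a PE1]] := step n a a E aE Ea.
  by apply: contra ww => /eqP e; apply/eqP; exact: (congr1 snd e).
have [|E2 [aE2 E2a PE2]] := step n.+1 _ _ E1 aE1 E1a; first by apply: ne; lia.
have [|E3 [aE3 E3a PE3]] := step n.+2 _ _ E2 aE2 E2a; first by apply: ne; lia.
have -> : ((e2 12)%:E * P E = P E3)%E.
  by rewrite PE3 PE2 PE1 !muleA -!EFinM -!e2D.
apply: le_measure; rewrite ?inE; [by case: aE3|exact: measurable_apart|].
move=> z /E3a; set c := slice b n.+3 z; set c' := slice b' n.+3 z => -[cE c'E].
have e3 : e2 n = 8 * e2 n.+3 :> R by rewrite (e2S n) (e2S n.+1) (e2S n.+2); ring.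
have e0 : 0 < e2 n.+3 :> R by exact: e2_gt0.
left; split.
  exists n.+3; rewrite /upper -/c cE; apply: le_lt_trans tn.
  rewrite e3 (_ : 2 * _ - 1 + 1 = 8 * a - 6); last by lia.
  by rewrite intrD intrM intrN le_eqVlt; apply/orP; left; apply/eqP; field.
apply: (@not_below R b' s n.+3); rewrite /lower -/c' c'E; apply: (le_trans sn).
rewrite e3 (_ : 2 * _ + 1 - 1 = 8 * a + 6); last by lia.
by rewrite intrD intrM le_eqVlt; apply/orP; left; apply/eqP; field.
Qed.

End slice_bounds.

Section slices_apart.
Context {R : realType}.
Local Notation Om := (measurableTypeR R).
Local Notation P := (@coinP R).
Implicit Types (x y : laakso R) (z : Om) (n m i j : nat) (a k : int) (b c : nat -> bool)
  (s t : R) (E : set Om).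

Let both b b' n a : set Om := [set z | slice b n z = a /\ slice b' n z = a].

Let adapted_both b b' n a : adapted n (both b b' n a).
Proof.
by have := adaptedI (@adapted_slice R b n a) (@adapted_slice R b' n a).
Qed.

(** Integers within less than one unit of [0, 1] are indices of points of [0, 1]. *)
Lemma unit_index n (k : int) (t e : R) : 0 <= t <= 1 -> 0 <= e < e2 n ->
  `|t - k%:~R * e2 n| <= e -> 0 <= k <= (2 ^ n)%N%:Z.
Proof.
move=> /andP[t0 t1] /andP[e0 en]; rewrite ler_norml => /andP[h1 h2].
have en0 : 0 < e2 n :> R by exact: e2_gt0.
have k1 : (-1)%:~R < k%:~R :> R.
  by rewrite -(ltr_pM2r en0) intrN mulN1r; lra.
have e1 : ((2 ^ n)%N%:Z)%:~R * e2 n = 1 :> R.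
  by rewrite -pmulrn natrX -exprMn divff// expr1n.
have k2 : k%:~R < ((2 ^ n)%N%:Z + 1)%:~R :> R.
  by rewrite -(ltr_pM2r en0) intrD mulrDl e1 mul1r; lra.
by move: k1 k2; rewrite !ltr_int; lia.
Qed.

Section wormholes.
Variables (b b' : nat -> bool) (m : nat) (s t : R).
Hypotheses (t01 : 0 <= t <= 1) (t0 : 0 < h m t) (ts : `|t - s| <= h m t / 31).
Hypotheses (bm : b m != b' m)
  (bj : forall j, b j != b' j -> h j t + h j s <= 64 / 31 * h m t).

Let ts_ge : - (h m t / 31) <= t - s.
Proof. by move: ts; rewrite ler_norml => /andP[]. Qed.
Let ts_le : t - s <= h m t / 31.
Proof. by move: ts; rewrite ler_norml => /andP[]. Qed.

Let h_both j (v : R) : b j != b' j -> 2 * h j v <= 2 * `|t - v| + 65 / 31 * h m t.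
Proof.
move=> /bj; have := h_lip j v t; have := h_lip j t s; rewrite (distrC v t).
rewrite !ler_norml => /andP[h1 h2] /andP[h3 h4]; move: ts h2 h4; lra.
Qed.

Lemma wormhole_split (w : R) : h m w = 0 -> h m t = `|t - w| ->
  exists c : bool, t = w + (-1) ^+ c * h m t.
Proof.
move=> w0 ->; exists (t < w); case: ltP => tw.
  by rewrite ltr0_norm ?subr_lt0// expr1; ring.
by rewrite ger0_norm ?subr_ge0// expr0; ring.
Qed.

(** At the centre of the component of level [m] that contains [t] the lines are at
    different vertices, because the branches of level [m] differ there. They are
    not distinguished by coarser levels, whose wormholes are too far away. *)
Lemma coinP_apart_center : 3 / 8 * e2 m < h m t ->
  ((e2 14 * h m t)%:E <= P (apart b t b' s))%E.
Proof.
move=> tm; have em0 : 0 < e2 m :> R by exact: e2_gt0.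
have tb := h_bound m t.
have [w [w0 _ tw]] := h_near m t.
have [c tE] := wormhole_split w0 tw; have [k wE] := h0_odd w0.
pose k' : int := 2 * k + 1 + (-1) ^+ c.
have k'E : k'%:~R * e2 m = w + (-1) ^+ c * e2 m.
  by rewrite /k' wE intrD mulrDl rmorphXn/= rmorphN1.
have tk : `|t - k'%:~R * e2 m| <= e2 m - h m t.
  rewrite k'E {1}tE opprD addrACA subrr add0r -mulrBr normrM normr_sign mul1r.
  by rewrite ler0_norm; lra.
have [q k'q] : exists q, k' = 2 * q.
  by rewrite /k'; case: (c); [exists k|exists (k + 1)]; rewrite ?expr1 ?expr0; ring.
have k'0 : 0 <= k' <= (2 ^ m)%N%:Z.
  by apply: unit_index t01 _ tk; apply/andP; split; lra.
have hk : h m (k'%:~R * e2 m : R) != 0.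
  apply/eqP => /h0_odd[q' /(mulIf (e2_neq0 m))/eqP]; rewrite eqr_int k'q => /eqP; clear; lia.
have joint : ((e2 m.+1)%:E <= P (both b b' m k'))%E.
  apply: coinP_joint => // j jm; have [|bbj] := eqVneq (b j) (b' j); first by left.
  right; apply/eqP; apply: contraT => hj.
  have [m' mE] : exists m', m = m'.+1 by case: (m) jm => // m' _; exists m'.
  have e2m : e2 m' = 2 * e2 m :> R by rewrite mE e2S.
  have gm' : grid m' (k'%:~R * e2 m : R).
    by exists q; rewrite e2m k'q intrM; ring.
  have jm' : (j <= m')%N by move: jm; rewrite mE.
  have := grid_h jm' gm' hj; have := h_both (k'%:~R * e2 m) bbj; move: tk.
  rewrite e2m => h1 h2 h3; suff : false by []; move: h1 h2 h3 tb t0; lra.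
apply: le_trans (@coinP_apart_vertices R b b' m k' _ s t (adapted_both _ _ _ _) (fun _ => id) _ _ _).
- apply: (@le_trans _ _ ((e2 12)%:E * (e2 m.+1)%:E)%E).
    rewrite -EFinM lee_fin (_ : e2 14 = e2 12 * e2 2); last by rewrite -e2D.
    rewrite -mulrA ler_pM2l ?e2_gt0// /e2 !exprS expr0 -/(e2 m).
    by move: tb; lra.
  by rewrite lee_wpmul2l// lee_fin e2_ge0.
- exact: word_neq (leqnn m) bm hk.
- by move: tk; rewrite ler_norml mulrBl => /andP[h1 h2]; lra.
- by move: tk ts_ge ts_le; rewrite ler_norml mulrDl => /andP[h1 h2]; lra.
Qed.

(** The slice first visits the wormhole [w] on both lines, makes a common step
    towards [t], and is then at different vertices of the right scale. *)
Lemma coinP_apart_hole : h m t <= 3 / 8 * e2 m ->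
  ((e2 14 * h m t)%:E <= P (apart b t b' s))%E.
Proof.
move=> tm; have em0 : 0 < e2 m :> R by exact: e2_gt0.
have [w [w0 gw tw]] := h_near m t.
have [c tE] := wormhole_split w0 tw.
have e2m : e2 m = 2 * e2 m.+1 :> R by exact: e2S.
have tm' : h m t <= 3 / 4 * e2 m.+1 by lra.
(* The scale is chosen such that [t] lies between 3/8 and 3/4 of a step away from
   [w]. *)
have [i /andP[i1 i2]] := e2_window t0 tm'.
set n := (m + i)%N.
have nE : e2 m.+1 * e2 i = e2 n.+1 :> R by rewrite -e2D addSn.
have nE' : e2 n.+1 = 2 * e2 n.+2 :> R by exact: e2S.
have nE'' : e2 n = 2 * e2 n.+1 :> R by exact: e2S.
have {}i1 : 3 / 8 * e2 n.+1 < h m t.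
  by move: i1; rewrite -(mulrA (3 / 4)) -e2D addSn addnS -/n nE'; lra.
have {}i2 : h m t <= 3 / 4 * e2 n.+1 by rewrite -nE mulrA.
have en0 : 0 < e2 n.+1 :> R by exact: e2_gt0.
have mn : (m <= n)%N by exact: leq_addr.
have gwn : grid n w by exact: grid_le mn gw.
have [k wE] := gwn; have tk : `|t - k%:~R * e2 n| <= h m t by rewrite -wE tw.
have k0 : 0 <= k <= (2 ^ n)%N%:Z.
  by apply: unit_index t01 _ tk; apply/andP; split; lra.
have same j : (j <= n)%N -> b j = b' j \/ h j (k%:~R * e2 n : R) = 0.
  move=> jn; have [|bbj] := eqVneq (b j) (b' j); first by left.
  right; rewrite -wE; apply/eqP; apply: contraT => hj.
  have := grid_h jn gwn hj; have := h_both w bbj; rewrite -tw nE''.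
  by move=> h1 h2; suff : false by []; move: h1 h2 i2 en0; lra.
have joint : ((e2 n.+1)%:E <= P (both b b' n k))%E.
  by apply: coinP_joint => // j jn; apply: same; exact: ltnW.
pose k' : int := 2 * k + (-1) ^+ c.
have k'E : k'%:~R * e2 n.+1 = w + (-1) ^+ c * e2 n.+1.
  by rewrite /k' wE intrD mulrDl rmorphXn/= rmorphN1 intrM nE''; congr (_ + _); ring.
have jointS : ((e2 2 * e2 n.+1)%:E <= P (both b b' n k `&` both b b' n.+1 k'))%E.
  apply: (@le_trans _ _ ((e2 2)%:E * P (both b b' n k))%E).
    by rewrite EFinM lee_wpmul2l// lee_fin e2_ge0.
  have -> : both b b' n k `&` both b b' n.+1 k' = both b b' n k `&` [set z | slice b n.+1 z = k'].
    apply/seteqP; split=> z [] [s1 s2]; rewrite /both /mkset; first by case.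
    move=> s3; split=> //; split=> //; rewrite -s3; apply/esym.
    by apply: (slice_step_eq s1 s2); exact: word_eq.
  rewrite /k'; case: (c); rewrite ?expr1 ?expr0.
    by rewrite (@coinP_down R b n k)// => z [].
  by rewrite (@coinP_up R b n k)// => z [].
have hk : h m (k'%:~R * e2 n.+1 : R) != 0.
  apply/eqP => h0; have := grid_eq (h0_grid h0) gw.
  rewrite k'E addrAC subrr add0r normrM normr_sign mul1r gtr0_norm//.
  have /[swap]/[apply] : e2 n.+1 < e2 m :> R.
    by apply: lt_le_trans (e2_le mn); rewrite nE''; lra.
  move=> /eqP; rewrite -subr_eq0 addrAC subrr add0r mulf_eq0 signr_eq0/=.
  by rewrite gt_eqF.
have aE : adapted n.+1 (both b b' n k `&` both b b' n.+1 k').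
  by apply: adaptedI; [apply: adaptedS|]; exact: adapted_both.
have mn' : (m <= n.+1)%N by exact: leqW.
apply: le_trans (@coinP_apart_vertices R b b' n.+1 k' _ s t aE _ _ _ _).
- apply: (@le_trans _ _ ((e2 12)%:E * (e2 2 * e2 n.+1)%:E)%E).
    rewrite -EFinM lee_fin (_ : e2 14 = e2 12 * e2 2); last by rewrite -e2D.
    by rewrite -!mulrA !ler_pM2l ?e2_gt0//; lra.
  by rewrite lee_wpmul2l// lee_fin e2_ge0.
- by move=> z [].
- exact: word_neq mn' bm hk.
- by rewrite mulrBl k'E; move: tE i1 i2; case: (c); rewrite ?expr1 ?expr0; lra.
- rewrite mulrDl k'E; move: ts_ge ts_le tE i1 i2.
  by case: (c); rewrite ?expr1 ?expr0; lra.
Qed.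

(** Three diverging steps cost the factor [e2 12]; the remaining factor [e2 2] covers
    the common step and the comparison of scales. *)
Lemma coinP_apart_ge : ((e2 14 * h m t)%:E <= P (apart b t b' s))%E.
Proof.
have [tm|tm] := leP (h m t) (3 / 8 * e2 m); first exact: coinP_apart_hole.
exact: coinP_apart_center.
Qed.

End wormholes.

(** If the heights do not account for the distance, some level does, and there the
    points lie on different branches. *)
Lemma mdist_le_apart x y : ((e2 16 * mdist x y)%:E <=
  `|pos x - pos y|%:E + P (apart (side x) (pos x) (side y) (pos y)))%E.
Proof.
set t := pos x; set s := pos y; set d := mdist x y.
set A := apart _ _ _ _; have mA : measurable A by exact: measurable_apart.
have d0 : 0 <= d by exact: le_trans (mdist_pos x y).
have e16 : e2 16 <= 64^-1 :> R.
  have -> : 64^-1 = e2 6 :> R by rewrite /e2 !exprS expr0; field.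
  exact: e2_le.
have [ts|ts] := leP (64^-1 * d) `|t - s|.
  apply: (@le_trans _ _ `|t - s|%:E); last by rewrite leeDl.
  by rewrite lee_fin; apply: le_trans ts; exact: ler_wpM2r.
have {}d0 : 0 < d by rewrite -(pmulr_rgt0 d (_ : 0 < 64^-1))//; apply: le_lt_trans ts.
(* The heights differ by less than [d / 64], so the supremum is attained, up to
   the factor 63 / 64, by some level. *)
have [m dm] : exists m, 63 / 64 * d < `|co x m - co y m|.
  apply: contrapT => /forallNP nm.
  suff : d <= 63 / 64 * d by move: d0; lra.
  apply/mdist_leP; split; first by apply: ltW; move: ts d0; rewrite -/t -/s; lra.
  by move=> m; rewrite leNgt; apply/negP/nm.
have bm : side x m != side y m.
  by apply/eqP => /co_same; rewrite -/t -/s; move: dm ts d0; lra.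
move: (dm); rewrite (co_opp bm) -/t -/s => {}dm.
have := h_lip m t s; rewrite ler_norml => /andP[hl1 hl2].
have hm : 31 / 64 * d <= h m t by move: dm ts hl1 hl2; lra.
apply: (@le_trans _ _ (P A)); last by rewrite leeDr// lee_fin.
apply: (@le_trans _ _ ((e2 14 * h m t)%:E)).
  rewrite lee_fin (_ : e2 16 = e2 14 * e2 2); last by rewrite -e2D.
  rewrite -mulrA ler_pM2l ?e2_gt0// /e2 !exprS expr0; move: hm d0; lra.
apply: coinP_apart_ge => //.
- exact: pos01.
- by move: hm d0; lra.
- by apply: ltW; move: hm d0 ts; rewrite -/t -/s; lra.
- move=> j /co_opp; rewrite -/t -/s => dj.
  by have := mdist_co x y j; rewrite dj -/d; move: hm; lra.
Qed.

Theorem laakso_embeds_L1 : bilipschitz_embeds_in_L1 (laakso R).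
Proof.
have e17 : e2 17 <= 64^-1 :> R.
  have -> : 64^-1 = e2 6 :> R by rewrite /e2 !exprS expr0; field.
  exact: e2_le.
have e170 : 0 < e2 17 :> R by exact: e2_gt0.
apply: (@bilipschitz_L1_of_integrable R _ Om P (laakso R) slice_map (e2 17)^-1).
- exact: integrable_slice_map.
- by rewrite invf_ge1// e2_le1.
move=> x y; rewrite slice_map_dist invrK.
have := mdist_le_apart x y; have := coinP_apart_le x y.
have := mdist_pos x y.
set A := apart _ _ _ _; have mA : measurable A by exact: measurable_apart.
have := fin_num_measure P A mA; move: (P A) => [p| |]// _ h1.
rewrite -EFinD !lee_fin -EFinM/= => h2 h3.
have e : e2 16 = 2 * e2 17 :> R by exact: e2S.
apply/andP; split; first by move: h3; rewrite e; lra.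
apply: (@le_trans _ _ (64 * mdist x y)).
  by have := le_trans (normr_ge0 _) h1; lra.
rewrite ler_wpM2r//; first exact: le_trans (normr_ge0 _) h1.
by rewrite -[leLHS]invrK lef_pV2// posrE ?invr_gt0.
Qed.

End slices_apart.

(** * Lipschitz curves in l1 *)

Section lipschitz_density.
Context {R : realType}.
Local Notation mu := (@lebesgue_measure R).
Local Notation Om := (measurableTypeR R).

Lemma integrable_subset (f : R -> R) (D : set R) : measurable D ->
  mu.-integrable setT (EFin \o f) -> mu.-integrable D (EFin \o f).
Proof. by move=> mD; exact: integrableS. Qed.

Definition primitive (f : R -> R) (x : R) : R :=
  (\int[mu]_(t in [set` `]-oo, x]]) f t)%R.

Lemma primitiveB f x y : mu.-integrable setT (EFin \o f) -> x <= y ->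
  primitive f y - primitive f x = (\int[mu]_(t in [set` `]x, y]]) f t)%R.
Proof.
move=> intf xy; rewrite /primitive Rintegral_itvB//.
exact: integrable_subset.
Qed.

Lemma primitive_derivable (f : R -> R) : mu.-integrable setT (EFin \o f) ->
  {ae mu, forall x, derivable (primitive f) x 1 /\ derive1 (primitive f) x = f x}.
Proof.
move=> intf; apply: FTC1Ny => [y|]; first exact: integrable_subset.
by apply: open_integrable_locally => //; exact: openT.
Qed.

Lemma stieltjes_itv (f : cumulative R R) x y : x <= y ->
  lebesgue_stieltjes_measure f `]x, y] = (f y - f x)%:E.
Proof.
move=> xy; rewrite /lebesgue_stieltjes_measure/= /measure_extension/=.
rewrite measurable_mu_extE/=; first exact: wlength_itv_bnd.
exact: is_ocitv.
Qed.

Section stieltjes.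
Variables (G : R -> R).
Hypotheses (ndG : {homo G : x y / x <= y}) (ndG' : {homo (fun x => x - G x) : x y / x <= y}).

Let lipG x y : `|G x - G y| <= `|x - y|.
Proof.
wlog xy : x y / x <= y.
  by move=> wl; have [/wl//|/ltW/wl] := leP x y; rewrite distrC (distrC y).
rewrite !ler0_norm ?subr_le0 ?ndG//.
by have := ndG' xy; lra.
Qed.

Let rcG : right_continuous G.
Proof.
apply: right_continuousW => x; apply/cvgrPdist_le => e e0; near=> y.
apply: le_trans (lipG x y) _; near: y.
have /cvgrPdist_le/(_ _ e0) : (fun y : R => y) @ x --> x by exact: cvg_id.
exact.
Unshelve. all: by end_near. Qed.

Let rcG' : right_continuous (fun x => x - G x).
Proof.
move=> x; apply: cvgB; last exact: rcG.
exact: cvg_within_filter cvg_id.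
Qed.

Let cG : cumulative R R := HB.pack G (isCumulative.Build R _ R G ndG rcG).
Let cG' : cumulative R R :=
  HB.pack (fun x => x - G x) (isCumulative.Build R _ R _ ndG' rcG').

Let mG := lebesgue_stieltjes_measure cG.

(** The Stieltjes measures of [G] and of [id - G] add up to Lebesgue measure. *)
Let mG_le A : measurable A -> (mG A <= mu A)%E.
Proof.
pose m := measure_add (lebesgue_stieltjes_measure cG) (lebesgue_stieltjes_measure cG').
have mE B : m B = (mG B + lebesgue_stieltjes_measure cG' B)%E by exact: measure_addE.
move=> mA; rewrite /lebesgue_measure (@lebesgue_stieltjes_measure_unique R idfun m)//.
  by rewrite [leRHS]mE leeDl.
move=> _ [[x y] _ <-]; rewrite [RHS]mE.
have [yx|xy] := ltP y x.
  by rewrite set_itv_ge ?measure0 ?adde0// bnd_simp -leNgt ltW.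
rewrite [LHS](stieltjes_itv idfun xy) [X in (X + _)%E](stieltjes_itv cG xy).
rewrite [X in (_ + X)%E](stieltjes_itv cG' xy).
by rewrite -EFinD; congr EFin => /=; ring.
Qed.

Lemma stieltjes_density a b : exists g : R -> R,
  mu.-integrable setT (EFin \o g) /\
  forall x y, a <= x -> x <= y -> y <= b ->
    G y - G x = (\int[mu]_(t in [set` `]x, y]]) g t)%R.
Proof.
have mab : measurable (`]a, b]%classic : set Om) by exact: measurable_itv.
have nu_fin : fin_num_fun (mrestr (lebesgue_stieltjes_measure cG) mab).
  move=> A mA; rewrite ge0_fin_numE//; apply: (@le_lt_trans _ _ (mu `]a, b])).
    apply: (@le_trans _ _ (mG `]a, b])); last exact: mG_le.
    by apply: le_measure; rewrite ?inE//; exact: measurableI.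
  by rewrite lebesgue_measure_itv; case: ifP => // _; rewrite -EFinB ltry.
pose nuf : {finite_measure set Om -> \bar R} := HB.pack (mrestr (lebesgue_stieltjes_measure cG) mab)
  (Measure_isFinite.Build _ _ _ (mrestr (lebesgue_stieltjes_measure cG) mab) nu_fin).
have dom : nuf `<< mu.
  apply/null_content_dominatesP => A mA A0; apply/eqP; rewrite eq_le measure_ge0 andbT.
  rewrite -A0; apply: (@le_trans _ _ (mG A)); last exact: mG_le.
  by apply: le_measure; rewrite ?inE//; exact: measurableI.
have [g [g0 gfin intg gE]] := radon_nikodym_sigma_finite dom.
have gg t : (fine (g t))%:E = g t by rewrite fineK.
exists (fine \o g); split.
  by rewrite (_ : EFin \o _ = g)//; apply/funext => t /=.
move=> x y ax xy yb; apply: EFin_inj; rewrite /Rintegral.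
under eq_integral do rewrite gg.
have mxy : measurable (`]x, y]%classic : set Om) by exact: measurable_itv.
rewrite -(gE _ mxy) fineK; last exact: (nu_fin _ mxy).
rewrite -(stieltjes_itv cG xy)/= /mrestr; congr mG; apply/seteqP; split=> t /=; last by case.
rewrite !in_itv/= => /andP[xt ty]; rewrite xt ty; split=> //.
by rewrite (le_lt_trans ax xt) (le_trans ty yb).
Qed.

End stieltjes.

(** After scaling, adding the identity and halving turns [F] into a function whose
    increments lie between 0 and those of the identity. *)
Lemma lipschitz_density (F : R -> R) (L a b : R) : 0 < L ->
  (forall x y, `|F x - F y| <= L * `|x - y|) ->
  exists f : R -> R, mu.-integrable setT (EFin \o f) /\
    forall x y, a <= x -> x <= y -> y <= b ->
      F y - F x = (\int[mu]_(t in [set` `]x, y]]) f t)%R.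
Proof.
move=> L0 FL; pose G x := (F x / L + x) / 2.
have FL' x y : x <= y -> F x / L - F y / L <= y - x /\ F y / L - F x / L <= y - x.
  move=> xy; have := FL y x; rewrite (ger0_norm (_ : 0 <= y - x)) ?subr_ge0//.
  rewrite ler_norml => /andP[h1 h2]; rewrite -!mulrBl !ler_pdivrMr//.
  by split; rewrite mulrC; lra.
have [|x y /FL'[h1 h2]|g [intg gE]] := @stieltjes_density G _ _ a b.
- by move=> x y xy; have [h1 h2] := FL' _ _ xy; rewrite /G; lra.
- by rewrite /G; lra.
have mab : measurable (`]a, b]%classic : set Om) by exact: measurable_itv.
have int1 : mu.-integrable setT (EFin \o (\1_(`]a, b]%classic) : R -> R)).
  exact: integrable_indic_itv.
have intLg : mu.-integrable setT (EFin \o (fun t => (2 * L) * g t)).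
  rewrite (_ : _ \o _ = (fun t => (2 * L)%:E * (g t)%:E)%E)//.
  exact: integrableZl.
have intL1 : mu.-integrable setT (EFin \o (fun t => L * \1_(`]a, b]%classic) t)).
  rewrite (_ : _ \o _ = (fun t => L%:E * (\1_(`]a, b]%classic) t)%:E)%E)//.
  exact: integrableZl.
exists (fun t => (2 * L) * g t - L * \1_(`]a, b]%classic) t); split.
  rewrite (_ : _ \o _ = ((EFin \o (fun t => ((2 * L) * g t)%R)) \-
     (EFin \o (fun t => (L * \1_(`]a, b]%classic) t)%R)))%E)//.
  exact: integrableB.
move=> x y ax xy yb.
have mxy : measurable (`]x, y]%classic : set Om) by exact: measurable_itv.
rewrite RintegralB//; [|exact: integrable_subset..].
rewrite !RintegralZl//; [|exact: integrable_subset..].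
rewrite -gE// (_ : \int[mu]_(t in _) _ = y - x).
  by rewrite /G; field; rewrite gt_eqF.
rewrite /Rintegral integral_indic//= (_ : _ `&` _ = `]x, y]%classic).
  rewrite lebesgue_measure_itv/= lte_fin; case: ltP => //= yx.
  by apply/esym; lra.
apply/seteqP; split=> t /=; first by case.
rewrite !in_itv/= => /andP[xt ty]; rewrite xt ty; split=> //.
by rewrite (le_lt_trans ax xt) (le_trans ty yb).
Qed.

End lipschitz_density.

Section l1_differentiability.
Context {R : realType}.
Local Notation mu := (@lebesgue_measure R).
Local Notation Om := (measurableTypeR R).

Definition quotient (F : R -> R) (t s : R) : R := s^-1 * (F (s + t) - F t).

Lemma quotient_cvg (F : R -> R) (t l : R) : derivable F t 1 -> derive1 F t = l ->
  quotient F t s @[s --> 0^'] --> l.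
Proof.
move=> dF <-; rewrite derive1E; have /cvg_ex[l' cl'] := dF.
have -> : 'D_1 F t = l' by exact: (cvg_lim (@Rhausdorff R) cl').
have -> : quotient F t = (fun s => s^-1 *: (F (s *: 1 + t) - F t)).
  by apply/funext => s; rewrite /quotient [s *: 1]mulr1.
exact: cl'.
Qed.

Lemma near_shift (t : R) (Q : R -> Prop) :
  (\forall y \near t, Q y) -> \forall s \near 0^', Q (s + t).
Proof.
move=> Qt; apply: cvg_within.
have : (fun s : R => s + t) @ (0 : R) --> (0 + t : R).
  by apply: cvgD; [exact: cvg_id|exact: cvg_cst].
by rewrite add0r; apply.
Qed.

(** Finitely many coordinates converge together; the tails of the difference
    quotients are bounded by those of a real function of small derivative. *)
Lemma l1_derivable (f : R -> l1 R) (t : R) (phi : l1 R) :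
  (forall i, quotient (fun y => f y i) t s @[s --> 0^'] --> phi i) ->
  (forall e : R, 0 < e -> exists N (D : R -> R) (d : R),
    [/\ quotient D t s @[s --> 0^'] --> d, `|d| <= e,
        forall M, \sum_(N <= i < M) `|phi i| <= e &
        \forall s \near 0^', forall M,
          \sum_(N <= i < M) `|f (s + t) i - f t i| <= `|D (s + t) - D t|]) ->
  derivable f t 1.
Proof.
move=> fphi tails; apply/cvg_ex; exists phi; apply/cvgrPdist_le => e e0.
have e4 : 0 < e / 4 by rewrite divr_gt0.
have [N [D [d [Dd dle phile fD]]]] := tails _ e4.
(* The first [N] coordinates converge. *)
have head : \sum_(0 <= i < N) `|phi i - quotient (fun y => f y i) t s| @[s --> 0^'] --> (0 : R).
  rewrite [X in _ --> X](_ : _ = \sum_(0 <= i < N) `|phi i - phi i|); last first.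
    by rewrite big1// => i _; rewrite subrr normr0.
  apply: cvg_big => [|i _]; first exact: add_continuous.
  by apply: cvg_norm; apply: cvgB; [exact: cvg_cst|exact: fphi].
have {}head : \forall s \near 0^', \sum_(0 <= i < N) `|phi i - quotient (fun y => f y i) t s| <= e / 4.
  have /cvgrPdist_le/(_ _ e4) := head; apply: filterS => s.
  by rewrite sub0r normrN; apply: le_trans; exact: ler_norm.
have {}Dd : \forall s \near 0^', `|quotient D t s| <= e / 2.
  have /cvgrPdist_le/(_ _ e4) := Dd; apply: filterS => s h.
  have := ler_normB d (d - quotient D t s).
  by rewrite subKr; lra.
near=> s; apply: (@l1norm_le R (phi - s^-1 *: (f (s *: 1 + t) - f t))) => n.
have -> : s *: 1 + t = s + t by rewrite [s *: 1]mulr1.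
have -> : \sum_(0 <= i < n) `|(phi - s^-1 *: (f (s + t) - f t)) i| =
    \sum_(0 <= i < n) `|phi i - quotient (fun y => f y i) t s| by [].
apply: (@le_trans _ _ (\sum_(0 <= i < N + n) `|phi i - quotient (fun y => f y i) t s|)).
  rewrite [leRHS](big_cat_nat (n := n)) ?leq_addl//= lerDl.
  by apply: sumr_ge0.
rewrite (big_cat_nat (n := N)) ?leq_addr//=.
have -> : e = e / 4 + (e / 4 + e / 2) by field.
apply: lerD; first by near: s.
apply: (@le_trans _ _ (\sum_(N <= i < N + n) (`|phi i| + `|quotient (fun y => f y i) t s|))).
  by apply: ler_sum => i _; exact: ler_normB.
rewrite big_split/=; apply: lerD; first exact: phile.
apply: (@le_trans _ _ `|quotient D t s|); last by near: s.
rewrite /quotient normrM.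
under eq_bigr do rewrite normrM.
rewrite -mulr_sumr ler_wpM2l//.
by move: (N + n)%N; near: s.
Unshelve. all: by end_near. Qed.

Section lipschitz_curve.
Variables (f : R -> l1 R) (L a b : R).
Hypotheses (L0 : 0 < L) (fL : forall x y, `|f x - f y| <= L * `|x - y|).

Let coord_lip i x y : `|f x i - f y i| <= L * `|x - y|.
Proof. exact: le_trans (l1norm_coord (f x - f y) i) (fL x y). Qed.

Let sum_lip N x y : \sum_(0 <= i < N) `|f x i - f y i| <= L * `|x - y|.
Proof. exact: le_trans (l1norm_ge (f x - f y) N) (fL x y). Qed.

Let near_ab t : a < t -> t < b -> \forall s \near 0^', a < s + t < b.
Proof.
move=> at_ tb; apply: (@near_shift t (fun y => a < y < b)).
near=> y; apply/andP; split; near: y.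
- exact: lt_nbhsr.
- exact: lt_nbhsl.
Unshelve. all: by end_near. Qed.

Let quotient_density (k : R -> R) i t : mu.-integrable setT (EFin \o k) ->
  (forall x y, a < x -> x <= y -> y < b ->
    f y i - f x i = (\int[mu]_(u in [set` `]x, y]]) k u)%R) ->
  a < t -> t < b ->
  derivable (primitive k) t 1 /\ derive1 (primitive k) t = k t ->
  quotient (fun y => f y i) t s @[s --> 0^'] --> k t.
Proof.
move=> intk kE at_ tb [dk dkt]; have := quotient_cvg dk dkt.
apply: cvg_trans; apply: near_eq_cvg; near=> s; rewrite /quotient; congr (_ * _).
have /andP[as_ sb] : a < s + t < b by near: s; exact: near_ab.
suff -> : f (s + t) i - f t i = primitive k (s + t) - primitive k t by [].
have [st|/ltW st] := leP t (s + t).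
  by rewrite (kE _ _ at_ st sb) primitiveB.
apply: oppr_inj; rewrite !opprB (kE _ _ as_ st tb) primitiveB//.
Unshelve. all: by end_near. Qed.

(** Almost everywhere the densities are limits of difference quotients, whose sums
    the Lipschitz constant bounds. On the remaining null set they are replaced by
    zero, so that the bound holds everywhere. *)
Lemma l1_density : exists k : nat -> R -> R,
  [/\ forall i, mu.-integrable setT (EFin \o k i),
      forall N t, \sum_(0 <= i < N) `|k i t| <= L * \1_(`]a, b[%classic) t &
      forall i x y, a < x -> x <= y -> y < b ->
        f y i - f x i = (\int[mu]_(u in [set` `]x, y]]) k i u)%R].
Proof.
have /choice[g gP] := fun i => @lipschitz_density R (fun y => f y i) L a b L0 (coord_lip i).
have intg i := (gP i).1.
have gE i x y : a < x -> x <= y -> y < b ->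
    f y i - f x i = (\int[mu]_(u in [set` `]x, y]]) g i u)%R.
  by move=> /ltW ax xy /ltW yb; exact: (gP i).2.
have mg i : measurable_fun setT (g i : Om -> R).
  by move: (measurable_int _ (intg i)) => /measurable_EFinP.
pose A : set Om := `]a, b[%classic `&` \bigcap_N [set t | \sum_(0 <= i < N) `|g i t| <= L].
have mA : measurable A.
  apply: measurableI; first exact: measurable_itv.
  apply: bigcapT_measurable => N; rewrite -[X in measurable X]setTI.
  apply: measurable_fun_le => //; apply: measurable_sum => i.
  exact: measurableT_comp.
have ae_A : {ae mu, forall t, a < t < b -> A t}.
  have : {ae mu, forall t, forall i, derivable (primitive (g i)) t 1 /\
      derive1 (primitive (g i)) t = g i t}.
    by apply: ae_foralln => i; exact: primitive_derivable.
  apply: filterS; first exact: (ae_filter_ringOfSetsType mu).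
  move=> t dt /andP[at_ tb]; split; first by rewrite /= in_itv/= at_ tb.
  move=> N _ /=.
  have cq : \sum_(0 <= i < N) `|quotient (fun y => f y i) t s| @[s --> 0^'] -->
      \sum_(0 <= i < N) `|g i t|.
    apply: cvg_big => [|i _]; first exact: add_continuous.
    by apply: cvg_norm; exact: quotient_density (gE i) at_ tb (dt i).
  apply: (cvgr_to_le cq); near=> s.
  have s0 : s != 0 by near: s; exact: nbhs_dnbhs_neq.
  rewrite /quotient; under eq_bigr do rewrite normrM.
  rewrite -mulr_sumr normfV ler_pdivrMl ?normr_gt0//.
  by apply: le_trans (sum_lip N (s + t) t) _; rewrite addrK mulrC.
have mgA i : measurable_fun (setT : set Om) ((fun t => g i t * \1_A t) : Om -> R).
  by apply: measurable_funM; [exact: mg|exact: measurable_indic].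
exists (fun i t => g i t * \1_A t); split.
- move=> i; apply: le_integrable (intg i) => //.
    by apply/measurable_EFinP; exact: mgA.
  move=> t _ /=; rewrite lee_fin normrM ler_piMr// indicE.
  by case: (_ \in _); rewrite ?normr1 ?normr0.
- move=> N t; under eq_bigr do rewrite normrM.
  rewrite -mulr_suml !indicE; have [/set_mem[tab tN]|] := boolP (t \in A).
    by rewrite mem_set// normr1 !mulr1; exact: tN.
  by rewrite normr0 mulr0 => _; rewrite mulr_ge0// ltW.
- move=> i x y ax xy yb; rewrite (gE i x y ax xy yb) /Rintegral; congr fine.
  apply: ae_eq_integral; first exact: measurable_itv.
  + by apply: measurable_funTS; exact/measurable_EFinP.
  + by apply: measurable_funTS; apply/measurable_EFinP; exact: mgA.
  + move: ae_A; apply: filterS; first exact: (ae_filter_ringOfSetsType mu).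
    move=> t tA; rewrite /= in_itv/= => /andP[xt ty].
    rewrite indicE mem_set ?mulr1//; apply: tA.
    by rewrite (lt_trans ax xt) (le_lt_trans ty yb).
Unshelve. all: by end_near. Qed.

(** The function that dominates the tails beyond [N] is the primitive of [s N], the
    tail of the sum of the densities; at almost every point its derivative is [s N],
    which tends to 0. *)
Lemma l1_derivable_ae : {ae mu, forall t, a < t < b -> derivable f t 1}.
Proof.
have [k [intk kL kE]] := l1_density.
have mk i : measurable_fun (setT : set Om) (k i : Om -> R).
  by move: (measurable_int _ (intk i)) => /measurable_EFinP.
have sk t := summable_seq_bounded (fun N => kL N t).
pose S t := limn [normed series (k ^~ t)].
have cS t : (fun n => \sum_(0 <= i < n) `|k i t|) @ \oo --> S t.
  by have /asboolP := (sk t).1.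
have mS : measurable_fun (setT : set Om) (S : Om -> R).
  apply: (@measurable_fun_cvg _ Om R setT (fun n t => \sum_(0 <= i < n) `|k i t|)) => [m|t _].
    by apply: measurable_sum => i; apply: measurableT_comp => //; exact: mk.
  exact: cS.
pose s N t := S t - \sum_(0 <= i < N) `|k i t|.
have s0 N t : 0 <= s N t by rewrite subr_ge0; exact: summable_seq_le (sk t).1.
have tail N M t : \sum_(N <= i < M) `|k i t| <= s N t.
  have [NM|/ltnW MN] := leqP N M; last by rewrite big_geq.
  rewrite lerBrDl -(big_cat_nat (n := N))//; exact: summable_seq_le (sk t).1.
have int1 : mu.-integrable setT (EFin \o (fun t => L * \1_(`]a, b[%classic) t)).
  rewrite (_ : _ \o _ = (fun t => L%:E * (\1_(`]a, b[%classic) t)%:E)%E)//.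
  by apply: integrableZl => //; exact: integrable_indic_itv.
have ints N : mu.-integrable setT (EFin \o s N).
  apply: le_integrable int1 => //.
    apply/measurable_EFinP; apply: measurable_funB => //; apply: measurable_sum => i.
    by apply: measurableT_comp => //; exact: mk.
  move=> t _ /=; rewrite lee_fin (ger0_norm (s0 N t)); apply: le_trans (ler_norm _).
  apply: le_trans (sk t).2; rewrite /s lerBlDr lerDl; exact: sumr_ge0.
have intn i : mu.-integrable setT (EFin \o (fun t => `|k i t|)).
  exact: (integrable_abse (intk i)).
have intsum N M : mu.-integrable setT (EFin \o (fun t => \sum_(N <= i < M) `|k i t|)).
  apply: le_integrable (ints N) => //.
    apply/measurable_EFinP; apply: measurable_sum => i.
    by apply: measurableT_comp => //; exact: mk.
  move=> t _ /=; rewrite lee_fin !ger0_norm ?tail//; exact: sumr_ge0.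
have incr N M x y : a < x -> x <= y -> y < b ->
    \sum_(N <= i < M) `|f y i - f x i| <= primitive (s N) y - primitive (s N) x.
  move=> ax xy yb; have mxy : measurable (`]x, y]%classic : set Om) by exact: measurable_itv.
  rewrite primitiveB//.
  apply: (@le_trans _ _ (\int[mu]_(t in `]x, y]) \sum_(N <= i < M) `|k i t|)); last first.
    apply: le_Rintegral; [exact: mxy|exact: integrable_subset|exact: integrable_subset|].
    by move=> t _; exact: tail.
  elim: M => [|M IH]; first by rewrite big_geq//; apply: Rintegral_ge0 => t _; rewrite big_geq.
  have [NM|MN] := leqP N M; last first.
    by rewrite big_geq//; apply: Rintegral_ge0 => t _; rewrite big_geq.
  rewrite big_nat_recr//=.
  have -> : (fun t => \sum_(N <= i < M.+1) `|k i t|) =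
      (fun t => \sum_(N <= i < M) `|k i t| + `|k M t|).
    by apply/funext => t; rewrite big_nat_recr.
  rewrite RintegralD//; [|exact: integrable_subset..].
  apply: lerD => //; rewrite (kE M _ _ ax xy yb); apply: le_normr_Rintegral => //.
  exact: integrable_subset.
have dk : {ae mu, forall t, forall i, derivable (primitive (k i)) t 1 /\
    derive1 (primitive (k i)) t = k i t}.
  by apply: ae_foralln => i; exact: primitive_derivable.
have ds : {ae mu, forall t, forall N, derivable (primitive (s N)) t 1 /\
    derive1 (primitive (s N)) t = s N t}.
  by apply: ae_foralln => N; exact: primitive_derivable.
move: dk ds; apply: filterS2; first exact: (ae_filter_ringOfSetsType mu).
move=> t dk ds /andP[at_ tb]; apply: (@l1_derivable f t (L1seq (sk t).1)) => [i|e e0] /=.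
  exact: quotient_density (kE i) at_ tb (dk i).
have /cvgrPdist_le/(_ _ e0)[N _ /(_ N (leqnn N)) sN] := cS t.
exists N, (primitive (s N)), (s N t); split=> [|//|M|].
- by have [] := ds N; exact: quotient_cvg.
- apply: le_trans (tail N M t) _; exact: le_trans (ler_norm _) sN.
near=> u => M; have /andP[au ub] : a < u + t < b by near: u; exact: near_ab.
have [tu|/ltW ut] := leP t (u + t).
  apply: le_trans (incr N M _ _ at_ tu ub) _; exact: ler_norm.
under eq_bigr do rewrite distrC.
rewrite distrC; apply: le_trans (incr N M _ _ au ut tb) _; exact: ler_norm.
Unshelve. all: by end_near. Qed.

End lipschitz_curve.

Theorem l1_radon_nikodym : radon_nikodym_property (l1 R).
Proof.
move=> f [L fL].
have L0 : 0 < `|L| + 1 by rewrite ltr_wpDl.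
have {}fL x y : `|f x - f y| <= (`|L| + 1) * `|x - y|.
  have := fL x y; rewrite /norm_dist => h; apply: (le_trans h).
  by rewrite ler_wpM2r//; apply: le_trans (ler_norm L) _; rewrite lerDl.
have : {ae mu, forall t, forall n, - n%:R < t < n%:R -> derivable f t 1}.
  by apply: ae_foralln => n; exact: l1_derivable_ae L0 fL.
apply: filterS; first exact: (ae_filter_ringOfSetsType mu).
move=> t /(_ (Num.bound `|t|)) dt; apply/derivable1_diffP; apply: dt.
by rewrite -ltr_norml; have := archi_boundP (normr_ge0 t).
Qed.

End l1_differentiability.

Theorem corollary1p5 (R : realType) :
  radon_nikodym_property (l1 R) /\
  exists (X : pmetricType R) (nu : {measure set (borel X) -> \bar R}),
    [/\ compact [set: X],
        Ahlfors_regular nu /\ doubling nu,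
        Poincare_inequality nu,
        bilipschitz_embeds_in_L1 X &
        forall V : completeNormedModType R, radon_nikodym_property V ->
          ~ bilipschitz_embeds_in_Banach X V].
Proof.
split; first exact: l1_radon_nikodym.
exists (laakso_pmetric R), (nu : {measure set (borel (laakso R)) -> \bar R}).
split; [exact: laakso_compact|split|exact: laakso_Poincare|exact: laakso_embeds_L1|].
- exact: nu_Ahlfors.
- exact: nu_doubling.
- by move=> V; exact: laakso_not_embeds_RNP.
Qed.
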